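(* For $d\ge4$ let $\Sigma_d$ be the simplex whose $d+1$ vertices are independent standard Gaussian vectors in $\mathbb R^d$. There is an absolute constant $c>0$ such that, for every $d\ge4$, \[\Pr\left(\Sigma_d\text{ has a degenerating LEB branch}\right)\ \ge\ 1-e^{-cd}.\] In fact, the same lower bound $1-e^{-cd}$ holds for the probability that $\Sigma_d$ belongs to the interior of the set of simplices having a degenerating LEB branch. Moreover, the entire refinement tree of $\Sigma_d$ is tie-free almost surely.
   Context: A nondegenerate $d$-simplex is given by $d+1$ affinely independent points of $\mathbb R^d$ (the Gaussian vertices are affinely independent almost surely). The interior is taken in the space $(\mathbb R^d)^{d+1}$ of vertex configurations. Bisecting a simplex at an edge $p_ip_j$ produces two children: one in which $p_i$ is replaced by the midpoint $\tfrac12(p_i+p_j)$ and one in which $p_j$ is replaced by it, the other vertices being unchanged. An LEB (Longest Edge Bisection) branch of $\Delta$ is an infinite sequence $(\Delta_n)_{n\ge0}$ with $\Delta_0=\Delta$ such that each $\Delta_{n+1}$ is one of the two children obtained by bisecting $\Delta_n$ at some longest edge of $\Delta_n$ (any longest edge and either child may be chosen). It degenerates if $\vartheta_d(\Delta_n)=\operatorname{vol}_d(\Delta_n)/\operatorname{diam}(\Delta_n)^d\to0$ as $n\to\infty$. The refinement tree of $\Delta$ consists of all simplices occurring in LEB branches of $\Delta$; it is tie-free if every simplex in it has a unique longest edge. *)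

(* Defs.v *)
From HB Require Import structures.
From mathcomp Require Import all_boot all_order all_algebra.
From mathcomp Require Import all_classical all_reals all_analysis.
Import Order.TTheory GRing.Theory Num.Theory.
Import numFieldNormedType.Exports.

Set Implicit Arguments.
Unset Strict Implicit.
Unset Printing Implicit Defensive.

Local Open Scope classical_set_scope.
Local Open Scope ring_scope.

(* A vertex configuration in (R^d)^(d+1) is a matrix p : 'M[R]_(d.+1, d) whose
   rows are the vertices.  The topology that MathComp-Analysis puts on matrices
   is the product topology. *)

(* MathComp-Analysis equips 'rV[R]_d with the sup norm, hence a separate
   definition of the Euclidean one. *)
Definition enorm (R : realType) (d : nat) (x : 'rV[R]_d) : R :=
  Num.sqrt (\sum_(j < d) x 0 j ^+ 2).

Definition edge_length (R : realType) (d : nat) (p : 'M[R]_(d.+1, d))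
    (i j : 'I_d.+1) : R :=
  enorm (row i p - row j p).

Definition edge_mx (R : realType) (d : nat) (p : 'M[R]_(d.+1, d)) : 'M[R]_d :=
  \matrix_(i < d) (row (lift ord0 i) p - row ord0 p).

Definition nondegenerate (R : realType) (d : nat) (p : 'M[R]_(d.+1, d)) : bool :=
  row_free (edge_mx p).

Definition simplex_hull (R : realType) (d : nat) (p : 'M[R]_(d.+1, d)) :
    set 'rV[R]_d :=
  [set x | exists a : 'rV[R]_d.+1,
    [/\ forall i, 0 <= a 0 i, \sum_i a 0 i = 1 & x = a *m p]].

Definition simplex_vol (R : realType) (d : nat) (p : 'M[R]_(d.+1, d)) : R :=
  `|\det (edge_mx p)| / d`!%:R.

Definition simplex_diam (R : realType) (d : nat) (p : 'M[R]_(d.+1, d)) : R :=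
  sup [set r | exists x y,
    [/\ simplex_hull p x, simplex_hull p y & r = enorm (x - y)]].

Definition theta (R : realType) (d : nat) (p : 'M[R]_(d.+1, d)) : R :=
  simplex_vol p / simplex_diam p ^+ d.

Definition longest_edge (R : realType) (d : nat) (p : 'M[R]_(d.+1, d))
    (i j : 'I_d.+1) : Prop :=
  i != j /\ forall k l, k != l -> edge_length p k l <= edge_length p i j.

Definition bisect (R : realType) (d : nat) (p : 'M[R]_(d.+1, d))
    (i j : 'I_d.+1) : 'M[R]_(d.+1, d) :=
  \matrix_(k < d.+1)
    (if k == i then 2^-1 *: (row i p + row j p) else row k p).

Definition LEB_child (R : realType) (d : nat) (p q : 'M[R]_(d.+1, d)) : Prop :=
  exists i j, longest_edge p i j /\ (q = bisect p i j \/ q = bisect p j i).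

Definition LEB_branch (R : realType) (d : nat) (p : 'M[R]_(d.+1, d))
    (s : nat -> 'M[R]_(d.+1, d)) : Prop :=
  s 0%N = p /\ forall n, LEB_child (s n) (s n.+1).

Definition degenerates (R : realType) (d : nat)
    (s : nat -> 'M[R]_(d.+1, d)) : Prop :=
  theta (s n) @[n --> \oo] --> (0 : R).

Definition has_degenerating_branch (R : realType) (d : nat) :
    set 'M[R]_(d.+1, d) :=
  [set p | nondegenerate p /\ exists s, LEB_branch p s /\ degenerates s].

Definition refinement_tree (R : realType) (d : nat) (p : 'M[R]_(d.+1, d)) :
    set 'M[R]_(d.+1, d) :=
  [set q | exists s n, LEB_branch p s /\ s n = q].

(* An edge is an unordered pair of vertices, encoded by its indices i < j. *)
Definition unique_longest_edge (R : realType) (d : nat)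
    (p : 'M[R]_(d.+1, d)) : Prop :=
  exists! e : 'I_d.+1 * 'I_d.+1, (e.1 < e.2)%N /\ longest_edge p e.1 e.2.

Definition tie_free (R : realType) (d : nat) (p : 'M[R]_(d.+1, d)) : Prop :=
  forall q, refinement_tree p q -> unique_longest_edge q.

Definition mutually_independent (R : realType) (disp disp' : measure_display)
    (T : measurableType disp) (T' : measurableType disp') (P : probability T R)
    (I : finType) (X : I -> T -> T') : Prop :=
  forall (J : {set I}) (B : I -> set T'), (forall i, measurable (B i)) ->
    P (\bigcap_(i in [set` J]) X i @^-1` B i)
    = (\prod_(i in J) P (X i @^-1` B i))%E.

(* d.-tuple R carries the product sigma-algebra, that is, the Borel sets of
   R^d. *)
Definition standard_gaussian (R : realType) (disp : measure_display)
    (T : measurableType disp) (P : probability T R) (d : nat)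
    (X : {RV P >-> d.-tuple R}) : Prop :=
  (forall (j : 'I_d) (B : set R), measurable B ->
     pushforward P (fun w => tnth (X w) j) B = normal_prob 0 1 B)
  /\ mutually_independent P (fun (j : 'I_d) w => tnth (X w) j).

Definition random_simplex (R : realType) (disp : measure_display)
    (T : measurableType disp) (P : probability T R) (d : nat)
    (X : 'I_d.+1 -> {RV P >-> d.-tuple R}) (w : T) : 'M[R]_(d.+1, d) :=
  \matrix_(i < d.+1, j < d) tnth (X i w) j.

(* Agrees with P on measurable sets, and with the completion of P on
   P-measurable ones; the value of P itself outside the sigma-algebra is
   unconstrained. *)
Definition inner_probability (R : realType) (disp : measure_display)
    (T : measurableType disp) (P : probability T R) (A : set T) : \bar R :=
  ereal_sup [set P B | B in [set B | measurable B /\ B `<=` A]].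

(* Main.v *)
(* A bisection halves the volume. Follow a branch that bisects a fixed face with
   five vertices as prescribed as long as one of the edges of that face is a
   longest one, and otherwise moves an end of a longest edge outside the face.
   If the four-dimensional branch of the face degenerates, so does this one.

   Squared edge lengths transform linearly. For the points x + 2w, -2z - 4w,
   2z - y + 2w, y - w, -x/2 + 2w with suitable Gram data, three bisections act as
   (x, y, z, w) |-> (y, z, x/4, -w/2), so that nine of them multiply the diameter
   by 1/4 and the volume by 2^-9, which halves the ratio theta of the
   four-simplex. A winning strategy, found by computer search, leads from any
   nearly regular four-simplex, no matter which of its edges is the longest, to a
   neighbourhood of this configuration.

   Five independent Gaussian points are nearly regular with probability at least
   q > 0 uniformly in d: by Chebyshev's inequality for large d, and because a box
   around a regular configuration has positive probability for each small d. The
   floor((d + 1) / 5) disjoint blocks of five vertices are independent.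

   Since bisecting is an invertible linear map of the vertices, a tie in the
   refinement tree is the vanishing of a nonzero polynomial in the coordinates;
   there are countably many of them. *)
Require Import Defs.
From HB Require Import structures.
From mathcomp Require Import all_boot all_order all_algebra all_fingroup.
From mathcomp Require Import all_classical all_reals all_analysis.
From mathcomp Require Import measurable_realfun.
From mathcomp Require Import ring lra zify ssrZ.
Import Order.TTheory GRing.Theory Num.Theory.
Import numFieldNormedType.Exports.

Set Implicit Arguments.
Unset Strict Implicit.
Unset Printing Implicit Defensive.

Local Open Scope classical_set_scope.
Local Open Scope ring_scope.
Local Notation Z := BinNums.Z.

(** Ties are the obstacle that shapes the argument: in a position with several longest edges an
    arbitrarily small perturbation decides which one must be bisected. Hence everything is proved
    for neighbourhoods. A position is [robust] if the wanted branch exists from every semimetric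
    near it, and the strategy is verified backwards from its target, each position having a reply to
    every edge that a perturbation can make longest. Openness, on which the statement about the
    interior rests, is thereby built in. The target tolerates perturbations because the nine-step
    cycle restores x, y, z up to scale, while w, relative to that scale, is multiplied by -1/2: the
    points flatten into a 3-space, and the inequalities need checking only for the initial w, for
    its first image and on one box that holds all later ones. All comparisons concern linear forms
    in squared distances with rational coefficients, so they reduce to integer computations. For a
    face of a larger simplex the danger is that from some time on the face is never bisected again;
    a contraction estimate for longest edges excludes it. *)

Section SquaredDistances.
Variables (R : archiRealFieldType) (I : finType).
Implicit Types (D : I -> I -> R) (i j k l : I).

(** The median formula of Apollonius: vertex [i] moves to the midpoint of [i] and [j]. For [l = j]
    it gives [D i j / 4], since the diagonal vanishes. *)
Definition sqbis D i j : I -> I -> R := fun k l =>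
  if k == l then 0
  else if k == i then (D i l + D j l) / 2 - D i j / 4
  else if l == i then (D k i + D k j) / 2 - D i j / 4
  else D k l.

Definition semimetric D := (forall k l, D k l = D l k) /\ (forall k, D k k = 0).

Definition sqlongest D (e : I * I) :=
  e.1 != e.2 /\ forall k l, D k l <= D e.1 e.2.

Fixpoint sqrun D (e : nat -> I * I) n : I -> I -> R :=
  if n is n'.+1 then sqbis (sqrun D e n') (e n').1 (e n').2 else D.

Definition sqlen D e n : R := sqrun D e n (e n).1 (e n).2.

(* The squared volume of a simplex drops by a factor 4 at every bisection, so
   for four-dimensional simplices the second clause says that the ratio
   vol / diam^4 tends to 0. *)
Definition sqdegen D := exists e : nat -> I * I,
  (forall n, sqlongest (sqrun D e n) (e n)) /\
  (forall K, exists N, forall n, (N <= n)%N -> K <= 2 ^+ n * sqlen D e n ^+ 2).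

Lemma semimetric_sqbis D i j : semimetric D -> semimetric (sqbis D i j).
Proof.
move=> [sD zD]; split=> [k l|k]; last by rewrite /sqbis eqxx.
rewrite /sqbis (eq_sym l k); case: (eqVneq k l) => // kl.
case: (eqVneq k i) => [ki|ki]; case: (eqVneq l i) => [li|li] //.
- by rewrite ki li eqxx in kl.
- by rewrite (sD l i) (sD l j).
- by rewrite (sD i k) (sD j k).
Qed.

Lemma sqrunS D e n :
  sqrun D e n.+1 = sqrun (sqbis D (e 0%N).1 (e 0%N).2) (fun n => e n.+1) n.
Proof. by elim: n => //= n ->. Qed.

Lemma sqdegen_sqbis D i j : sqlongest D (i, j) -> sqdegen (sqbis D i j) ->
  sqdegen D.
Proof.
move=> lij [e [le ge]].
exists (fun n => if n is n'.+1 then e n' else (i, j)); split.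
  by case=> [//|n]; rewrite sqrunS /=; exact: le.
move=> K; have [N HN] := ge K; exists N.+1 => -[//|n] Nn.
rewrite /sqlen sqrunS /=.
(* The same lengths occur one step later, which only gains a factor 2. *)
apply: le_trans (HN n Nn) _; rewrite [2 ^+ n.+1]exprS -mulrA ler_peMl ?ler1n //.
by apply: mulr_ge0; [rewrite exprn_ge0|exact: sqr_ge0].
Qed.

Lemma sqbisZ c D i j :
  sqbis (fun k l => c * D k l) i j = fun k l => c * sqbis D i j k l.
Proof.
apply/funext => k; apply/funext => l; rewrite /sqbis.
case: (k == l); first by rewrite mulr0.
by case: (k == i); last case: (l == i); rewrite //=; field.
Qed.

Lemma sqdegenZ c D : 0 < c -> sqdegen D -> sqdegen (fun k l => c * D k l).
Proof.
move=> c0 [e [le ge]].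
have rE n : sqrun (fun k l => c * D k l) e n = fun k l => c * sqrun D e n k l.
  by elim: n => //= n ->; rewrite sqbisZ.
exists e; split=> [n|K].
  have [ne le'] := le n; split=> // k l.
  by rewrite rE ler_pM2l.
have [N HN] := ge (K / c ^+ 2); exists N => n /HN.
rewrite /sqlen rE ler_pdivrMr ?exprn_gt0 // => /le_trans; apply.
by rewrite exprMn; lra.
Qed.

Lemma sqdegen_relabel D (f : I -> I) : injective f ->
  sqdegen (fun k l => D (f k) (f l)) -> sqdegen D.
Proof.
move=> fI [e [le ge]].
pose e' n := (f (e n).1, f (e n).2).
have rE n k l : sqrun (fun k l => D (f k) (f l)) e n k l
    = sqrun D e' n (f k) (f l).
  elim: n k l => //= n IH k l; rewrite /sqbis !(inj_eq fI).
  by rewrite !IH.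
have [g fK gK] : bijective f by apply: injF_bij.
exists e'; split=> [n|K].
  have [ne le'] := le n; split; first by rewrite /= (inj_eq fI).
  by move=> k l; rewrite -(gK k) -(gK l) /= -!rE.
by have [N HN] := ge K; exists N => n /HN; rewrite /sqlen rE.
Qed.

End SquaredDistances.

(** * The self-similar spiral *)

Section Spiral.
Variable R : archiRealFieldType.

(** Inner products of the vectors x, y, z, w of the spiral. There are ten of them, as many as a
    four-simplex has edges, so every semimetric on five points has such parameters, realizable by
    vectors or not ([spiral_gramof]). *)
Record gram := Gram {
  gxx : R; gyy : R; gzz : R; gxy : R; gyz : R; gxz : R;
  gxw : R; gyw : R; gzw : R; gww : R }.

Definition upper (a01 a02 a03 a04 a12 a13 a14 a23 a24 a34 : R) (k l : 'I_5) : R :=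
  match nat_of_ord k, nat_of_ord l with
  | 0, 1 | 1, 0 => a01 | 0, 2 | 2, 0 => a02 | 0, 3 | 3, 0 => a03
  | 0, 4 | 4, 0 => a04 | 1, 2 | 2, 1 => a12 | 1, 3 | 3, 1 => a13
  | 1, 4 | 4, 1 => a14 | 2, 3 | 3, 2 => a23 | 2, 4 | 4, 2 => a24
  | 3, 4 | 4, 3 => a34 | _, _ => 0%R
  end%N.

(* Squared distances of the points x + 2w, - 2z - 4w, 2z - y + 2w, y - w,
   - x/2 + 2w. *)
Definition spiral (g : gram) : 'I_5 -> 'I_5 -> R :=
  let: Gram xx yy zz xy yz xz xw yw zw ww := g in
  upper
    (xx + 4 * zz + 36 * ww + 4 * xz + 12 * xw + 24 * zw)
    (xx + 4 * zz + yy - 4 * xz + 2 * xy - 4 * yz)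
    (xx + yy + 9 * ww - 2 * xy + 6 * xw - 6 * yw)
    (9 / 4 * xx)
    (16 * zz + yy + 36 * ww - 8 * yz + 48 * zw - 12 * yw)
    (4 * zz + yy + 9 * ww + 4 * yz + 12 * zw + 6 * yw)
    (4 * zz + xx / 4 + 36 * ww - 2 * xz + 24 * zw - 6 * xw)
    (4 * zz + 4 * yy + 9 * ww - 8 * yz + 12 * zw - 12 * yw)
    (4 * zz + yy + xx / 4 - 4 * yz + 2 * xz - xy)
    (yy + 9 * ww + xx / 4 - 6 * yw + xy - 3 * xw).

(* (x, y, z, w) |-> (y, z, x / 4, - w / 2) *)
Definition gstep (g : gram) : gram :=
  let: Gram xx yy zz xy yz xz xw yw zw ww := g in
  Gram yy zz (xx / 16) yz (xz / 4) (xy / 4)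
    (- (yw / 2)) (- (zw / 2)) (- (xw / 8)) (ww / 4).

Definition p0 : 'I_5 := @Ordinal 5 0 isT.
Definition p1 : 'I_5 := @Ordinal 5 1 isT.
Definition p2 : 'I_5 := @Ordinal 5 2 isT.
Definition p3 : 'I_5 := @Ordinal 5 3 isT.
Definition p4 : 'I_5 := @Ordinal 5 4 isT.

Lemma ord5P (P : 'I_5 -> Prop) : P p0 -> P p1 -> P p2 -> P p3 -> P p4 -> forall k, P k.
Proof.
move=> P0 P1 P2 P3 P4 [[|[|[|[|[|//]]]]] h].
- by rewrite (_ : Ordinal h = p0) //; apply: val_inj.
- by rewrite (_ : Ordinal h = p1) //; apply: val_inj.
- by rewrite (_ : Ordinal h = p2) //; apply: val_inj.
- by rewrite (_ : Ordinal h = p3) //; apply: val_inj.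
- by rewrite (_ : Ordinal h = p4) //; apply: val_inj.
Qed.

Lemma sqbis_upper0 a01 a02 a03 a04 a12 a13 a14 a23 a24 a34 :
  sqbis (upper a01 a02 a03 a04 a12 a13 a14 a23 a24 a34) p0 p1 =
  upper (a01 / 4) ((a02 + a12) / 2 - a01 / 4) ((a03 + a13) / 2 - a01 / 4)
    ((a04 + a14) / 2 - a01 / 4) a12 a13 a14 a23 a24 a34.
Proof.
apply/funext => k; apply/funext => l; move: k l.
by elim/ord5P; elim/ord5P; rewrite /sqbis -!val_eqE /upper /=; field.
Qed.

Lemma sqbis_upper1 a01 a02 a03 a04 a12 a13 a14 a23 a24 a34 :
  sqbis (upper a01 a02 a03 a04 a12 a13 a14 a23 a24 a34) p1 p2 =
  upper ((a01 + a02) / 2 - a12 / 4) a02 a03 a04 (a12 / 4)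
    ((a13 + a23) / 2 - a12 / 4) ((a14 + a24) / 2 - a12 / 4) a23 a24 a34.
Proof.
apply/funext => k; apply/funext => l; move: k l.
by elim/ord5P; elim/ord5P; rewrite /sqbis -!val_eqE /upper /=; field.
Qed.

Lemma sqbis_upper2 a01 a02 a03 a04 a12 a13 a14 a23 a24 a34 :
  sqbis (upper a01 a02 a03 a04 a12 a13 a14 a23 a24 a34) p2 p3 =
  upper a01 ((a02 + a03) / 2 - a23 / 4) a03 a04
    ((a12 + a13) / 2 - a23 / 4) a13 a14 (a23 / 4) ((a24 + a34) / 2 - a23 / 4) a34.
Proof.
apply/funext => k; apply/funext => l; move: k l.
by elim/ord5P; elim/ord5P; rewrite /sqbis -!val_eqE /upper /=; field.
Qed.

Definition edge5 (r : nat) : 'I_5 * 'I_5 :=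
  match r with 0 => (p0, p1) | 1 => (p1, p2) | _ => (p2, p3) end%N.

(** [shift5 k] is the old label of the vertex that plays the role [k] in the next round. The points
    y - w and - x/2 + 2w stay and become 0 and 1; the midpoints of the edges 01, 12, 23, which carry
    the labels 0, 1, 2, become 2, 4, 3. *)
Definition shift5 (k : 'I_5) : 'I_5 :=
  match nat_of_ord k with 0 => p3 | 1 => p4 | 2 => p0 | 3 => p2 | _ => p1 end%N.

Lemma shift5_inj : injective shift5.
Proof. by elim/ord5P; elim/ord5P. Qed.

Definition stage (D : 'I_5 -> 'I_5 -> R) (r : nat) := sqrun D edge5 r.

Lemma spiral_step g :
  (fun k l => stage (spiral g) 3 (shift5 k) (shift5 l)) = spiral (gstep g).
Proof.
case: g => xx yy zz xy yz xz xw yw zw ww.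
apply/funext => k; apply/funext => l; move: k l.
rewrite /stage /= sqbis_upper0 sqbis_upper1 sqbis_upper2.
by elim/ord5P; elim/ord5P; rewrite /upper /=; field.
Qed.

(** Integer coefficients are binary, so that [vm_compute] can carry out the finite checks; [zr]
    embeds them into the field. *)
Definition zr (z : Z) : R := (int_of_Z z)%:~R.

Lemma zrE x : zr x = (int_of_Z x)%:~R. Proof. by []. Qed.
Lemma zrD x y : zr (x + y) = zr x + zr y.
Proof. by rewrite /zr raddfD rmorphD. Qed.
Lemma zrB x y : zr (x - y) = zr x - zr y.
Proof. by rewrite /zr raddfB rmorphB. Qed.
Lemma zrM x y : zr (x * y) = zr x * zr y.
Proof. by rewrite /zr !rmorphM. Qed.
Lemma zrN x : zr (- x) = - zr x.
Proof. by rewrite /zr !rmorphN. Qed.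
Lemma zr_nat n : zr n%:R = n%:R.
Proof. by rewrite /zr !rmorph_nat. Qed.
Lemma zr0 : zr 0 = 0. Proof. by []. Qed.
Lemma zr1 : zr 1 = 1. Proof. by []. Qed.
Lemma zr_le x y : (x <= y) -> zr x <= zr y.
Proof. by move=> xy; rewrite /zr ler_int; lia. Qed.

(* Four times sqbis, on integers. *)
Definition zbis (M : nat -> nat -> Z) (i j k l : nat) : Z :=
  if k == l then 0
  else if k == i then 2 * (M i l + M j l) - M i j
  else if l == i then 2 * (M k i + M k j) - M i j
  else 4 * M k l.

(** Bisection is linear, so it acts separately on the coefficients [F m] of each parameter [g m];
    the factor [c] gathers the denominators, one 4 for every bisection. *)
Lemma sqbis_lin (D : 'I_5 -> 'I_5 -> R) c (g : nat -> R) (F : nat -> nat -> nat -> Z) i j :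
  (forall k l : 'I_5, c * D k l = \sum_(m < 10) g m * zr (F m k l)) ->
  forall k l : 'I_5,
    (4 * c) * sqbis D i j k l = \sum_(m < 10) g m * zr (zbis (F m) i j k l).
Proof.
move=> DE k l; rewrite /sqbis /zbis -val_eqE /=.
case: eqP => _; first by rewrite mulr0 big1 // => m _; rewrite /zr !mulr0.
have sE (x1 x2 x3 : nat -> Z) (d1 d2 d3 : R) :
    c * d1 = \sum_(m < 10) g m * zr (x1 m) ->
    c * d2 = \sum_(m < 10) g m * zr (x2 m) ->
    c * d3 = \sum_(m < 10) g m * zr (x3 m) ->
    4 * c * ((d1 + d2) / 2 - d3 / 4) =
    \sum_(m < 10) g m * zr (2 * (x1 m + x2 m) - x3 m).
  move=> e1 e2 e3; rewrite (_ : _ * _ = 2 * (c * d1 + c * d2) - c * d3); last by field.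
  rewrite e1 e2 e3 -big_split mulr_sumr -sumrB; apply: eq_bigr => m _ /=.
  rewrite zrB zrM zrD (_ : zr 2 = 2) //; ring.
rewrite -val_eqE /=; case: eqP => _; first exact: (sE (fun m => F m i l) (fun m => F m j l) (fun m => F m i j)).
rewrite -val_eqE /=; case: eqP => _; first exact: (sE (fun m => F m k i) (fun m => F m k j) (fun m => F m i j)).
rewrite -mulrA DE mulr_sumr; apply: eq_bigr => m _.
by rewrite zrM (_ : zr 4 = 4) //; ring.
Qed.

Definition comp (g : gram) (m : nat) : R :=
  nth 0 [:: gxx g; gyy g; gzz g; gxy g; gyz g; gxz g; gxw g; gyw g; gzw g; gww g] m.

Definition zsym (s : seq Z) (k l : nat) : Z :=
  match k, l with
  | 0, 1 | 1, 0 => nth 0%R s 0 | 0, 2 | 2, 0 => nth 0%R s 1 | 0, 3 | 3, 0 => nth 0%R s 2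
  | 0, 4 | 4, 0 => nth 0%R s 3 | 1, 2 | 2, 1 => nth 0%R s 4 | 1, 3 | 3, 1 => nth 0%R s 5
  | 1, 4 | 4, 1 => nth 0%R s 6 | 2, 3 | 3, 2 => nth 0%R s 7 | 2, 4 | 4, 2 => nth 0%R s 8
  | 3, 4 | 4, 3 => nth 0%R s 9 | _, _ => 0%R
  end%N.

(* Coefficients of 4 * spiral g, one list per coordinate of g. *)
Definition zspiral (m : nat) : nat -> nat -> Z := zsym (nth [::] [::
  [:: 4; 4; 4; 9; 0; 0; 1; 0; 1; 1];
  [:: 0; 4; 4; 0; 4; 4; 0; 16; 4; 4];
  [:: 16; 16; 0; 0; 64; 16; 16; 16; 16; 0];
  [:: 0; 8; -8; 0; 0; 0; 0; 0; -4; 4];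
  [:: 0; -16; 0; 0; -32; 16; 0; -32; -16; 0];
  [:: 16; -16; 0; 0; 0; 0; -8; 0; 8; 0];
  [:: 48; 0; 24; 0; 0; 0; -24; 0; 0; -12];
  [:: 0; 0; -24; 0; -48; 24; 0; -48; 0; -24];
  [:: 96; 0; 0; 0; 192; 48; 96; 48; 0; 0];
  [:: 144; 0; 36; 0; 144; 36; 144; 36; 0; 36]] m).

Lemma zspiralE g (k l : 'I_5) :
  4 * spiral g k l = \sum_(m < 10) comp g m * zr (zspiral m k l).
Proof.
case: g => xx yy zz xy yz xz xw yw zw ww.
move: k l; elim/ord5P; elim/ord5P; rewrite !big_ord_recr big_ord0 /= /upper /=;
  rewrite /comp /zspiral /zsym /= ?zrN ?zr_nat ?zr0 ?zr1; by field.
Qed.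

Fixpoint zstage (M : nat -> nat -> Z) r : nat -> nat -> Z :=
  if r is r'.+1 then zbis (zstage M r') r' r'.+1 else M.

Lemma zstageE g r (k l : 'I_5) : (r <= 3)%N ->
  4 ^+ r.+1 * stage (spiral g) r k l = \sum_(m < 10) comp g m * zr (zstage (zspiral m) r k l).
Proof.
elim: r k l => [|r IH] k l r3 /=; first by rewrite expr1 zspiralE.
rewrite exprS; case: r r3 IH => [|[|[|//]]] _ IH.
- by apply: (@sqbis_lin _ _ (comp g) (fun m => zstage (zspiral m) 0)) => k' l'; exact: IH.
- by apply: (@sqbis_lin _ _ (comp g) (fun m => zstage (zspiral m) 1)) => k' l'; exact: IH.
- by apply: (@sqbis_lin _ _ (comp g) (fun m => zstage (zspiral m) 2)) => k' l'; exact: IH.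
Qed.

End Spiral.

(** * Interval arithmetic on boxes of Gram parameters *)

Section Boxes.
Variable R : archiRealFieldType.
Local Notation zr := (@zr R).
Local Notation gram := (gram R).

(** The value at the corner of the box where a linear form with coefficients [c] is smallest. *)
Definition zlow (c l u : nat -> Z) : Z :=
  foldr (fun m a => (if 0 <= c m then c m * l m else c m * u m) + a) 0 (iota 0 10).

(** [K] is a common denominator that keeps the bounds integral. *)
Definition inbox (K : Z) (l u : nat -> Z) (x : nat -> R) : Prop :=
  forall m, (m < 10)%N -> zr (l m) <= zr K * x m <= zr (u m).

Lemma zlowP K l u x c : inbox K l u x ->
  zr (zlow c l u) <= zr K * \sum_(m < 10) x m * zr (c m).
Proof.
move=> b; rewrite mulr_sumr -(big_mkord xpredT (fun m => zr K * (x m * zr (c m)))).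
rewrite /index_iota subn0 /zlow.
have : {in iota 0 10, forall m, (m < 10)%N} by move=> m; rewrite mem_iota.
elim: (iota 0 10) => [|m s IH] s10; first by rewrite big_nil zr0.
rewrite big_cons /= zrD lerD //; last first.
  by apply: IH => k ks; apply: s10; rewrite inE ks orbT.
have /b/andP[lo hi] := s10 m (mem_head _ _).
rewrite mulrA [leRHS]mulrC; case: ifPn => c0; rewrite zrM.
  by rewrite ler_wpM2l // -(zr0 R) zr_le.
rewrite ler_wnM2l // -(zr0 R) zr_le //.
by rewrite ltW // ltNge.
Qed.

(** Two edges are compared through the difference of their coefficients as one linear form; separate
    bounds would discard their correlation. The last inequality says that the bisected edge has
    squared length at least 1. *)
Definition zlegal (K : Z) (l u : nat -> Z) : bool :=
  all (fun r =>
    let c k1 k2 m := zstage (zspiral m) r k1 k2 in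
    all (fun k1 => all (fun k2 =>
      0 <= zlow (fun m => c r r.+1 m - c k1 k2 m) l u) (iota 0 5)) (iota 0 5)
    && (4 ^+ r.+1 * K <= zlow (c r r.+1) l u)) (iota 0 3).

Definition legal (g : gram) : Prop := forall r, (r < 3)%N ->
  sqlongest (stage (spiral g) r) (edge5 r) /\
  1 <= stage (spiral g) r (edge5 r).1 (edge5 r).2.

Lemma zlegalP K l u g : (0 < K) -> inbox K l u (comp g) -> zlegal K l u -> legal g.
Proof.
move=> K0 b /allP ok r r3.
have K0' : 0 < zr K.
  rewrite lt_neqAle -{2}(zr0 R) zr_le ?ltW // andbT eq_sym zrE intr_eq0.
  by lia.
have /ok/andP[/allP le ge] : r \in iota 0 3 by rewrite mem_iota.
have [e1 e2] : nat_of_ord (edge5 r).1 = r /\ nat_of_ord (edge5 r).2 = r.+1.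
  by case: r r3 {ok le ge} => [|[|[|]]].
have E k1 k2 : 4 ^+ r.+1 * stage (spiral g) r k1 k2 =
    \sum_(m < 10) comp g m * zr (zstage (zspiral m) r k1 k2).
  by rewrite zstageE // ltnW.
have c0 : 0 < 4 ^+ r.+1 :> R by rewrite exprn_gt0.
have cK0 : 0 < zr K * 4 ^+ r.+1 by rewrite mulr_gt0.
split; last first.
  rewrite -(ler_pM2l cK0) mulr1 -mulrA E e1 e2.
  apply: (le_trans _ (zlowP (fun m => zstage (zspiral m) r r r.+1) b)).
  by apply: le_trans (zr_le R ge); rewrite zrM mulrC !zrE !rmorphXn /= lexx.
split; first by case: r r3 {ok le ge e1 e2 E c0 cK0} => [|[|[|]]].
move=> k1 k2; rewrite -subr_ge0 -(pmulr_rge0 _ cK0) -mulrA mulrBr !E e1 e2.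
rewrite -sumrB.
rewrite (eq_bigr (fun m : 'I_10 => comp g m * zr
  (zstage (zspiral m) r r r.+1 - zstage (zspiral m) r k1 k2))); last first.
  by move=> m _; rewrite zrB mulrBr.
apply: (le_trans _ (zlowP (fun m =>
  zstage (zspiral m) r r r.+1 - zstage (zspiral m) r k1 k2) b)).
rewrite -(zr0 R) zr_le //.
have k5 (k : 'I_5) : nat_of_ord k \in iota 0 5 by rewrite mem_iota ltn_ord.
have /allP le2 := le _ (k5 k1); exact: le2 _ (k5 k2).
Qed.

(** 16 is the common denominator of [gstep]. Products of w with x, y, z change sign, so their lower
    bounds come from upper ones; exchanging the arguments gives the upper bounds. *)
Definition zgstep (l u : nat -> Z) : nat -> Z := nth 0 [::
  16 * l 1; 16 * l 2; l 0; 16 * l 4; 4 * l 5; 4 * l 3;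
  - (8 * u 7); - (8 * u 8); - (2 * u 6); 4 * l 9].

Lemma inbox_gstep K l u g : inbox K l u (comp g) ->
  inbox (16 * K) (zgstep l u) (zgstep u l) (comp (gstep g)).
Proof.
move=> b [|[|[|[|[|[|[|[|[|[|//]]]]]]]]]] _; rewrite /zgstep /= !zrM ?zrN ?zrM;
  case: g b => xx yy zz xy yz xz xw yw zw ww b.
all: rewrite /comp /= ?zr_nat.
all: [> have := b 1 isT | have := b 2 isT | have := b 0 isT | have := b 4 isT
      | have := b 5 isT | have := b 3 isT | have := b 7 isT | have := b 8 isT
      | have := b 6 isT | have := b 9 isT].
all: rewrite /comp /= => /andP[? ?]; apply/andP; split; lra.
Qed.

(** The boxes, with denominator 3240 = 45 * 72, share the x, y, z part: the Gram parameters of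
    [terminal] with tolerance 1/72. They differ in w: [box0] is centred at [terminal], [box1] is its
    image under w |-> - w/2, and [box2] contains its images under all w |-> s w with |s| <= 1/4. *)
Definition box0 : (nat -> Z) * (nat -> Z) :=
  (nth 0 [:: 45 * 2175; 45 * 799; 45 * 273; 45 * 703; 45 * 199; 45 * 431;
     - (9 * 60); - (13 * 60); 4 * 60; 60 * 40],
   nth 0 [:: 45 * 2177; 45 * 801; 45 * 275; 45 * 705; 45 * 201; 45 * 433;
     - (7 * 60); - (11 * 60); 6 * 60; 62 * 40]).
Definition box1 : (nat -> Z) * (nat -> Z) :=
  (nth 0 [:: 45 * 2175; 45 * 799; 45 * 273; 45 * 703; 45 * 199; 45 * 431;
     7 * 30; 11 * 30; - (6 * 30); 60 * 10],
   nth 0 [:: 45 * 2177; 45 * 801; 45 * 275; 45 * 705; 45 * 201; 45 * 433;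
     9 * 30; 13 * 30; - (4 * 30); 62 * 10]).
Definition box2 : (nat -> Z) * (nat -> Z) :=
  (nth 0 [:: 45 * 2175; 45 * 799; 45 * 273; 45 * 703; 45 * 199; 45 * 431;
     - (5 * 30); - (7 * 30); - (3 * 30); 0],
   nth 0 [:: 45 * 2177; 45 * 801; 45 * 275; 45 * 705; 45 * 201; 45 * 433;
     5 * 30; 7 * 30; 3 * 30; 162]).

Definition zlegal3 (b : (nat -> Z) * (nat -> Z)) : bool :=
  let l1 := zgstep b.1 b.2 in let u1 := zgstep b.2 b.1 in
  [&& zlegal 3240 b.1 b.2, zlegal (16 * 3240) l1 u1
    & zlegal (16 * (16 * 3240)) (zgstep l1 u1) (zgstep u1 l1)].

Lemma zlegal3_boxes : [&& zlegal3 box0, zlegal3 box1 & zlegal3 box2].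
Proof. by vm_compute. Qed.
End Boxes.

(** * Infinitely many rounds of the spiral *)

Section Tail.
Variable R : archiRealFieldType.
Local Notation zr := (@zr R).
Local Notation gram := (gram R).
Implicit Types g : gram.

Definition gmul (c : R) g : gram :=
  let: Gram xx yy zz xy yz xz xw yw zw ww := g in
  Gram (c * xx) (c * yy) (c * zz) (c * xy) (c * yz) (c * xz)
    (c * xw) (c * yw) (c * zw) (c * ww).

(* The effect of w |-> s w. *)
Definition gtwist (s : R) g : gram :=
  let: Gram xx yy zz xy yz xz xw yw zw ww := g in
  Gram xx yy zz xy yz xz (s * xw) (s * yw) (s * zw) (s ^+ 2 * ww).

Lemma gstep_gmul c g : gstep (gmul c g) = gmul c (gstep g).
Proof. by case: g => *; rewrite /=; congr Gram; field. Qed.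

Lemma iter_gstep_gmul c g r : iter r (@gstep R) (gmul c g) = gmul c (iter r (@gstep R) g).
Proof. by elim: r => //= r ->; rewrite gstep_gmul. Qed.

(** Three rounds multiply x, y, z by 1/4 and w by -1/8, which is 1/4 times -1/2. Inner products
    scale by the square 1/16. *)
Lemma iter3_gstep g m :
  iter (m * 3) (@gstep R) g = gmul (16^-1 ^+ m) (gtwist ((- 2^-1) ^+ m) g).
Proof.
elim: m g => [|m IH] g.
  by case: g => *; rewrite /= !expr0 /= expr1n !mul1r.
rewrite mulSn addnC iterD IH.
by case: g => *; rewrite /= !exprS /=; congr Gram; field.
Qed.

Lemma spiral_gmul c g : spiral (gmul c g) = fun k l => c * spiral g k l.
Proof.
case: g => *; apply/funext => k; apply/funext => l; move: k l.
by elim/ord5P; elim/ord5P; rewrite /= /upper /=; field.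
Qed.

Lemma stage_gmul c g r : stage (spiral (gmul c g)) r = fun k l => c * stage (spiral g) r k l.
Proof.
elim: r => [|r IH]; first by rewrite /stage /= spiral_gmul.
by rewrite {1}/stage /= -/(stage _ r) IH sqbisZ.
Qed.

Lemma scale_bound (s x M : R) : `|s| <= 4^-1 -> - M <= x <= M -> - (M / 4) <= s * x <= M / 4.
Proof.
move=> s4 xM; rewrite -ler_norml normrM mulrC.
by apply: ler_pM => //; rewrite ler_norml.
Qed.

Lemma comp_twist s g m : comp (gtwist s g) m =
  (if (m < 6)%N then 1 else if (m < 9)%N then s else s ^+ 2) * comp g m.
Proof.
case: g => *; case: m => [|[|[|[|[|[|[|[|[|[|m]]]]]]]]]] /=; rewrite ?mul1r //.
by rewrite /comp /= nth_nil mulr0.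
Qed.

Lemma inbox_tail m g : inbox 3240 box0.1 box0.2 (comp g) ->
  let b := match m with 0 => box0 | 1 => box1 | _ => box2 end%N in
  inbox 3240 b.1 b.2 (comp (gtwist ((- 2^-1) ^+ m) g)).
Proof.
move=> b0 b k k10; rewrite comp_twist; have := b0 k k10.
have s4 n : `|(- 2^-1) ^+ n.+2| <= 4^-1 :> R.
  rewrite (_ : (- 2^-1) ^+ n.+2 = (- 2^-1) ^+ n / 4); last by rewrite !exprS; field.
  rewrite normrM normrX normrN ger0_norm ?invr_ge0 //.
  rewrite ger0_norm ?invr_ge0 // ler_piMl ?invr_ge0 // exprn_ile1 ?invr_ge0 //.
  by rewrite invf_le1 ?ler1n.
rewrite {}/b; case: m => [|[|m]].
- by rewrite expr0 expr1n !if_same mul1r.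
- rewrite expr1 expr2; case: k k10 => [|[|[|[|[|[|[|[|[|[|//]]]]]]]]]] _ /=;
    rewrite ?mul1r // !(zrM, zrN, zr_nat) => /andP[? ?]; apply/andP; split; lra.
have := s4 m; set s := _ ^+ m.+2; clearbody s => {}s4.
case: k k10 => [|[|[|[|[|[|[|[|[|[|//]]]]]]]]]] _ /=; rewrite ?mul1r //;
  rewrite [zr 3240 * (_ * _)]mulrCA; set x := zr 3240 * _; clearbody x;
  rewrite !(zrM, zrN, zr_nat) => /andP[lx ux].
(* In this and the next two cases the bound is an upper bound for the absolute values in [box0],
   here 5 * 120 >= 9 * 60, whose quarter is the bound of [box2]. *)
- have /andP[]: - (5 * 120 / 4) <= s * x <= 5 * 120 / 4 by apply: scale_bound => //; lra.
  by move=> *; lra.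
- have /andP[]: - (7 * 120 / 4) <= s * x <= 7 * 120 / 4 by apply: scale_bound => //; lra.
  by move=> *; lra.
- have /andP[]: - (3 * 120 / 4) <= s * x <= 3 * 120 / 4 by apply: scale_bound => //; lra.
  by move=> *; lra.
rewrite zr0 mulr_ge0 ?sqr_ge0 /=; last by lra.
apply: (@le_trans _ _ (4^-1 ^+ 2 * (62 * 40))); last by lra.
apply: ler_pM; rewrite ?sqr_ge0 //; first by lra.
  by rewrite -real_normK ?num_real // ler_sqr ?nnegrE ?invr_ge0.
by [].
Qed.

End Tail.

Section Tail2.
Variable R : archiRealFieldType.
Local Notation zr := (@zr R).
Local Notation gram := (gram R).
Implicit Types g : gram.

Lemma zlegal3P b g : zlegal3 b -> inbox 3240 b.1 b.2 (comp g) ->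
  forall r, (r < 3)%N -> legal (iter r (@gstep R) g).
Proof.
case/and3P=> l0 l1 l2 b0.
have b1 := inbox_gstep b0; have b2 := inbox_gstep b1.
case=> [|[|[|//]]] _.
- exact: zlegalP (isT : 0 < 3240 :> Z) b0 l0.
- exact: zlegalP (isT : 0 < 16 * 3240 :> Z) b1 l1.
- exact: zlegalP (isT : 0 < 16 * (16 * 3240) :> Z) b2 l2.
Qed.

(** The twist depends on [q %/ 3] alone, and its cases 0, 1 and at least 2 are the three boxes; the
    remaining [q %% 3] rounds are covered by [zlegal3]. *)
Lemma legal_tail g q : inbox 3240 box0.1 box0.2 (comp g) ->
  exists2 h, legal h & iter q (@gstep R) g = gmul (16^-1 ^+ (q %/ 3)) h.
Proof.
move=> b0; exists (iter (q %% 3) (@gstep R) (gtwist ((- 2^-1) ^+ (q %/ 3)) g)); last first.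
  rewrite {1}(divn_eq q 3) addnC iterD iter3_gstep iter_gstep_gmul //.
have /and3P[z0 z1 z2] := zlegal3_boxes.
have q3 : (q %% 3 < 3)%N by rewrite ltn_mod.
have := inbox_tail (q %/ 3) b0; case: (q %/ 3)%N => [|[|n]] b.
- exact: (zlegal3P z0 b q3).
- exact: (zlegal3P z1 b q3).
- exact: (zlegal3P z2 b q3).
Qed.

(* Each round of three bisections acts on the Gram parameters by gstep, up to
   a permutation of the vertices. *)
Lemma sqdegen_spiral g : inbox 3240 box0.1 box0.2 (comp g) -> sqdegen (spiral g).
Proof.
move=> b0.
(* [f q] translates the labels of round [q] back into the original ones. *)
pose f q := iter q shift5.
pose e n := (f (n %/ 3)%N (edge5 (n %% 3)).1, f (n %/ 3)%N (edge5 (n %% 3)).2).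
have fI q : injective (f q).
  by elim: q => [|q IH] x y //= /shift5_inj /IH.
have eE q r : (r < 3)%N -> e (q * 3 + r)%N = (f q (edge5 r).1, f q (edge5 r).2).
  by move=> r3; rewrite /e divnMDl // divn_small // addn0 modnMDl modn_small.
clearbody e.
have stageE q r : (r <= 3)%N -> (fun k l => sqrun (spiral g) e (q * 3) (f q k) (f q l))
      = spiral (iter q (@gstep R) g) ->
    (fun k l => sqrun (spiral g) e (q * 3 + r) (f q k) (f q l))
      = stage (spiral (iter q (@gstep R) g)) r.
  move=> r3 Eq; elim: r r3 => [|r IH] r3; first by rewrite addn0 Eq.
  rewrite addnS /stage /= eE // -/(stage _ r) -IH 1?ltnW //.
  by apply/funext => k; apply/funext => l; rewrite /sqbis /= !(inj_eq (fI q)).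
have runE q : (fun k l => sqrun (spiral g) e (q * 3) (f q k) (f q l))
    = spiral (iter q (@gstep R) g).
  elim: q => [|q IH]; first by apply/funext => k; apply/funext.
  have := stageE q 3 isT IH; rewrite [(q.+1 * 3)%N]mulSn addnC => E3.
  rewrite iterS -spiral_step -E3; apply/funext => k; apply/funext => l.
  by rewrite /f -!iterSr.
have main n : exists2 h, legal h &
    (fun k l => sqrun (spiral g) e n (f (n %/ 3)%N k) (f (n %/ 3)%N l))
      = fun k l => 16^-1 ^+ (n %/ 3 %/ 3) * stage (spiral h) (n %% 3) k l.
  have [h lh hE] := legal_tail (n %/ 3) b0; exists h => //.
  have := stageE (n %/ 3)%N (n %% 3)%N (ltnW (@ltn_pmod n 3 isT)) (runE _).
  by rewrite -divn_eq => ->; rewrite hE stage_gmul.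
exists e; split=> [n|K].
  have [h lh E] := main n; have [[ne le] _] := lh (n %% 3)%N (@ltn_pmod n 3 isT).
  have [f' fK f'K] : bijective (f (n %/ 3)%N) by apply: injF_bij.
  have -> : e n = (f (n %/ 3)%N (edge5 (n %% 3)).1, f (n %/ 3)%N (edge5 (n %% 3)).2).
    by rewrite {1}(divn_eq n 3) eE // ltn_pmod.
  split; first by rewrite /= (inj_eq (fI _)).
  move=> k l; rewrite -(f'K k) -(f'K l) /=.
  have /= E' a b := congr1 (fun F => F a b) E.
  by rewrite !E' ler_pM2l ?exprn_gt0 ?invr_gt0.
have [N KN] : exists N : nat, K <= N%:R.
  exists (Num.bound `|K|); apply: le_trans (ler_norm _) _.
  by rewrite ltW // archi_boundP.
exists (9 * N)%N => n Nn; apply: le_trans KN _.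
have [h lh E] := main n; have [_ ge1] := lh (n %% 3)%N (@ltn_pmod n 3 isT).
have /= E' := congr1 (fun F => F (edge5 (n %% 3)).1 (edge5 (n %% 3)).2) E.
have en : e n = (f (n %/ 3)%N (edge5 (n %% 3)).1, f (n %/ 3)%N (edge5 (n %% 3)).2).
  by rewrite {1}(divn_eq n 3) eE // ltn_pmod.
rewrite /sqlen en /= E' -divnMA exprMn -exprM mulrA.
set m := (n %/ _)%N.
have Nm : (N <= m)%N by rewrite leq_divRL // mulnC.
rewrite (_ : 3 * 3 = 9)%N // in m Nm *.
apply: (@le_trans _ _ (2 ^+ m)).
  apply: (@le_trans _ _ m%:R); first by rewrite ler_nat.
  by rewrite -natrX ler_nat ltnW // ltn_expl.
rewrite -[leLHS]mulr1 ler_pM ?exprn_ge0 ?invr_ge0 //; last first.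
  by rewrite expr_ge1 // (le_trans _ ge1).
have nE : (n = 9 * m + n %% 9)%N by rewrite {1}(divn_eq n 9) mulnC.
rewrite nE exprD exprM mulnC exprM -mulrA [_ ^+ (n %% 9) * _]mulrC mulrA -exprMn.
(* In nine bisections the volume factor gains 2^9, while the square of the squared length loses only
   16^2: the quantity doubles. *)
rewrite (_ : 2 ^+ 9 * 16^-1 ^+ 2 = 2); last by field.
by rewrite ler_peMr ?exprn_ge0 // exprn_ege1 // ler1n.
Qed.

End Tail2.

(** * The target of the strategy *)

Section Terminal.
Variable R : archiRealFieldType.
Local Notation zr := (@zr R).
Local Notation gram := (gram R).
Implicit Types (D : 'I_5 -> 'I_5 -> R) (s : seq Z).

Definition dlist D : nat -> R := nth 0 [:: D p0 p1; D p0 p2; D p0 p3; D p0 p4;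
  D p1 p2; D p1 p3; D p1 p4; D p2 p3; D p2 p4; D p3 p4].

(* 324 times the coefficients of the inverse of spiral. *)
Definition zgram (m : nat) : nat -> Z := nth 0 (nth [::] [::
  [:: 0; 0; 0; 144; 0; 0; 0; 0; 0; 0];
  [:: 0; 0; 0; 0; - 36; 72; 0; 72; 0; 0];
  [:: - 9; 18; 18; - 18; 18; 18; - 18; - 36; 36; 36];
  [:: 36; 36; - 72; 0; 0; 0; - 36; 0; - 36; 72];
  [:: - 9; - 9; 18; 0; 9; 36; - 18; - 18; - 18; 36];
  [:: 18; - 36; - 36; 18; 0; 0; - 18; 0; 36; 36];
  [:: 12; 12; 12; - 12; 0; 0; - 12; 0; - 12; - 12];
  [:: 6; 6; - 12; 0; - 12; 6; 12; 6; 12; - 24];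
  [:: 0; - 9; - 9; 12; 3; 3; 0; 12; - 18; - 18];
  [:: 4; 4; 4; - 8; - 4; - 4; 8; - 4; 8; 8]] m).

Definition gramof D : gram :=
  let c m := (\sum_(p < 10) dlist D p * zr (zgram m p)) / 324 in
  Gram (c 0) (c 1) (c 2) (c 3) (c 4) (c 5) (c 6) (c 7) (c 8) (c 9).

Lemma spiral_gramof D : semimetric D -> spiral (gramof D) = D.
Proof.
move=> [sD zD]; apply/funext => k; apply/funext => l; move: k l.
rewrite /gramof !big_ord_recr !big_ord0 /dlist /zgram /= ?zrN ?zr_nat ?zr0.
elim/ord5P; elim/ord5P; rewrite /upper /= ?zD //; try by field.
all: by rewrite [RHS]sD; field.
Qed.

Definition znear (e : R) D s := forall k l : 'I_5, `|D k l - zr (zsym s k l)| <= e.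

(** Winning from a whole neighbourhood is what passes backwards through moves in spite of ties. The
    radius may shrink from position to position, as there are finitely many. *)
Definition robust s := exists2 e : R, 0 < e &
  forall D, semimetric D -> znear e D s -> sqdegen D.

(** Integral squared distances whose Gram parameters are the centre of [box0]. *)
Definition terminal : seq Z := [:: 97; 41; 29; 68; 84; 44; 41; 48; 25; 37].

(** Distances are scaled by 100 and the inverse of [spiral] by 324, the boxes by 3240; hence the
    factor 10 in front of [box0]. *)
Lemma terminal_bounds : all (fun m =>
  let l p := 100 * nth 0 terminal p - 1 in let u p := 100 * nth 0 terminal p + 1 in
  (10 * box0.1 m <= zlow (zgram m) l u) &&
  (10 * - box0.2 m <= zlow (fun p => - zgram m p) l u)) (iota 0 10).
Proof. by vm_compute. Qed.

Lemma robust_terminal : robust terminal.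
Proof.
exists 100^-1 => [|D sD nD]; first by rewrite invr_gt0.
rewrite -(spiral_gramof sD); apply: sqdegen_spiral => m m10.
have b : inbox 100 (fun p => 100 * nth 0 terminal p - 1)
    (fun p => 100 * nth 0 terminal p + 1) (dlist D).
  move=> p p10; rewrite (zr_nat R 100) zrB zrD zrM zr1 (zr_nat R 100).
  have N (k l : 'I_5) : zr (zsym terminal k l) - 100^-1 <= D k l <= zr (zsym terminal k l) + 100^-1.
    by have := nD k l; rewrite ler_distl.
  have X (x y : R) : x - 100^-1 <= y <= x + 100^-1 ->
      100 * x - 1 <= 100 * y <= 100 * x + 1.
    by move=> /andP[? ?]; apply/andP; split; lra.
  case: p p10 => [|[|[|[|[|[|[|[|[|[|//]]]]]]]]]] _; apply: X;
    [> exact: (N p0 p1) | exact: (N p0 p2) | exact: (N p0 p3) | exact: (N p0 p4)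
     | exact: (N p1 p2) | exact: (N p1 p3) | exact: (N p1 p4)
     | exact: (N p2 p3) | exact: (N p2 p4) | exact: (N p3 p4)].
have /(allP terminal_bounds)/andP[lo hi] : m \in iota 0 10 by rewrite mem_iota.
have {lo} := le_trans (zr_le R lo) (zlowP (zgram m) b).
have {hi} := le_trans (zr_le R hi) (zlowP (fun p => - zgram m p) b).
rewrite (eq_bigr (fun p : 'I_10 => - (dlist D p * zr (zgram m p)))); last first.
  by move=> p _; rewrite zrN mulrN.
rewrite sumrN !zrM zrN !zr_nat.
rewrite (_ : comp (gramof D) m = (\sum_(p < 10) dlist D p * zr (zgram m p)) / 324); last first.
  by case: m m10 => [|[|[|[|[|[|[|[|[|[|//]]]]]]]]]].
set S := \sum_(p < 10) _ => h1 h2; apply/andP; split.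
  by rewrite (_ : 3240 * (S / 324) = 10 * S); [lra | field].
by rewrite (_ : 3240 * (S / 324) = 10 * S); [lra | field].
Qed.
End Terminal.

(* [i], [j], [next], [perm], [g]: if [(i, j)] is a longest edge, replace vertex
   [i]; after relabelling by [perm] and scaling by [4 / g] the result is the
   position number [next]. *)
Definition move := (nat * nat * nat * seq nat * nat)%type.
Definition position := (seq nat * seq move)%type.

Definition zlist (s : seq nat) : seq Z := map (fun n => n%:R) s.

Definition move_ok (done : seq (seq nat)) (s : seq nat) (m : move) : bool :=
  let: (i, j, next, perm, g) := m in
  let M := zsym (zlist s) in let M' := zsym (zlist (nth [::] done next)) in
  let f := nth 0%N perm in
  [&& (next < size done)%N, (i < 5)%N, (j < 5)%N, i != j, (0 < g)%N, size perm == 5,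
      uniq perm, all (fun k => k < 5)%N perm &
      all (fun k => all (fun l => zbis M i j (f k) (f l) == g%:R * M' k l)
        (iota 0 5)) (iota 0 5)].

Definition covered (ms : seq move) (k l : nat) : bool :=
  has (fun m : move => let: (i, j, _, _, _) := m in
         ((i == k) && (j == l)) || ((i == l) && (j == k))) ms.

(** An uncovered edge is shorter than the first listed one by at least 1, the gap between integers,
    so it cannot become longest under a small perturbation. Only covered edges need a reply. *)
Definition position_ok (done : seq (seq nat)) (p : position) : bool :=
  let M := zsym (zlist p.1) in
  if p.2 is (i, j, _, _, _) :: _ then
    [&& 0 < M i j, all (move_ok done p.1) p.2 &
     all (fun k => all (fun l => [|| k == l, covered p.2 k l | M k l + 1 <= M i j])
        (iota 0 5)) (iota 0 5)]
  else false.

(** Moves may lead only to positions already in [done], so the strategy has no cycles and induction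
    along the list applies. *)
Fixpoint strategy_ok (done : seq (seq nat)) (ps : seq position) : bool :=
  if ps is p :: ps' then position_ok done p && strategy_ok (rcons done p.1) ps'
  else true.

(** * Backward induction along the strategy *)

Section Strategy.
Variable R : archiRealFieldType.
Local Notation zr := (@zr R).
Implicit Types D : 'I_5 -> 'I_5 -> R.

Lemma semimetric_relabel D (f : 'I_5 -> 'I_5) (c : R) : semimetric D ->
  semimetric (fun k l => c * D (f k) (f l)).
Proof. by move=> [sD zD]; split=> *; [rewrite sD|rewrite zD mulr0]. Qed.

(** Four times the median formula is 2 d1 + 2 d2 - d3, so errors grow by at most 2 + 2 + 1. *)
Lemma znear_sqbis (e : R) D s (i j : 'I_5) : znear e D s ->
  forall k l : 'I_5, `|4 * sqbis D i j k l - zr (zbis (zsym s) i j k l)| <= 5 * e.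
Proof.
move=> nD k l; rewrite /sqbis /zbis -!val_eqE /=.
have e0 : 0 <= e by apply: le_trans (nD p0 p0).
have N a b : - e <= D a b - zr (zsym s a b) <= e by rewrite -ler_norml.
have X (d1 d2 d3 : R) x1 x2 x3 : - e <= d1 - zr x1 <= e -> - e <= d2 - zr x2 <= e ->
    - e <= d3 - zr x3 <= e ->
    `|4 * ((d1 + d2) / 2 - d3 / 4) - zr (2 * (x1 + x2) - x3)| <= 5 * e.
  move=> /andP[? ?] /andP[? ?] /andP[? ?].
  by rewrite zrB zrM zrD (zr_nat R 2) ler_norml; apply/andP; split; lra.
case: eqP => _; first by rewrite mulr0 zr0 subrr normr0 mulr_ge0.
case: eqP => _; first exact: X.
case: eqP => _; first exact: X.
by rewrite zrM (zr_nat R 4) -mulrBr normrM ger0_norm // ler_pM ?ler_nat.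
Qed.

Lemma move_robust done s i j next perm g :
  (forall s', s' \in done -> robust R (zlist s')) ->
  move_ok done s (i, j, next, perm, g) ->
  exists2 e : R, 0 < e & forall D, semimetric D -> znear e D (zlist s) ->
    forall i' j' : 'I_5, i' = i :> nat -> j' = j :> nat -> sqdegen (sqbis D i' j').
Proof.
move=> rob /and5P[ns i5 j5 ij] /and5P[g0 /eqP sz un a5 /allP ok].
have [e e0 He] := rob _ (mem_nth [::] ns).
pose f (k : 'I_5) : 'I_5 := inord (nth 0%N perm k).
have fE k : f k = nth 0%N perm k :> nat.
  by rewrite inordK // (allP a5) // mem_nth // sz ltn_ord.
have fI : injective f.
  move=> k l /(congr1 val); rewrite /= !fE => /eqP.
  by rewrite nth_uniq ?sz ?ltn_ord // => /eqP/val_inj.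
have g0' : 0 < g%:R :> R by rewrite ltr0n.
(* Bisection and scaling by [4 / g] multiply errors by at most [5 / g]. *)
exists (e * g%:R / 5); first by rewrite !mulr_gt0 ?invr_gt0.
move=> D sD nD i' j' ii jj.
apply: (sqdegen_relabel fI).
have -> : (fun k l => sqbis D i' j' (f k) (f l)) =
    (fun k l => (g%:R / 4) * ((4 / g%:R) * sqbis D i' j' (f k) (f l))).
  by apply/funext => k; apply/funext => l; field; rewrite gt_eqF.
apply: sqdegenZ; first by rewrite divr_gt0.
apply: He; first exact/semimetric_relabel/semimetric_sqbis.
move=> k l; have := znear_sqbis i' j' nD (f k) (f l).
have k5 (x : 'I_5) : nat_of_ord x \in iota 0 5 by rewrite mem_iota ltn_ord.
have /allP ok2 := ok _ (k5 k); rewrite ii jj !fE (eqP (ok2 _ (k5 l))) zrM zr_nat.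
move=> X; rewrite -(ler_pM2l g0') -{1}(gtr0_norm g0') -normrM mulrBr.
apply: le_trans (_ : 5 * (e * g%:R / 5) <= _); last by rewrite (_ : 5 * _ = g%:R * e) //; field.
by rewrite (_ : g%:R * (4 / g%:R * _) = 4 * sqbis D i' j' (f k) (f l)) //; field; rewrite gt_eqF.
Qed.

Lemma sqlongest_exists D : exists e : 'I_5 * 'I_5, forall k l, D k l <= D e.1 e.2.
Proof.
pose e := [arg max_(x > (p0, p0)) D x.1 x.2]%O.
exists e => k l; rewrite /e; case: arg_maxP => // x _ /(_ (k, l)); exact.
Qed.

Lemma position_robust done p :
  (forall s', s' \in done -> robust R (zlist s')) ->
  position_ok done p -> robust R (zlist p.1).
Proof.
case: p => s [//|[[[[i j] n] q] g] ms'] rob; rewrite /position_ok [_.2]/= [_.1]/=.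
set ms := _ :: ms'; move=> /and3P[M0 ok /allP cov].
have [e e0 He] : exists2 e : R, 0 < e & forall D, semimetric D -> znear e D (zlist s) ->
    forall k l : 'I_5, covered ms k l -> sqdegen (sqbis D k l) \/ sqdegen (sqbis D l k).
  have := ok; clear cov; rewrite {ok}; elim: ms => [|[[[[a b] c] d] h] ms IH] /=.
    by exists 1.
  case/andP=> /(move_robust rob)[e1 e10 H1] /IH[e2 e20 H2].
  exists (Num.min e1 e2); first by rewrite lt_min e10.
  move=> D sD nD k l; rewrite /covered /= => /orP[].
    move=> c0; have nD1 : znear e1 D (zlist s).
      by move=> x y; apply: le_trans (nD x y) _; rewrite ge_min lexx.
    case/orP: c0 => /andP[/eqP ak /eqP bl].
      by left; apply: H1.
    by right; apply: H1.
  apply: H2 => // x y; apply: le_trans (nD x y) _.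
  by rewrite ge_min lexx orbT.
(* Errors of 1/4 at two edges cannot make up for a difference of 1. *)
exists (Num.min e 4^-1); first by rewrite lt_min e0 invr_gt0 ltr0n.
move=> D sD nD.
have nDe : znear e D (zlist s) by move=> x y; apply: le_trans (nD x y) _; rewrite ge_min lexx.
have nD4 (x y : 'I_5) : zr (zsym (zlist s) x y) - 4^-1 <= D x y <= zr (zsym (zlist s) x y) + 4^-1.
  by rewrite -ler_distl; apply: le_trans (nD x y) _; rewrite ge_min lexx orbT.
have /andP[/and5P[_ i5 j5 _ _] _] := ok.
have [[k l] /= kl] := sqlongest_exists D.
pose i' : 'I_5 := inord i; pose j' : 'I_5 := inord j.
have Mle (x y : 'I_5) : zsym (zlist s) x y + 1 <= zsym (zlist s) i j -> D x y < D k l.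
  move=> /(zr_le R); rewrite zrD zr1 => Mxy; apply: lt_le_trans (kl i' j').
  have /andP[lo _] := nD4 i' j'; have /andP[_ hi] := nD4 x y.
  by move: lo; rewrite /i' /j' !inordK // => lo; lra.
have Dkl : 0 < D k l.
  rewrite -[X in X < _](proj2 sD p0); apply: Mle => /=; rewrite add0r.
  by move: M0; lia.
have nkl : k != l by apply: contraTneq Dkl => ->; rewrite (proj2 sD) ltxx.
have lkl : sqlongest D (k, l) by [].
have llk : sqlongest D (l, k).
  by split=> [|x y]; rewrite /= 1?eq_sym // (proj1 sD l k).
have k5 (x : 'I_5) : nat_of_ord x \in iota 0 5 by rewrite mem_iota ltn_ord.
have /allP/(_ _ (k5 l))/or3P[kl0|c|/Mle] := cov _ (k5 k).
- by rewrite -val_eqE kl0 in nkl.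
- by have [?|?] := He D sD nDe k l c; [apply: sqdegen_sqbis lkl _|apply: sqdegen_sqbis llk _].
- by rewrite ltxx.
Qed.

Lemma strategy_robust done ps :
  (forall s, s \in done -> robust R (zlist s)) -> strategy_ok done ps ->
  forall p, p \in ps -> robust R (zlist p.1).
Proof.
elim: ps done => [//|p ps IH] done rob /= /andP[/(position_robust rob) rp ok] q.
rewrite inE => /predU1P[->//|]; apply: IH ok _ => s.
by rewrite mem_rcons inE => /predU1P[->//|]; apply: rob.
Qed.
End Strategy.

Definition terminal_nat : seq nat := [:: 97; 41; 29; 68; 84; 44; 41; 48; 25; 37]%N.

(** Number 0 is [terminal_nat], so the entry at index k has number k + 1, and every move leads to a
    smaller number. The last entry is the regular simplex, where all ten edges tie and each has a
    reply. *)
Definition strategy : seq position := [::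
([:: 29; 41; 97; 121; 48; 44; 112; 84; 48; 164], [:: (4, 3, 0, [:: 0; 3; 2; 1; 4], 4)]);
([:: 41; 48; 100; 84; 121; 49; 97; 148; 164; 176], [:: (3, 4, 1, [:: 1; 3; 0; 4; 2], 4)]);
([:: 49; 57; 97; 121; 148; 176; 148; 100; 192; 164], [:: (2, 4, 2, [:: 2; 0; 4; 1; 3], 4)]);
([:: 25; 37; 52; 48; 44; 97; 41; 29; 37; 68], [:: (3, 1, 3, [:: 3; 2; 0; 1; 4], 1)]);
([:: 25; 41; 49; 97; 48; 80; 52; 64; 68; 116], [:: (3, 4, 4, [:: 1; 0; 3; 4; 2], 4)]);
([:: 41; 49; 57; 97; 64; 132; 68; 148; 116; 208], [:: (3, 4, 5, [:: 0; 3; 1; 2; 4], 4)]);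
([:: 49; 57; 97; 121; 148; 116; 148; 208; 192; 272], [:: (4, 3, 6, [:: 0; 4; 1; 2; 3], 4)]);
([:: 29; 37; 37; 48; 52; 68; 41; 48; 41; 121], [:: (4, 3, 7, [:: 4; 0; 2; 1; 3], 1)]);
([:: 41; 41; 121; 49; 52; 48; 100; 68; 64; 148], [:: (4, 3, 8, [:: 4; 2; 1; 3; 0], 4)]);
([:: 41; 49; 57; 121; 64; 132; 68; 148; 148; 192], [:: (3, 4, 9, [:: 0; 3; 1; 4; 2], 4)]);
([:: 16; 16; 17; 33; 16; 37; 37; 41; 57; 48], [:: (2, 4, 10, [:: 2; 0; 1; 4; 3], 1)]);
([:: 16; 25; 41; 57; 29; 37; 37; 68; 52; 48], [:: (2, 3, 11, [:: 2; 1; 0; 3; 4], 4)]);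
([:: 25; 41; 57; 65; 68; 52; 116; 48; 64; 80], [:: (4, 1, 12, [:: 0; 4; 1; 2; 3], 4)]);
([:: 12; 13; 20; 37; 17; 16; 41; 29; 16; 37], [:: (4, 1, 13, [:: 4; 2; 1; 0; 3], 1)]);
([:: 12; 16; 25; 41; 20; 21; 37; 53; 37; 64], [:: (3, 4, 14, [:: 1; 0; 3; 2; 4], 4)]);
([:: 16; 25; 41; 41; 53; 29; 37; 84; 64; 52], [:: (3, 2, 15, [:: 0; 3; 1; 2; 4], 4)]);
([:: 25; 41; 41; 49; 64; 84; 80; 52; 80; 116], [:: (4, 3, 16, [:: 0; 4; 1; 3; 2], 4)]);
([:: 13; 16; 25; 20; 21; 16; 29; 17; 20; 49], [:: (3, 4, 17, [:: 3; 2; 0; 1; 4], 1)]);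
([:: 13; 16; 29; 53; 25; 20; 52; 49; 25; 80], [:: (4, 3, 18, [:: 1; 0; 4; 2; 3], 4)]);
([:: 13; 20; 48; 52; 29; 29; 53; 68; 80; 100], [:: (3, 4, 19, [:: 1; 0; 3; 2; 4], 4)]);
([:: 5; 9; 12; 13; 12; 17; 20; 29; 16; 25], [:: (2, 3, 20, [:: 0; 2; 1; 3; 4], 1)]);
([:: 12; 13; 16; 29; 17; 20; 17; 25; 48; 25], [:: (2, 4, 21, [:: 2; 1; 0; 4; 3], 4)]);
([:: 17; 17; 20; 33; 48; 25; 36; 25; 52; 33], [:: (4, 2, 22, [:: 4; 0; 2; 3; 1], 4)]);
([:: 20; 25; 48; 36; 49; 68; 48; 25; 33; 52], [:: (1, 3, 23, [:: 1; 0; 3; 2; 4], 4)]);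
([:: 25; 33; 41; 49; 52; 68; 68; 64; 48; 80], [:: (3, 4, 24, [:: 3; 4; 0; 1; 2], 4)]);
([:: 12; 13; 16; 16; 17; 20; 20; 17; 25; 16], [:: (4, 2, 25, [:: 4; 2; 0; 3; 1], 1)]);
([:: 16; 17; 20; 48; 25; 20; 64; 17; 33; 36], [:: (4, 1, 26, [:: 4; 3; 2; 0; 1], 4)]);
([:: 4; 5; 12; 12; 5; 16; 16; 9; 17; 16], [:: (4, 2, 27, [:: 0; 1; 4; 2; 3], 1)]);
([:: 1; 3; 3; 4; 4; 4; 3; 4; 9; 9], [:: (4, 2, 28, [:: 0; 1; 4; 2; 3], 1); (4, 3, 28, [:: 0; 1; 4; 3; 2], 1)]);
([:: 3; 3; 4; 4; 4; 5; 9; 5; 9; 12], [:: (3, 4, 29, [:: 0; 3; 1; 2; 4], 4)]);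
([:: 4; 5; 5; 9; 5; 5; 9; 4; 12; 16], [:: (3, 4, 30, [:: 3; 0; 1; 2; 4], 4)]);
([:: 4; 5; 12; 16; 5; 16; 20; 9; 13; 12], [:: (4, 1, 31, [:: 2; 4; 0; 1; 3], 4)]);
([:: 1; 3; 4; 4; 4; 5; 3; 3; 9; 8], [:: (4, 2, 32, [:: 0; 1; 4; 2; 3], 1)]);
([:: 3; 3; 5; 9; 4; 4; 4; 8; 8; 12], [:: (3, 4, 33, [:: 1; 3; 0; 2; 4], 4)]);
([:: 1; 1; 1; 3; 2; 2; 2; 3; 4; 5], [:: (4, 3, 34, [:: 4; 0; 1; 3; 2], 1)]);
([:: 1; 1; 3; 3; 3; 3; 5; 4; 4; 8], [:: (3, 4, 35, [:: 0; 3; 2; 1; 4], 4)]);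
([:: 3; 3; 3; 5; 4; 4; 4; 4; 8; 12], [:: (3, 4, 36, [:: 3; 0; 1; 2; 4], 4)]);
([:: 3; 3; 9; 5; 4; 4; 12; 8; 8; 16], [:: (3, 4, 37, [:: 0; 3; 2; 1; 4], 4)]);
([:: 1; 3; 4; 4; 4; 5; 5; 3; 3; 4], [:: (3, 1, 32, [:: 0; 1; 3; 2; 4], 1); (4, 1, 32, [:: 0; 1; 4; 2; 3], 1)]);
([:: 1; 4; 4; 8; 5; 5; 9; 4; 8; 12], [:: (4, 3, 39, [:: 0; 1; 4; 2; 3], 4)]);
([:: 1; 4; 8; 12; 5; 9; 13; 12; 16; 12], [:: (4, 2, 40, [:: 0; 1; 4; 2; 3], 4)]);
([:: 1; 2; 3; 3; 3; 4; 4; 3; 9; 8], [:: (4, 2, 41, [:: 0; 4; 1; 2; 3], 1)]);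
([:: 1; 3; 3; 9; 4; 4; 12; 4; 4; 8], [:: (1, 4, 42, [:: 1; 2; 0; 3; 4], 4)]);
([:: 1; 3; 5; 9; 4; 4; 12; 8; 8; 16], [:: (3, 4, 43, [:: 0; 1; 3; 2; 4], 4)]);
([:: 3; 5; 5; 9; 8; 8; 8; 16; 16; 16], [:: (2, 3, 44, [:: 0; 2; 1; 3; 4], 4); (2, 4, 38, [:: 0; 2; 1; 4; 3], 4); (3, 4, 38, [:: 0; 3; 1; 4; 2], 4)]);
([:: 1; 2; 3; 5; 2; 4; 4; 2; 2; 4], [:: (0, 4, 45, [:: 0; 2; 1; 4; 3], 1)]);
([:: 1; 3; 3; 5; 4; 4; 4; 4; 4; 8], [:: (3, 4, 46, [:: 0; 1; 3; 2; 4], 4)]);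
([:: 3; 3; 5; 5; 4; 4; 12; 8; 8; 16], [:: (4, 3, 47, [:: 0; 4; 1; 2; 3], 4)]);
([:: 1; 1; 1; 3; 1; 2; 4; 2; 5; 2], [:: (2, 4, 48, [:: 2; 0; 3; 1; 4], 1)]);
([:: 1; 1; 3; 3; 1; 3; 5; 4; 4; 8], [:: (3, 4, 49, [:: 0; 2; 1; 3; 4], 4)]);
([:: 1; 3; 3; 5; 4; 4; 4; 4; 8; 12], [:: (3, 4, 50, [:: 3; 0; 1; 2; 4], 4)]);
([:: 1; 1; 1; 1; 2; 2; 1; 1; 3; 3], [:: (2, 4, 51, [:: 2; 0; 1; 4; 3], 1); (3, 4, 51, [:: 3; 0; 1; 4; 2], 1)]);
([:: 1; 1; 2; 3; 1; 2; 3; 3; 4; 1], [:: (2, 4, 52, [:: 2; 3; 0; 1; 4], 4)]);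
([:: 4; 5; 12; 20; 5; 16; 16; 9; 13; 16], [:: (4, 0, 31, [:: 2; 4; 0; 1; 3], 4)]);
([:: 1; 3; 5; 4; 4; 4; 5; 4; 7; 13], [:: (4, 3, 54, [:: 0; 1; 4; 2; 3], 1)]);
([:: 3; 5; 4; 8; 4; 7; 11; 13; 5; 20], [:: (4, 3, 55, [:: 0; 4; 1; 2; 3], 4)]);
([:: 4; 5; 8; 16; 13; 20; 28; 5; 9; 16], [:: (4, 1, 56, [:: 0; 4; 2; 1; 3], 4)]);
([:: 1; 2; 3; 4; 5; 4; 7; 3; 4; 9], [:: (3, 4, 57, [:: 0; 1; 3; 2; 4], 1)]);
([:: 5; 4; 3; 7; 3; 8; 4; 5; 9; 16], [:: (3, 4, 58, [:: 3; 0; 1; 2; 4], 4)]);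
([:: 1; 3; 4; 8; 4; 7; 11; 9; 5; 16], [:: (4, 3, 58, [:: 0; 1; 4; 2; 3], 4)]);
([:: 3; 4; 11; 7; 5; 8; 16; 5; 9; 16], [:: (1, 4, 60, [:: 1; 0; 2; 4; 3], 4); (3, 4, 59, [:: 0; 3; 2; 1; 4], 4)]);
([:: 3; 7; 7; 11; 12; 16; 8; 12; 20; 16], [:: (2, 4, 61, [:: 0; 1; 2; 4; 3], 4)]);
([:: 2; 2; 3; 4; 4; 5; 4; 7; 4; 3], [:: (2, 3, 62, [:: 2; 0; 3; 4; 1], 1)]);
([:: 4; 5; 12; 8; 5; 16; 12; 5; 9; 12], [:: (3, 1, 40, [:: 3; 2; 0; 1; 4], 4)]);
([:: 1; 1; 3; 4; 2; 2; 3; 4; 5; 3], [:: (2, 4, 64, [:: 1; 0; 2; 4; 3], 1)]);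
([:: 1; 3; 4; 4; 4; 5; 5; 3; 7; 12], [:: (4, 3, 65, [:: 0; 4; 1; 2; 3], 4)]);
([:: 3; 5; 4; 12; 4; 7; 7; 5; 5; 16], [:: (3, 4, 66, [:: 3; 2; 1; 0; 4], 4)]);
([:: 3; 4; 8; 12; 7; 11; 7; 4; 16; 20], [:: (3, 4, 67, [:: 0; 1; 3; 2; 4], 4)]);
([:: 4; 7; 16; 20; 11; 20; 32; 7; 11; 20], [:: (4, 1, 68, [:: 4; 2; 0; 1; 3], 4)]);
([:: 1; 3; 5; 8; 4; 4; 5; 4; 11; 5], [:: (2, 4, 69, [:: 1; 0; 2; 3; 4], 1)]);
([:: 1; 3; 8; 12; 4; 5; 13; 11; 7; 20], [:: (4, 3, 70, [:: 0; 1; 2; 4; 3], 4)]);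
([:: 1; 5; 9; 13; 8; 8; 12; 16; 20; 28], [:: (3, 4, 71, [:: 1; 0; 3; 2; 4], 4)]);
([:: 5; 9; 9; 13; 16; 16; 20; 32; 12; 28], [:: (2, 3, 72, [:: 0; 2; 1; 3; 4], 4)]);
([:: 1; 4; 3; 8; 3; 4; 9; 5; 4; 7], [:: (1, 4, 73, [:: 1; 2; 0; 4; 3], 1)]);
([:: 1; 3; 8; 8; 4; 5; 9; 11; 7; 16], [:: (3, 4, 74, [:: 0; 1; 3; 2; 4], 4)]);
([:: 3; 4; 8; 8; 7; 7; 11; 12; 20; 16], [:: (2, 4, 75, [:: 0; 2; 1; 4; 3], 4)]);
([:: 1; 2; 2; 4; 3; 5; 7; 4; 4; 4], [:: (4, 1, 76, [:: 0; 4; 1; 2; 3], 1)]);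
([:: 3; 3; 5; 7; 8; 4; 4; 4; 8; 4], [:: (2, 1, 77, [:: 2; 0; 1; 3; 4], 4); (2, 4, 63, [:: 2; 3; 4; 0; 1], 4)]);
([:: 1; 3; 4; 5; 4; 5; 4; 3; 8; 13], [:: (4, 3, 32, [:: 0; 1; 4; 2; 3], 1)]);
([:: 3; 3; 8; 8; 4; 5; 5; 5; 13; 16], [:: (3, 4, 79, [:: 1; 3; 0; 2; 4], 4)]);
([:: 4; 5; 5; 17; 5; 13; 9; 16; 16; 32], [:: (4, 3, 80, [:: 4; 0; 1; 2; 3], 4)]);
([:: 5; 5; 9; 17; 16; 12; 16; 12; 32; 36], [:: (3, 4, 81, [:: 0; 3; 1; 2; 4], 4)]);
([:: 5; 9; 17; 25; 12; 32; 32; 36; 20; 64], [:: (4, 3, 82, [:: 0; 4; 1; 2; 3], 4)]);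
([:: 3; 3; 8; 8; 4; 5; 9; 5; 17; 16], [:: (2, 4, 83, [:: 2; 0; 1; 4; 3], 1)]);
([:: 3; 5; 17; 9; 8; 8; 16; 16; 12; 36], [:: (4, 3, 84, [:: 1; 4; 0; 2; 3], 4)]);
([:: 2; 2; 2; 4; 4; 4; 3; 4; 9; 9], [:: (2, 4, 85, [:: 2; 0; 1; 3; 4], 1); (3, 4, 85, [:: 3; 0; 1; 2; 4], 1)]);
([:: 2; 2; 4; 6; 4; 9; 5; 9; 5; 12], [:: (4, 3, 86, [:: 0; 4; 1; 2; 3], 4)]);
([:: 3; 3; 8; 16; 4; 5; 9; 5; 9; 12], [:: (0, 4, 87, [:: 0; 1; 2; 4; 3], 4)]);
([:: 3; 5; 13; 9; 8; 8; 16; 20; 12; 16], [:: (3, 2, 88, [:: 1; 0; 3; 2; 4], 4)]);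
([:: 1; 2; 3; 4; 3; 4; 5; 3; 8; 13], [:: (4, 3, 41, [:: 0; 4; 1; 2; 3], 1)]);
([:: 1; 3; 4; 13; 4; 5; 16; 3; 8; 5], [:: (1, 4, 90, [:: 1; 3; 2; 0; 4], 4)]);
([:: 1; 3; 5; 13; 4; 4; 16; 8; 8; 20], [:: (3, 4, 91, [:: 0; 1; 2; 3; 4], 4)]);
([:: 1; 4; 8; 16; 5; 9; 13; 12; 20; 32], [:: (3, 4, 92, [:: 1; 0; 3; 2; 4], 4)]);
([:: 5; 9; 9; 13; 12; 12; 20; 32; 16; 32], [:: (2, 3, 93, [:: 2; 0; 1; 3; 4], 4); (3, 4, 89, [:: 0; 3; 1; 4; 2], 4)]);
([:: 1; 3; 4; 8; 4; 3; 9; 5; 3; 8], [:: (1, 4, 94, [:: 1; 2; 0; 4; 3], 1)]);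
([:: 1; 3; 5; 9; 4; 4; 8; 8; 8; 12], [:: (3, 4, 95, [:: 1; 0; 3; 2; 4], 4)]);
([:: 3; 5; 5; 9; 8; 8; 8; 16; 12; 12], [:: (2, 3, 96, [:: 0; 2; 1; 3; 4], 4)]);
([:: 1; 2; 3; 4; 2; 4; 5; 2; 2; 3], [:: (1, 4, 97, [:: 1; 2; 0; 4; 3], 1)]);
([:: 1; 3; 4; 7; 4; 5; 8; 3; 4; 3], [:: (4, 1, 98, [:: 0; 1; 4; 2; 3], 4)]);
([:: 1; 3; 7; 7; 4; 8; 8; 4; 8; 12], [:: (4, 3, 99, [:: 0; 1; 2; 4; 3], 4)]);
([:: 3; 4; 8; 20; 7; 7; 11; 12; 32; 20], [:: (4, 2, 100, [:: 1; 4; 0; 2; 3], 4)]);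
([:: 1; 1; 3; 8; 2; 2; 5; 4; 11; 5], [:: (2, 4, 101, [:: 1; 2; 0; 3; 4], 1)]);
([:: 1; 3; 4; 8; 4; 3; 11; 9; 5; 20], [:: (3, 4, 102, [:: 0; 3; 1; 2; 4], 4)]);
([:: 1; 1; 8; 8; 2; 5; 9; 11; 7; 20], [:: (4, 3, 102, [:: 0; 1; 2; 4; 3], 4)]);
([:: 1; 3; 7; 11; 4; 8; 8; 8; 20; 20], [:: (2, 4, 104, [:: 1; 2; 0; 4; 3], 4); (3, 4, 103, [:: 1; 0; 3; 2; 4], 4)]);
([:: 1; 2; 2; 2; 2; 3; 5; 7; 5; 4], [:: (3, 2, 105, [:: 3; 0; 1; 2; 4], 1)]);
([:: 1; 2; 7; 5; 3; 8; 4; 3; 5; 4], [:: (1, 3, 106, [:: 1; 2; 0; 3; 4], 4)]);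
([:: 1; 1; 3; 5; 1; 4; 8; 5; 7; 4], [:: (4, 1, 49, [:: 0; 1; 2; 4; 3], 4)]);
([:: 1; 3; 5; 7; 4; 4; 8; 12; 12; 4], [:: (2, 3, 108, [:: 2; 1; 0; 3; 4], 4); (2, 4, 107, [:: 0; 1; 2; 4; 3], 4)]);
([:: 3; 5; 7; 7; 12; 12; 16; 4; 4; 12], [:: (4, 1, 109, [:: 0; 4; 1; 2; 3], 4)]);
([:: 1; 1; 3; 5; 3; 3; 7; 4; 4; 2], [:: (4, 1, 110, [:: 4; 3; 0; 1; 2], 1)]);
([:: 1; 3; 4; 3; 4; 5; 4; 3; 8; 7], [:: (4, 2, 65, [:: 0; 4; 1; 2; 3], 4)]);
([:: 3; 4; 4; 8; 5; 7; 7; 4; 4; 12], [:: (3, 4, 112, [:: 3; 2; 0; 1; 4], 4)]);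
([:: 1; 1; 1; 5; 1; 2; 4; 3; 7; 4], [:: (4, 2, 113, [:: 1; 4; 0; 2; 3], 1)]);
([:: 1; 1; 5; 5; 3; 3; 7; 8; 4; 8], [:: (3, 2, 114, [:: 0; 3; 1; 2; 4], 4); (3, 4, 111, [:: 0; 1; 2; 3; 4], 4)]);
([:: 1; 3; 5; 5; 4; 4; 4; 4; 4; 4], [:: (3, 0, 54, [:: 0; 1; 3; 2; 4], 1); (4, 0, 54, [:: 0; 1; 4; 2; 3], 1)]);
([:: 1; 1; 1; 2; 1; 1; 3; 1; 4; 5], [:: (4, 3, 116, [:: 4; 0; 1; 2; 3], 1)]);
([:: 1; 1; 1; 5; 1; 2; 4; 3; 3; 8], [:: (3, 4, 117, [:: 3; 2; 1; 0; 4], 4)]);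
([:: 1; 1; 3; 5; 2; 4; 4; 4; 8; 12], [:: (3, 4, 118, [:: 0; 1; 3; 2; 4], 4)]);
([:: 1; 3; 5; 5; 4; 4; 8; 4; 12; 16], [:: (3, 4, 119, [:: 0; 3; 1; 2; 4], 4)]);
([:: 3; 4; 12; 12; 5; 5; 5; 16; 16; 8], [:: (3, 2, 120, [:: 1; 3; 0; 2; 4], 4); (4, 2, 120, [:: 1; 4; 0; 2; 3], 4)]);
([:: 1; 1; 3; 3; 1; 3; 5; 4; 4; 2], [:: (1, 4, 121, [:: 0; 1; 2; 3; 4], 1)]);
([:: 1; 1; 2; 2; 3; 1; 5; 3; 2; 7], [:: (4, 3, 109, [:: 4; 0; 2; 1; 3], 1)]);
([:: 1; 1; 5; 5; 2; 2; 4; 7; 3; 8], [:: (4, 3, 123, [:: 1; 0; 4; 2; 3], 4)]);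
([:: 1; 1; 3; 7; 1; 4; 8; 5; 5; 8], [:: (1, 4, 124, [:: 2; 1; 0; 4; 3], 4); (4, 3, 122, [:: 0; 2; 1; 4; 3], 4)]);
([:: 1; 3; 5; 5; 4; 4; 8; 12; 12; 8], [:: (2, 3, 125, [:: 2; 1; 0; 3; 4], 4); (2, 4, 115, [:: 0; 2; 1; 4; 3], 4)]);
([:: 1; 1; 2; 1; 1; 1; 3; 2; 3; 3], [:: (1, 4, 126, [:: 1; 0; 4; 2; 3], 1); (2, 4, 109, [:: 2; 0; 4; 1; 3], 1); (4, 3, 78, [:: 4; 0; 3; 1; 2], 1)]);
([:: 1; 1; 1; 3; 1; 2; 3; 3; 4; 3], [:: (2, 4, 127, [:: 2; 0; 1; 3; 4], 4)]);
([:: 2; 1; 3; 3; 3; 1; 3; 4; 4; 4], [:: (2, 3, 128, [:: 2; 1; 3; 0; 4], 4); (4, 2, 53, [:: 0; 4; 2; 1; 3], 4); (4, 3, 53, [:: 1; 4; 3; 0; 2], 4)]);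
([:: 1; 1; 1; 1; 1; 1; 3; 1; 3; 3], [:: (4, 1, 116, [:: 4; 0; 1; 2; 3], 1); (4, 2, 116, [:: 4; 0; 2; 1; 3], 1); (4, 3, 116, [:: 4; 0; 3; 1; 2], 1)]);
([:: 1; 1; 1; 3; 1; 1; 3; 1; 3; 4], [:: (3, 4, 130, [:: 3; 0; 1; 2; 4], 4)]);
([:: 1; 1; 3; 3; 1; 3; 3; 4; 4; 4], [:: (3, 2, 131, [:: 0; 1; 3; 2; 4], 4); (4, 2, 131, [:: 0; 1; 4; 2; 3], 4); (3, 4, 53, [:: 0; 1; 2; 3; 4], 4)]);
([:: 1; 3; 3; 3; 4; 4; 4; 4; 4; 4], [:: (2, 1, 132, [:: 0; 2; 1; 3; 4], 4); (3, 1, 132, [:: 0; 3; 1; 2; 4], 4); (4, 1, 132, [:: 0; 4; 1; 2; 3], 4); (2, 3, 129, [:: 0; 2; 1; 3; 4], 4); (2, 4, 129, [:: 0; 2; 1; 4; 3], 4); (3, 4, 129, [:: 0; 3; 1; 4; 2], 4)]);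
([:: 1; 1; 1; 1; 1; 1; 1; 1; 1; 1], [:: (0, 1, 133, [:: 0; 1; 2; 3; 4], 1); (0, 2, 133, [:: 0; 2; 1; 3; 4], 1); (0, 3, 133, [:: 0; 3; 1; 2; 4], 1); (0, 4, 133, [:: 0; 4; 1; 2; 3], 1); (1, 2, 133, [:: 1; 2; 0; 3; 4], 1); (1, 3, 133, [:: 1; 3; 0; 2; 4], 1); (1, 4, 133, [:: 1; 4; 0; 2; 3], 1); (2, 3, 133, [:: 2; 3; 0; 1; 4], 1); (2, 4, 133, [:: 2; 4; 0; 1; 3], 1); (3, 4, 133, [:: 3; 4; 0; 1; 2], 1)])]%N.

Lemma strategy_valid : strategy_ok [:: terminal_nat] strategy.
Proof. by vm_compute. Qed.

Lemma robust_regular (R : archiRealFieldType) : robust R (zlist (nseq 10 1%N)).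
Proof.
have done_ok s : s \in [:: terminal_nat] -> robust R (zlist s).
  by rewrite inE => /eqP ->; apply: robust_terminal.
apply: (strategy_robust done_ok strategy_valid (p := last ([::], [::]) strategy)).
by vm_compute.
Qed.

(** * Contraction of the longest edge *)

Section Contraction.
Variables (R : realType) (I : finType).
Implicit Types (D : I -> I -> R).

(** With longest squared length L, the median formula is at most (L + L)/2 - L/4. *)
Lemma sqbis_le D (e : I * I) (k l : I) : semimetric D -> sqlongest D e ->
  (k == e.1) || (l == e.1) -> sqbis D e.1 e.2 k l <= 3 / 4 * D e.1 e.2.
Proof.
move=> [sD zD] [ne le] kl.
have pos : 0 <= D e.1 e.2 by rewrite -(zD e.1) le.
rewrite /sqbis; case: (k == l); first by rewrite mulr_ge0 ?divr_ge0.
case: (k == e.1) kl => [_|/= ->].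
  by have := le e.1 l; have := le e.2 l; lra.
by have := le k e.1; have := le k e.2; lra.
Qed.

Lemma sqbis_le_longest D (e : I * I) (k l : I) : semimetric D -> sqlongest D e ->
  sqbis D e.1 e.2 k l <= D e.1 e.2.
Proof.
move=> sD lD; have pos : 0 <= D e.1 e.2 by rewrite -(sD.2 e.1) lD.2.
have [kl|] := boolP ((k == e.1) || (l == e.1)).
  by apply: le_trans (sqbis_le sD lD kl) _; lra.
rewrite negb_or => /andP[/negbTE ke /negbTE le]; rewrite /sqbis ke le.
by case: ifP => // _; apply: lD.2.
Qed.

Variables (D : nat -> I -> I -> R) (e : nat -> I * I).
Hypothesis sD : semimetric (D 0).
Hypothesis lD : forall n, sqlongest (D n) (e n).
Hypothesis DS : forall n, D n.+1 = sqbis (D n) (e n).1 (e n).2.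
Let len n := D n (e n).1 (e n).2.

Let sDn n : semimetric (D n).
Proof. by elim: n => // n IH; rewrite DS; apply: semimetric_sqbis. Qed.

Lemma longest_monotone n m : len (n + m) <= len n.
Proof.
elim: m => [|m IH]; first by rewrite addn0.
by apply: le_trans IH; rewrite addnS /len DS; apply: sqbis_le_longest.
Qed.

Let len_ge0 n : 0 <= len n.
Proof. by rewrite -((sDn n).2 (e n).1) (lD n).2. Qed.

(* A vertex that has been moved is not an end of a longest edge again before
   the squared diameter has dropped by the factor 3/4. *)
Lemma longest_contract n : len (n + #|I|) <= 3 / 4 * len n.
Proof.
rewrite leNgt; apply/negP => big.
have bigt t : (t <= #|I|)%N -> 3 / 4 * len n < len (n + t).
  by move=> tI; apply: lt_le_trans big _; rewrite -(subnKC tI) addnA longest_monotone.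
(* [A] collects the moved vertices. Their edges are too short to be longest, so every step adds a
   new vertex, and after [#|I|] steps none is left. *)
have [A [cA hA]] : exists A : {set I}, #|A| = #|I| /\
    forall k l, k \in A -> D (n + #|I|) k l <= 3 / 4 * len n.
  suff H t : (t <= #|I|)%N -> exists A : {set I}, #|A| = t /\
      forall k l, k \in A -> D (n + t) k l <= 3 / 4 * len n by exact: H.
  elim: t => [|t IH] tI; first by exists finset.set0; rewrite cards0; split=> // k l; rewrite inE.
  have [A [cA hA]] := IH (ltnW tI).
  have eA : (e (n + t)).1 \notin A.
    by apply/negP => h; have := hA _ (e (n + t)).2 h; rewrite leNgt bigt // ltnW.
  exists ((e (n + t)).1 |: A)%SET; rewrite cardsU1 eA cA; split=> // k l kA.
  rewrite addnS DS.
  have [kl|] := boolP ((k == (e (n + t)).1) || (l == (e (n + t)).1)).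
    apply: le_trans (sqbis_le (sDn _) (lD _) kl) _.
    by rewrite ler_pM2l ?divr_gt0 // longest_monotone.
  rewrite negb_or => /andP[/negbTE ke /negbTE le]; rewrite /sqbis ke le.
  case: ifP => [_|_]; first by rewrite mulr_ge0 ?divr_ge0.
  by apply: hA; move: kA; rewrite !inE ke.
have : (e (n + #|I|)%N).1 \in A.
  have /eqP -> : A == finset.setT by rewrite eqEcard finset.subsetT cardsT cA leqnn.
  by rewrite inE.
by move=> h; have := hA _ (e (n + #|I|)).2 h; rewrite leNgt bigt.
Qed.

Lemma longest_small mu : 0 < mu -> exists n, len n < mu.
Proof.
move=> mu0.
have H x : len (x * #|I|) <= (3 / 4) ^+ x * len 0.
  elim: x => [|x IH]; first by rewrite expr0 mul1r.
  rewrite mulSn addnC; apply: le_trans (longest_contract _) _.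
  by rewrite exprS -[leRHS]mulrA ler_pM2l ?divr_gt0.
(* This elementary bound makes (3/4)^x tend to 0; its induction closes since 3/4 + 3/16 <= 1. *)
have B x : x%:R / 4 * (3 / 4) ^+ x <= 1 :> R.
  elim: x => [|x IH]; first by rewrite !mul0r.
  rewrite exprS -natr1.
  have q1 : (3 / 4) ^+ x <= 1 :> R by rewrite exprn_ile1 // ?divr_ge0 //; lra.
  have q0 : 0 <= (3 / 4) ^+ x :> R by rewrite exprn_ge0 // divr_ge0.
  rewrite (_ : _ * _ = 3 / 4 * (x%:R / 4 * (3 / 4) ^+ x) + 3 / 16 * (3 / 4) ^+ x);
    last by field.
  lra.
pose x := (Num.bound (4 * len 0 / mu)).+1.
have x0 : 0 < x%:R :> R by rewrite ltr0n.
exists (x * #|I|)%N; apply: le_lt_trans (H x) _.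
have bx : 4 * len 0 / mu < x%:R.
  apply: lt_trans (archi_boundP _) _; last by rewrite ltr_nat ltnS.
  by rewrite divr_ge0 ?mulr_ge0 // ltW.
have : (3 / 4) ^+ x <= 4 / x%:R :> R.
  by rewrite ler_pdivlMr //; move: (B x); move: ((3 / 4) ^+ x) (x%:R : R) => q y; lra.
move=> h; apply: (@le_lt_trans _ _ (4 / x%:R * len 0)).
  by rewrite ler_wpM2r.
by rewrite mulrAC ltr_pdivrMr // (mulrC mu) -ltr_pdivrMr.
Qed.

End Contraction.

(** * Vertex matrices and their squared distances *)

Section Geometry.
Variables (R : realType) (d : nat).
Implicit Types (p q : 'M[R]_(d.+1, d)) (i j k l : 'I_d.+1).

Definition sqd p k l : R := \sum_(j < d) (p k j - p l j) ^+ 2.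

Lemma sqd_ge0 p k l : 0 <= sqd p k l.
Proof. by apply: sumr_ge0 => j _; apply: sqr_ge0. Qed.

Lemma semimetric_sqd p : semimetric (sqd p).
Proof.
split=> [k l|k]; first by apply: eq_bigr => j _; ring.
by rewrite /sqd big1 // => j _; rewrite subrr expr0n.
Qed.

Lemma edge_lengthE p k l : edge_length p k l = Num.sqrt (sqd p k l).
Proof. by congr Num.sqrt; apply: eq_bigr => j _; rewrite !mxE. Qed.

Lemma longest_edgeP p i j : longest_edge p i j <-> sqlongest (sqd p) (i, j).
Proof.
split=> -[ij le]; split=> // k l.
  case: (eqVneq k l) => [->|/le]; last by rewrite !edge_lengthE ler_sqrt // sqd_ge0.
  by rewrite (semimetric_sqd p).2 sqd_ge0.
by rewrite !edge_lengthE ler_sqrt ?sqd_ge0.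
Qed.

Lemma sqd_bisect p i j : i != j -> sqd (bisect p i j) = sqbis (sqd p) i j.
Proof.
move=> ij; apply/funext => k; apply/funext => l; rewrite /sqbis.
case: (eqVneq k l) => [->|kl]; first exact: (semimetric_sqd _).2.
have mid m : (sqd p i m + sqd p j m) / 2 - sqd p i j / 4
    = \sum_(s < d) (2^-1 * (p i s + p j s) - p m s) ^+ 2.
  rewrite /sqd -big_split /= !mulr_suml -sumrB; apply: eq_bigr => s _.
  by field.
case: (eqVneq k i) => [ki|ki].
  rewrite mid; apply: eq_bigr => s _; rewrite !mxE ki eqxx.
  by rewrite eq_sym -ki (negbTE kl) !mxE.
case: (eqVneq l i) => [li|li].
  rewrite ![sqd p k _](semimetric_sqd p).1 mid; apply: eq_bigr => s _.
  by rewrite !mxE li eqxx (negbTE ki) !mxE; ring.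
by apply: eq_bigr => s _; rewrite !mxE (negbTE ki) (negbTE li) !mxE.
Qed.

Lemma exists_sqlongest (D : 'I_d.+1 -> 'I_d.+1 -> R) : (0 < d)%N ->
  semimetric D -> (forall k l, 0 <= D k l) -> exists e, sqlongest D e.
Proof.
move=> d0 sD D0; pose e0 : 'I_d.+1 * 'I_d.+1 := (ord0, ord_max).
have e0P : e0.1 != e0.2 by rewrite -val_eqE /= eq_sym -lt0n.
pose P (e : 'I_d.+1 * 'I_d.+1) := e.1 != e.2.
have := @Order.TotalTheory.arg_maxP _ _ _ e0 P (fun e => D e.1 e.2) e0P.
case=> e eP le; exists e; split=> // k l.
case: (eqVneq k l) => [->|kl]; first by rewrite sD.2.
exact: (le (k, l)).
Qed.

(** A lower bound for the diameter bounds [theta] above. The work lies in the boundedness of the set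
    of distances, without which its [sup] would say nothing about its members. *)
Lemma simplex_diam_ge p k l : edge_length p k l <= simplex_diam p.
Proof.
pose M := \sum_k \sum_j `|p k j|.
have pM a b : `|p a b| <= M.
  rewrite /M (bigD1 a) //= (bigD1 b) //= -addrA lerDl addr_ge0 //.
    by apply: sumr_ge0.
  by apply: sumr_ge0 => ? _; apply: sumr_ge0.
have M0 : 0 <= M by apply: sumr_ge0 => ? _; apply: sumr_ge0.
apply: ub_le_sup.
  exists (Num.sqrt (\sum_(j < d) (M + M) ^+ 2)) => _ [x [y [hx hy ->]]].
  rewrite ler_sqrt; last by apply: sumr_ge0 => ? _; apply: sqr_ge0.
  apply: ler_sum => j _; rewrite -(@real_normK _ (_ 0 j)) ?num_real //.
  rewrite ler_pXn2r ?nnegrE ?addr_ge0 // !mxE.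
  have H z : simplex_hull p z -> `|z 0 j| <= M.
    move=> [a [a0 a1 ->]]; rewrite mxE; apply: le_trans (ler_norm_sum _ _ _) _.
    rewrite -[leRHS]mul1r -a1 mulr_suml; apply: ler_sum => m _.
    by rewrite normrM (ger0_norm (a0 m)) ler_wpM2l.
  by apply: le_trans (ler_normB _ _) _; apply: lerD; apply: H.
exists (row k p), (row l p).
have H m : simplex_hull p (row m p).
  exists (delta_mx 0 m); split; last by rewrite -rowE.
    by move=> i; rewrite mxE.
  rewrite (bigD1 m) //= mxE !eqxx big1 ?addr0 // => i im.
  by rewrite mxE (negbTE im) andbF.
by split.
Qed.

End Geometry.

(** * Determinants and bisection *)

Section Determinants.
Variable R : comNzRingType.

(** The matrix [U] of these row operations differs from the identity only in column [k0], and
    [a k0 = 0] makes its row [k0] a unit vector, along which the determinant is expanded. *)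
Lemma det_addrow n (A : 'M[R]_n) (k0 : 'I_n) (a : 'I_n -> R) : a k0 = 0 ->
  \det (\matrix_k (row k A + a k *: row k0 A)) = \det A.
Proof.
move=> a0; pose U : 'M[R]_n := \matrix_(i, j) ((i == j)%:R + a i * (k0 == j)%:R).
have -> : \matrix_k (row k A + a k *: row k0 A) = U *m A.
  apply/matrixP => i j; rewrite !mxE.
  under [RHS]eq_bigr do rewrite mxE mulrDl -!mulrA.
  rewrite big_split /= -mulr_sumr; congr (_ + _ * _).
    rewrite (bigD1 i) //= eqxx mul1r big1 ?addr0 // => k ki.
    by rewrite eq_sym (negbTE ki) mul0r.
  rewrite (bigD1 k0) //= eqxx mul1r big1 ?addr0 // => k ki.
  by rewrite eq_sym (negbTE ki) mul0r.
rewrite det_mulmx (expand_det_row _ k0) (bigD1 k0) //= big1 ?addr0; last first.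
  by move=> j jk; rewrite mxE a0 mul0r eq_sym (negbTE jk) addr0 mul0r.
rewrite mxE eqxx a0 mul0r addr0 mul1r /cofactor addnn -signr_odd odd_double.
rewrite (_ : row' _ _ = 1%:M) ?det1 ?expr0 ?mul1r //.
apply/matrixP => i j; rewrite !mxE (negbTE (neq_lift _ _)) mulr0 addr0.
by rewrite (inj_eq lift_inj).
Qed.

End Determinants.

Lemma det_bisect (R : fieldType) n (A : 'M[R]_n) i j : i != j ->
  \det (\matrix_k (if k == i then 2^-1 *: (row i A + row j A) else row k A))
  = 2^-1 * \det A.
Proof.
move=> ij; rewrite -(@det_addrow _ _ A j (fun k => (k == i)%:R)); last first.
  by rewrite eq_sym (negbTE ij).
set B := \matrix_k (_ + _ *: _).
rewrite (@determinant_multilinear _ _ _ B A i 2^-1 0) ?mul0r ?addr0 //.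
- by rewrite scale0r addr0 !rowK !eqxx scale1r.
- by apply/matrixP => k l; rewrite !mxE eq_sym (negbTE (neq_lift _ _)) mxE ?mul0r ?addr0.
- by apply/matrixP => k l; rewrite !mxE eq_sym (negbTE (neq_lift _ _)) !mxE ?mul0r ?addr0.
Qed.

(** Homogeneous coordinates treat all vertices alike, so that a face without vertex 0 needs no
    special care. *)
Lemma det_edge_mx (R : realType) d (p : 'M[R]_(d.+1, d)) :
  \det (edge_mx p) = \det (row_mx (const_mx 1) p : 'M[R]_(1 + d)).
Proof.
pose a (k : 'I_d.+1) : R := - (k != ord0)%:R.
rewrite -(@det_addrow _ _ (row_mx _ p : 'M[R]_(1 + d)) ord0 a); last first.
  by rewrite /a eqxx oppr0.
set A := (X in _ = \det X).
rewrite (_ : A = block_mx 1%:M (row ord0 p) 0 (edge_mx p)).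
  by rewrite det_ublock det1 mul1r.
have o0 : ord0 = lshift d ord0 :> 'I_(1 + d) by apply/val_inj.
have AE k l : A k l = row_mx (const_mx 1) p k l
    + a k * row_mx (const_mx 1) p (lshift d ord0 : 'I_(1 + d)) l.
  by rewrite -o0 /A; move: (row_mx _ _) => M; rewrite !mxE.
apply/matrixP => k l; rewrite AE /a {A AE}.
case: (split_ordP k) => k' ->; case: (split_ordP l) => l' ->.
- by rewrite block_mxEul !row_mxEl !mxE !ord1 !eqxx oppr0 mul0r addr0.
- by rewrite block_mxEur !row_mxEr !mxE !ord1 -o0 !eqxx oppr0 mul0r addr0.
- by rewrite block_mxEdl !row_mxEl !mxE /= mulr1 subrr.
- rewrite block_mxEdr !row_mxEr !mxE -o0 /= mulN1r.
  by have -> : rshift 1 k' = lift ord0 k' by apply/val_inj.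
Qed.

(** Meant for [S] the five vertices of the face, with rows bounded once and for all, while the other
    rows shrink with the diameter. *)
Lemma det_norm_le (R : realDomainType) n (A : 'M[R]_n) (S : {pred 'I_n}) (K L : R) :
  (forall i j, i \in S -> `|A i j| <= K) ->
  (forall i j, i \notin S -> `|A i j| <= L) ->
  `|\det A| <= n`!%:R * (K ^+ #|S| * L ^+ #|[predC S]|).
Proof.
move=> AK AL; rewrite /determinant.
apply: le_trans (ler_norm_sum _ _ _) _.
rewrite -(card_Sn n) mulr_natl -sumr_const.
apply: ler_sum => s _.
rewrite normrM normrX normrN1 expr1n mul1r normr_prod (bigID (mem S)) /=.
rewrite -!prodr_const; apply: ler_pM; do 1?by apply: prodr_ge0.
  by apply: ler_prod => i iS; rewrite normr_ge0 AK.
by rewrite ler_prod // => i iS; rewrite normr_ge0 AL.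
Qed.

(** * Volume of a simplex whose face has been bisected n times *)

Section CoreVolume.
Variables (R : realType) (d : nat) (f : 'I_5 -> 'I_d.+1).
Implicit Types (p q : 'M[R]_(d.+1, d)) (e : nat -> 'I_5 * 'I_5).
Local Notation core k := (k \in codom f).

Fixpoint corerun p e n : 'M[R]_(d.+1, d) :=
  if n is n'.+1 then
    bisect (corerun p e n') (f (e n').1) (f (e n').2) else p.

Definition homog p : 'M[R]_(1 + d) := row_mx (const_mx 1) p.

(** Bisections of the face halve the determinant whatever stands in the other rows, so [Y] may be
    taken from a different simplex. *)
Definition core_mix p (Y : 'M[R]_(1 + d)) : 'M[R]_(1 + d) :=
  \matrix_k (if core k then row k (homog p) else row k Y).

Lemma row_homog_bisect p i j : row i (homog (bisect p i j))
  = 2^-1 *: (row i (homog p) + row j (homog p)).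
Proof.
apply/rowP => l; rewrite !mxE; case: splitP => l' _; rewrite ?mxE ?eqxx ?mxE //.
by field.
Qed.

Lemma row_homog_bisect_neq p i j k : k != i ->
  row k (homog (bisect p i j)) = row k (homog p).
Proof.
move=> ki.
by apply/rowP => l; rewrite !mxE; case: splitP => l' _; rewrite ?mxE ?(negbTE ki) ?mxE.
Qed.

Lemma det_core_mix p e Y n : injective f -> (forall n, (e n).1 != (e n).2) ->
  \det (core_mix (corerun p e n) Y) = 2 ^- n * \det (core_mix p Y).
Proof.
move=> fI ne; elim: n => [|n IH]; first by rewrite invr1 mul1r.
rewrite exprS invfM -mulrA -IH -(@det_bisect _ _ _ (f (e n).1) (f (e n).2)); last first.
  by rewrite (inj_eq fI).
congr (\det _); apply/row_matrixP => k; rewrite !rowK !codom_f.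
case: (eqVneq k (f (e n).1)) => [->|kn]; first by rewrite codom_f row_homog_bisect.
by rewrite row_homog_bisect_neq.
Qed.

(** Subtracting a core row from the rows outside the face makes these at most [L]. Undoing the n
    bisections of the face alone then yields 2^-n and puts the original core rows back, bounded by
    [K]; here [1 <= K] accounts for the homogeneous coordinate 1. *)
Lemma det_edge_core p q e n (K L : R) : injective f ->
  (forall n, (e n).1 != (e n).2) ->
  (forall m, row (f m) q = row (f m) (corerun p e n)) ->
  1 <= K -> 0 <= L -> (forall k j, `|p k j| <= K) -> (forall k l j, `|q k j - q l j| <= L) ->
  `|\det (edge_mx q)| <= 2 ^- n * (d.+1)`!%:R * K ^+ 5 * L ^+ (d.+1 - 5).
Proof.
move=> fI ne qp K1 L0 pK qL.
pose a k : R := - (~~ core k)%:R.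
pose Y := \matrix_k (row k (homog q) - row (f ord0) (homog q)).
rewrite det_edge_mx -(@det_addrow _ _ _ (f ord0) a); last by rewrite /a codom_f oppr0.
rewrite (_ : \matrix_k _ = core_mix (corerun p e n) Y); last first.
  apply/row_matrixP => k; rewrite !rowK /a.
  case: ifPn => [/codomP[m ->]|kf]; last by rewrite scaleN1r.
  rewrite oppr0 scale0r addr0; apply/rowP => l; rewrite !mxE.
  case: splitP => l' _; rewrite ?mxE //.
  by have /rowP/(_ l') := qp m; rewrite !mxE.
rewrite det_core_mix // normrM ger0_norm ?invr_ge0 ?exprn_ge0 //.
rewrite -(mulrA (2 ^- n)) -(mulrA (2 ^- n)) -(mulrA _ (K ^+ 5)).
rewrite ler_wpM2l ?invr_ge0 ?exprn_ge0 //.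
have cS : #|[pred k | core k]| = 5 by rewrite (card_codom fI) card_ord.
have <- : #|[predC [pred k | core k]]| = (d.+1 - 5)%N.
  by have := cardC [pred k | core k]; rewrite cS card_ord => h; apply/eqP; rewrite -(eqn_add2l 5) h subnKC // -h leq_addr.
rewrite -[X in K ^+ X]cS; apply: det_norm_le => k l; rewrite inE => kf; rewrite mxE.
  rewrite kf !mxE; case: splitP => l' _; rewrite ?mxE ?pK //.
  by rewrite ger0_norm.
rewrite (negbTE kf) !mxE; case: splitP => l' _; rewrite ?mxE ?qL //.
by rewrite subrr normr0.
Qed.

End CoreVolume.

(** * Degeneration passes from a face to the simplex *)

Section FaceLemma.
Variables (R : realType) (d : nat) (p : 'M[R]_(d.+1, d)) (f : 'I_5 -> 'I_d.+1).
Hypothesis fI : injective f.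
Let D0 k l := sqd p (f k) (f l).
Variable e : nat -> 'I_5 * 'I_5.
Hypothesis lce : forall n, sqlongest (sqrun D0 e n) (e n).
Hypothesis div : forall K, exists N, forall n, (N <= n)%N ->
  K <= 2 ^+ n * sqlen D0 e n ^+ 2.

Let neq n : (e n).1 != (e n).2. Proof. by have [] := lce n. Qed.

(** The current simplex and the number of prescribed face bisections done so far. *)
Let state : Type := 'M[R]_(d.+1, d) * nat.

Let core_edge n := (f (e n).1, f (e n).2).

(** The first end is the one that moves, hence the orientation away from the face. By [move_longest]
    the default is never taken. *)
Let rider_edge (q : 'M[R]_(d.+1, d)) : 'I_d.+1 * 'I_d.+1 :=
  xget (ord0, ord0) [set y | sqlongest (sqd q) y /\ y.1 \notin codom f].

Let move (s : state) : ('I_d.+1 * 'I_d.+1) * nat :=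
  if `[< sqlongest (sqd s.1) (core_edge s.2) >] then (core_edge s.2, s.2.+1)
  else (rider_edge s.1, s.2).

Let step (s : state) : state :=
  (bisect s.1 (move s).1.1 (move s).1.2, (move s).2).

Let run t : state := iter t step (p, 0%N).

Let core_inv (s : state) :=
  forall m, row (f m) s.1 = row (f m) (corerun f p e s.2).

Let sqd_corerun n k l : sqd (corerun f p e n) (f k) (f l) = sqrun D0 e n k l.
Proof.
elim: n k l => // n IH k l.
by rewrite /= sqd_bisect ?(inj_eq fI) // /sqbis !(inj_eq fI) !IH.
Qed.

Let sqd_core s k l : core_inv s -> sqd s.1 (f k) (f l) = sqrun D0 e s.2 k l.
Proof.
move=> cs; rewrite -sqd_corerun; apply: eq_bigr => j _.
by have /rowP/(_ j) := cs k; have /rowP/(_ j) := cs l; rewrite !mxE => -> ->.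
Qed.

(** The prescribed edge is longest within the face. If it is not longest in the simplex, no edge of
    the face is, and every longest edge has an end outside. *)
Let move_longest s : core_inv s -> sqlongest (sqd s.1) (move s).1 /\
  ((move s).2 = s.2 -> (move s).1.1 \notin codom f).
Proof.
move=> cs; rewrite /move; case: asboolP => [lc|nlc].
  by split=> // /eqP; rewrite /= eqn_leq ltnn.
have d0 : (0 < d)%N.
  by have := leq_card f fI; rewrite !card_ord; case: d.
have [y ly] := exists_sqlongest d0 (semimetric_sqd s.1) (sqd_ge0 s.1).
suff [z [lz zf]] : exists z, sqlongest (sqd s.1) z /\ z.1 \notin codom f.
  rewrite /rider_edge /=; case: xgetP => [w -> //|/(_ z)]; by case.
have [y1|] := boolP (y.1 \in codom f); last by exists y.
have [y2|y2] := boolP (y.2 \in codom f); last first.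
  exists (y.2, y.1); split=> //; case: ly => yy ly; split; first by rewrite eq_sym.
  by move=> k l; rewrite [leRHS](semimetric_sqd s.1).1; apply: ly.
case: nlc; split; first by rewrite /core_edge /= (inj_eq fI).
move=> k l; apply: le_trans (ly.2 k l) _.
have /codomP[a ->] := y1; have /codomP[b ->] := y2.
by rewrite /core_edge /= !sqd_core //; have [_] := lce s.2; apply.
Qed.

Let core_inv_run t : core_inv (run t).
Proof.
elim: t => [//|t IH] m; rewrite [run _]/(step (run t)) /step /=.
have [[n1 _] n2] := move_longest IH.
move: n1 n2; rewrite /move; case: asboolP => _ /= n1 n2.
  apply/rowP => j; rewrite !mxE (inj_eq fI).
  have H a : (run t).1 (f a) j = corerun f p e (run t).2 (f a) j.
    by have /rowP/(_ j) := IH a; rewrite !mxE.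
  by case: ifP => _; rewrite !mxE !H.
rewrite -IH; apply/rowP => j; rewrite !mxE ifF ?mxE //.
by apply/negbTE/negP => /eqP h; have := n2 erefl; rewrite -h codom_f.
Qed.

Let run_longest t : sqlongest (sqd (run t).1) (move (run t)).1.
Proof. by case: (move_longest (core_inv_run t)). Qed.

Let len t := sqd (run t).1 (move (run t)).1.1 (move (run t)).1.2.

Let sqd_runS t : sqd (run t.+1).1 =
  sqbis (sqd (run t).1) (move (run t)).1.1 (move (run t)).1.2.
Proof. by rewrite sqd_bisect //; case: (run_longest t). Qed.

Let sqlen_le t : sqlen D0 e (run t).2 <= len t.
Proof. by rewrite /sqlen -sqd_core //; have [_] := run_longest t; apply. Qed.

Let semi n : semimetric (sqrun D0 e n).
Proof.
by split=> [k l|k]; rewrite -!sqd_corerun; [apply: (semimetric_sqd _).1|apply: (semimetric_sqd _).2].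
Qed.

(** Longest lengths never increase, so a zero would persist and contradict [div] for 1. *)
Let sqlen_gt0 n : 0 < sqlen D0 e n.
Proof.
rewrite lt_neqAle -{2}[0]((semi n).2 ord0) (lce n).2 andbT eq_sym.
apply/negP => /eqP z.
have [N HN] := div 1.
have := HN (n + N)%N (leq_addl _ _); apply/negP; rewrite -ltNge.
suff -> : sqlen D0 e (n + N) = 0 by rewrite expr0n mulr0.
apply/eqP; rewrite eq_le -{2}[0]((semi (n + N)%N).2 ord0) (lce _).2 andbT -z.
exact: (longest_monotone (semi 0)).
Qed.

Let count_mono t u : ((run t).2 <= (run (t + u)).2)%N.
Proof.
elim: u => [|u IH]; first by rewrite addn0.
apply: leq_trans IH _; rewrite addnS [run _.+1]/(step _) /step /move /=.
by case: asboolP.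
Qed.

(* As long as only riders are moved the core does not change, whereas the
   diameter tends to 0. *)
Let count_cvg n : exists t0, forall t, (t0 <= t)%N -> (n <= (run t).2)%N.
Proof.
suff [t0 H] : exists t0, (n <= (run t0).2)%N.
  by exists t0 => t /subnKC <-; apply: leq_trans H (count_mono _ _).
elim: n => [|n [t0 IH]]; first by exists 0%N.
apply: contrapT => H.
have cst u : (run (t0 + u)).2 = n.
  apply/eqP; rewrite eqn_leq (leq_trans IH (count_mono _ _)) andbT.
  by rewrite leqNgt; apply/negP => h; apply: H; exists (t0 + u)%N.
have DS u : sqd (run (t0 + u.+1)).1 = sqbis (sqd (run (t0 + u)).1)
    (move (run (t0 + u))).1.1 (move (run (t0 + u))).1.2.
  by rewrite addnS sqd_runS.
have [u] := @longest_small R _ (fun u => sqd (run (t0 + u)).1)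
  (fun u => (move (run (t0 + u))).1) (semimetric_sqd _)
  (fun u => run_longest _) DS _ (sqlen_gt0 n).
by apply/negP; rewrite -leNgt -{1}(cst u) sqlen_le.
Qed.

Lemma face_degenerates : Defs.nondegenerate p -> has_degenerating_branch p.
Proof.
move=> np; split=> //; exists (fun t => (run t).1); split.
  split=> // t; exists (move (run t)).1.1, (move (run t)).1.2.
  split; last by left.
  by apply/longest_edgeP; have := run_longest t; case: ((move (run t)).1).
have d4 : (4 <= d)%N by have := leq_card f fI; rewrite !card_ord.
pose K := (\sum_k \sum_j `|p k j|) + 1.
have pK k j : `|p k j| <= K.
  rewrite /K (bigD1 k) //= (bigD1 j) //= -!addrA lerDl !addr_ge0 //.
    by apply: sumr_ge0.
  by apply: sumr_ge0 => ? _; apply: sumr_ge0.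
have K1 : 1 <= K by rewrite lerDr; apply: sumr_ge0 => ? _; apply: sumr_ge0.
pose C := (d.+1)`!%:R * K ^+ 5 / d`!%:R.
have theta_le t : theta (run t).1 <=
    C / (2 ^+ (run t).2 * sqlen D0 e (run t).2 ^+ 2).
  have l0 : 0 < len t := lt_le_trans (sqlen_gt0 _) (sqlen_le t).
  pose L := Num.sqrt (len t).
  have L0 : 0 < L by rewrite sqrtr_gt0.
  have qL k l j : `|(run t).1 k j - (run t).1 l j| <= L.
    rewrite -sqrtr_sqr ler_sqrt ?(ltW l0) //.
    apply: le_trans (_ : sqd (run t).1 k l <= _); last by case: (run_longest t).
    by rewrite /sqd (bigD1 j) //= lerDl sumr_ge0 // => ? _; apply: sqr_ge0.
  have vol := det_edge_core fI neq (core_inv_run t) K1 (ltW L0) pK qL.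
  have dL : L <= simplex_diam (run t).1.
    by rewrite /L /len -edge_lengthE simplex_diam_ge.
  have dL0 := lt_le_trans L0 dL.
  rewrite /theta /simplex_vol ler_pdivrMr ?exprn_gt0 // ler_pdivrMr ?ltr0n ?fact_gt0 //.
  apply: le_trans vol _.
  have sl0 := sqlen_gt0 (run t).2; have two0 : 0 < 2 ^+ (run t).2 :> R by rewrite exprn_gt0.
  have f0 : 0 < d`!%:R :> R by rewrite ltr0n fact_gt0.
  rewrite (_ : _ * d`!%:R = 2 ^- (run t).2 * (d.+1)`!%:R * K ^+ 5 *
    (simplex_diam (run t).1 ^+ d / sqlen D0 e (run t).2 ^+ 2)); last first.
    move: f0 sl0 two0; rewrite /C; move: (_`!%:R : R) (K ^+ 5) (_ ^+ d) (2 ^+ _).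
    move: (sqlen _ _ _) ((d.+1)`!%:R : R) => a b c K5 x y c0 a0 y0.
    by field; rewrite !gt_eqF.
  rewrite ler_wpM2l //.
    by rewrite !mulr_ge0 ?invr_ge0 ?exprn_ge0 // (le_trans _ K1).
  rewrite ler_pdivlMr ?exprn_gt0 //.
  (* The diameter is at least [L], and L^d = L^(d-4) * L^4, where L^4 dominates the square of the
     longest squared length of the face. *)
  apply: le_trans (_ : L ^+ (d.+1 - 5) * len t ^+ 2 <= _).
    rewrite ler_wpM2l ?exprn_ge0 ?(ltW L0) //.
    by rewrite ler_pXn2r ?nnegrE ?(ltW sl0) ?(ltW l0) // sqlen_le.
  rewrite -(sqr_sqrtr (ltW l0)) -/L -exprM -exprD subSS subnK //.
  by apply: lerXn2r => //; rewrite nnegrE ltW.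
have theta_ge t : 0 <= theta (run t).1.
  rewrite /theta divr_ge0 ?exprn_ge0 //; first by rewrite divr_ge0.
  by apply: le_trans (simplex_diam_ge _ ord0 ord0); apply: sqrtr_ge0.
apply/cvgrPdist_le => eps eps0.
have C0 : 0 <= C by rewrite !mulr_ge0 ?invr_ge0 ?exprn_ge0 // (le_trans _ K1).
have [N HN] := div (C / eps); have [t0 Ht] := count_cvg N.
exists t0 => // t /= /Ht /HN h.
rewrite sub0r normrN ger0_norm //; apply: le_trans (theta_le t) _.
rewrite ler_pdivrMr; last by rewrite mulr_gt0 ?exprn_gt0.
by move: h; rewrite ler_pdivrMr // mulrC.
Qed.

End FaceLemma.

(** * Events on disjoint groups of independent variables *)

Section Independence.
Context d (T : measurableType d) (R : realType) (P : probability T R).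
Variables (I : finType) (Z : I -> T -> R).
Hypothesis mZ : forall i, measurable_fun setT (Z i).
Hypothesis indZ : mutually_independent P Z.
Implicit Types J K : {set I}.

(** A pi-system that generates the events depending on the variables in [J] only. *)
Definition rects J : set (set T) :=
  [set A | exists2 B : I -> set R, (forall i, measurable (B i)) &
     A = \bigcap_(i in [set` J]) Z i @^-1` B i].

Definition sig J : set (set T) := <<s rects J >>.

Lemma rects_measurable J A : rects J A -> measurable A.
Proof.
move=> [B mB ->]; apply: fin_bigcap_measurable => // i _.
by rewrite -[X in measurable X]setTI; apply: mZ.
Qed.

Lemma sig_measurable J A : sig J A -> measurable A.
Proof.
apply: smallest_sub; first exact: sigma_algebra_measurable.
exact: rects_measurable.
Qed.

Lemma rectsT J : rects J setT.
Proof.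
by exists (fun _ => setT) => //; apply/seteqP; split.
Qed.

Lemma rectsI J : setI_closed (rects J).
Proof.
move=> A B [A' mA ->] [B' mB ->]; exists (fun i => A' i `&` B' i).
  by move=> i; apply: measurableI.
by rewrite -bigcapI; apply: eq_bigcapr => i _; rewrite preimage_setI.
Qed.

Lemma rects_sub J K : J \subset K -> rects J `<=` rects K.
Proof.
move=> JK _ [B mB ->]; exists (fun i => if i \in J then B i else setT).
  by move=> i; case: ifP.
apply/seteqP; split=> x /= Bx i /= iJ.
  by case: ifPn => // iJ'; apply: Bx.
by have := Bx i; rewrite /= iJ; apply; apply: (fintype.subsetP JK).
Qed.

Lemma sig_sub J K : J \subset K -> sig J `<=` sig K.
Proof. by move=> JK; apply: sub_smallest2r (rects_sub JK). Qed.

Lemma sig_coord J i B : i \in J -> measurable B -> sig J (Z i @^-1` B).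
Proof.
move=> iJ mB; apply: sub_sigma_algebra.
exists (fun k => if k == i then B else setT); first by move=> k; case: ifP.
apply/seteqP; split=> [x Bx k _ /=|x /(_ i iJ) /=]; last by rewrite eqxx.
by case: eqP => [->|].
Qed.

Lemma rects_indep J K A B : fintype.disjoint (mem J) (mem K) -> rects J A -> rects K B ->
  P (A `&` B) = (P A * P B)%E.
Proof.
move=> JK [A' mA ->] [B' mB ->].
pose C i := if i \in J then A' i else B' i.
have mC i : measurable (C i) by rewrite /C; case: ifP.
have eA : \bigcap_(i in [set` J]) Z i @^-1` A' i = \bigcap_(i in [set` J]) Z i @^-1` C i.
  by apply: eq_bigcapr => i /= iJ; rewrite /C iJ.
have eB : \bigcap_(i in [set` K]) Z i @^-1` B' i = \bigcap_(i in [set` K]) Z i @^-1` C i.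
  by apply: eq_bigcapr => i /= iK; rewrite /C (disjointFl JK).
rewrite eA eB -bigcap_setU (_ : [set` J] `|` [set` K] = [set` (J :|: K)%SET]); last first.
  by apply/seteqP; split=> i /=; rewrite inE => /orP.
rewrite !indZ // -bigU //=; apply: eq_bigl => i; by rewrite !inE.
Qed.

(** Uniqueness of finite measures that agree on a pi-system is used twice: it reduces first [B],
    then [A] to rectangles. *)
Lemma sig_indep J K A B : fintype.disjoint (mem J) (mem K) ->
  sig J A -> sig K B -> P (A `&` B) = (P A * P B)%E.
Proof.
move=> JK sA.
have mA := sig_measurable sA.
have step C D (G : set (set T)) : measurable C -> G setT -> setI_closed G ->
    G `<=` measurable -> (forall E, G E -> P (C `&` E) = (P C * P E)%E) ->
    <<s G >> D -> P (C `&` D) = (P C * P D)%E.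
  move=> mC GT GI Gm GE sD.
  have PC0 : (0 <= fine (P C))%R by rewrite fine_ge0.
  have U := @g_sigma_algebra_measure_unique _ R T G Gm (fun _ => setT) (fun _ => GT) _
    (mrestr P mC) (mscale (NngNum PC0) P) GI _ _ D sD.
  have mE E : mscale (NngNum PC0) P E = (P C * P E)%E.
    by rewrite /mscale /= fineK ?fin_num_measure.
  rewrite setIC -mE; apply: U.
  - by apply/seteqP; split=> // x _; exists 0%N.
  - by move=> E GE'; rewrite [RHS]mE -GE // setIC.
  - move=> _; apply: (@le_lt_trans _ _ 1%E); last exact: ltry.
    by apply: (@probability_le1 _ _ _ P (setT `&` C)); rewrite setTI.
apply: (step A B (rects K)) => //; [exact: rectsT | exact: rectsI | exact: rects_measurable |].
move=> E rE; rewrite setIC muleC.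
apply: (step E A (rects J)) => //; first exact: rects_measurable rE.
- exact: rectsT.
- exact: rectsI.
- exact: rects_measurable.
- by move=> F rF; rewrite setIC muleC; apply: rects_indep JK rF rE.
Qed.

Lemma sig_bigcap J n (A : nat -> set T) :
  (forall a, (a < n)%N -> sig J (A a)) -> sig J (\bigcap_(a < n) A a).
Proof.
move=> sA; pose TJ := g_sigma_algebraType (rects J).
by apply: (@fin_bigcap_measurable _ TJ) => //; exact: finite_II.
Qed.

Lemma sig_indep_seq n (J : nat -> {set I}) (A : nat -> set T) :
  (forall a b, (a < b < n)%N -> fintype.disjoint (mem (J a)) (mem (J b))) ->
  (forall a, (a < n)%N -> sig (J a) (A a)) ->
  P (\bigcap_(a < n) A a) = (\prod_(a < n) P (A a))%E.
Proof.
elim: n => [|n IH] dJ sA.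
  by rewrite big_ord0 II0 bigcap_set0 probability_setT.
rewrite big_ord_recr /= -IH; [|by move=> a b /andP[ab bn]; apply: dJ; rewrite ab ltnS ltnW|]; last first.
  by move=> a an; apply: sA; rewrite ltnS ltnW.
pose K := (\bigcup_(a < n) J a)%SET.
rewrite -(@sig_indep K (J n)); last exact: sA.
- congr (P _); apply/seteqP; split=> [x H|x [H Hn] a /=].
    by split=> [a /= an|]; apply: H => /=; rewrite ltnS // ltnW.
  by rewrite ltnS leq_eqVlt => /predU1P[->//|]; apply: H.
- rewrite disjoint_sym /K disjoint_subset; apply/fintype.subsetP => i iJ; rewrite inE.
  apply/negP => /bigcupP[a _ ia].
  have an : (a < n < n.+1)%N by rewrite ltn_ord ltnS leqnn.
  by rewrite (disjointFr (dJ a n an) ia) in iJ.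
- apply: sig_bigcap => a an; apply: (@sig_sub (J a)); last by apply: sA; rewrite ltnS ltnW.
  by rewrite /K; apply: (finset.bigcup_sup (Ordinal an)).
Qed.

End Independence.

Lemma joint_law d d1 d2 (T : measurableType d) (T1 : measurableType d1)
    (T2 : measurableType d2) (R : realType) (P : probability T R)
    (U : {RV P >-> T1}) (V : {RV P >-> T2}) :
  (forall A B, measurable A -> measurable B ->
    P (U @^-1` A `&` V @^-1` B) = (P (U @^-1` A) * P (V @^-1` B))%E) ->
  forall E : set (T1 * T2), measurable E ->
  P ((fun w => (U w, V w)) @^-1` E) = (distribution P U \x distribution P V)%E E.
Proof.
move=> ind E mE.
have mUV : measurable_fun setT (fun w => (U w, V w)) by apply: measurable_fun_pair.
pose UV : {RV P >-> (T1 * T2)%type} := HB.pack (fun w => (U w, V w)) (isMeasurableFun.Build _ _ _ _ _ mUV).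
symmetry; exact: (product_measure_unique (m' := distribution P UV)).
Qed.

(** * Zeros of polynomials in independent atomless variables *)

Section PolynomialFunctions.
Variables (R : comNzRingType) (I : finType).
Implicit Types J : {set I}.

(** Polynomial functions are given by their construction: measurability, continuity and dependence
    on the variables in [J] alone follow by induction on it. *)
Inductive polyf J : ((I -> R) -> R) -> Prop :=
| polyf_cst c : polyf J (fun _ => c)
| polyf_var i : i \in J -> polyf J (fun x => x i)
| polyf_add f g : polyf J f -> polyf J g -> polyf J (fun x => f x + g x)
| polyf_mul f g : polyf J f -> polyf J g -> polyf J (fun x => f x * g x).

Lemma polyf_sum J (K : Type) (s : seq K) (Q : pred K) (F : K -> (I -> R) -> R) :
  (forall k, polyf J (F k)) -> polyf J (fun x => \sum_(k <- s | Q k) F k x).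
Proof.
move=> pF; elim: s => [|k s IH].
  by under eq_fun do rewrite big_nil; apply: polyf_cst.
under eq_fun do rewrite big_cons; case: (Q k) => //.
by apply: (polyf_add (pF k)).
Qed.

Lemma polyf_prod J (K : Type) (s : seq K) (Q : pred K) (F : K -> (I -> R) -> R) :
  (forall k, polyf J (F k)) -> polyf J (fun x => \prod_(k <- s | Q k) F k x).
Proof.
move=> pF; elim: s => [|k s IH].
  by under eq_fun do rewrite big_nil; apply: polyf_cst.
under eq_fun do rewrite big_cons; case: (Q k) => //.
by apply: (polyf_mul (pF k)).
Qed.

Lemma polyf_det J n (A : (I -> R) -> 'M[R]_n) :
  (forall i j, polyf J (fun x => A x i j)) -> polyf J (fun x => \det (A x)).
Proof.
move=> pA; apply: polyf_sum => s; apply: polyf_mul; first exact: polyf_cst.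
by apply: polyf_prod.
Qed.

Lemma polyf_opp J f : polyf J f -> polyf J (fun x => - f x).
Proof.
move=> pf; under eq_fun do rewrite -mulN1r.
by apply: polyf_mul => //; apply: polyf_cst.
Qed.

Lemma polyf_sub J f g : polyf J f -> polyf J g -> polyf J (fun x => f x - g x).
Proof. by move=> pf pg; apply: polyf_add => //; apply: polyf_opp. Qed.

Lemma polyf_exp J f n : polyf J f -> polyf J (fun x => f x ^+ n).
Proof.
move=> pf; elim: n => [|n IH]; first by under eq_fun do rewrite expr0; apply: polyf_cst.
by under eq_fun do rewrite exprS; apply: polyf_mul.
Qed.

Lemma polyf_local J f x y : polyf J f -> {in J, x =1 y} -> f x = f y.
Proof.
by move=> pf xy; elim: pf => //= [f1 f2 _ -> _ ->|f1 f2 _ -> _ ->].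
Qed.

(** Singling out one variable drives the induction in [polyf_null]. The uniform bound [n] on the
    degree makes the coefficients a random vector of fixed length. *)
Lemma polyf_coef J i f : polyf J f -> exists n (Q : (I -> R) -> {poly R}),
  [/\ forall x, (size (Q x) <= n)%N,
      forall m, polyf (J :\ i)%SET (fun x => (Q x)`_m)
    & forall x, f x = (Q x).[x i]].
Proof.
elim=> [c|k kJ|f1 f2 _ [n1 [Q1 [s1 c1 e1]]] _ [n2 [Q2 [s2 c2 e2]]]
  |f1 f2 _ [n1 [Q1 [s1 c1 e1]]] _ [n2 [Q2 [s2 c2 e2]]]].
- exists 1%N, (fun _ => c%:P); split=> [x|m|x]; last by rewrite hornerC.
    by rewrite size_polyC leq_b1.
  exact: polyf_cst.
- have [->|ki] := eqVneq k i.
    exists 2%N, (fun _ => 'X); split=> [x|m|x]; last by rewrite hornerX.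
      by rewrite size_polyX.
    exact: polyf_cst.
  exists 1%N, (fun x => (x k)%:P); split=> [x|m|x]; last by rewrite hornerC.
    by rewrite size_polyC leq_b1.
  under eq_fun do rewrite coefC; case: m => [|m] /=; last exact: polyf_cst.
  by apply: polyf_var; rewrite !inE ki.
- exists (maxn n1 n2), (fun x => Q1 x + Q2 x); split=> [x|m|x].
  + by rewrite (leq_trans (size_polyD _ _)) // geq_max !leq_max s1 s2 orbT.
  + by under eq_fun do rewrite coefD; apply: polyf_add.
  + by rewrite hornerD -e1 -e2.
- exists (n1 + n2)%N, (fun x => Q1 x * Q2 x); split=> [x|m|x].
  + rewrite (leq_trans (size_polyMleq _ _)) // (leq_trans (leq_pred _)) //.
    by rewrite leq_add.
  + under eq_fun do rewrite coefM; apply: polyf_sum => j.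
    exact: polyf_mul.
  + by rewrite hornerM -e1 -e2.
Qed.

End PolynomialFunctions.

Lemma polyf_continuous (R : realType) m n J (f : ('I_m * 'I_n -> R) -> R) :
  polyf J f -> continuous (fun p : 'M[R]_(m, n) => f (fun ij => p ij.1 ij.2)).
Proof.
elim=> [c|k _|f1 f2 _ c1 _ c2|f1 f2 _ c1 _ c2] p.
- exact: (@cst_continuous _ _ c p).
- exact: (@coord_continuous R m n k.1 k.2 p).
- exact: (continuousD (c1 p) (c2 p)).
- exact: (continuousM (c1 p) (c2 p)).
Qed.

Lemma poly_roots_seq (F : idomainType) (q : {poly F}) : q != 0 ->
  exists s : seq F, forall u, root q u -> u \in s.
Proof.
move En : (size q) => n; elim: n q En => [|n IH] q sq q0.
  by move/eqP: sq; rewrite size_poly_eq0 (negbTE q0).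
have [[a qa]|no] := pselect (exists a, root q a); last first.
  by exists [::] => u qu; case: no; exists u.
have [r qE] := factor_theorem q a qa.
have r0 : r != 0 by apply: contraNneq q0 => r0; rewrite qE r0 mul0r.
have [|s rs] := IH r _ r0.
  by move: sq; rewrite qE size_Mmonic ?monicXsubC // size_XsubC addn2 => -[].
exists (a :: s) => u; rewrite qE rootM root_XsubC inE => /orP[/rs ->|->] //.
by rewrite orbT.
Qed.

Section PolynomialsOfIndependentVariables.
Context d (T : measurableType d) (R : realType) (P : probability T R).
Variables (I : finType) (Z : I -> T -> R).
Hypothesis mZ : forall i, measurable_fun setT (Z i).
Hypothesis indZ : mutually_independent P Z.
Implicit Types J K : {set I}.
Local Notation at_Z f := (fun w => f (Z^~ w)).

Lemma polyf_sig J f : polyf J f ->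
  measurable_fun (setT : set (g_sigma_algebraType (rects Z J))) (at_Z f).
Proof.
elim=> [c|k kJ|f1 f2 _ c1 _ c2|f1 f2 _ c1 _ c2] /=.
- exact: measurable_cst.
- by move=> _ B mB; rewrite setTI; apply: sig_coord.
- exact: measurable_funD.
- exact: measurable_funM.
Qed.

Lemma polyf_measurable J f : polyf J f -> measurable_fun setT (at_Z f).
Proof.
move=> /polyf_sig mf _ B mB; apply: (sig_measurable mZ (J := J)).
exact: mf.
Qed.

Hypothesis atomless : forall i x, P (Z i @^-1` [set x]) = 0%E.

Let mpre i (A : set R) : measurable A -> measurable (Z i @^-1` A).
Proof. by move=> mA; rewrite -[X in measurable X]setTI; apply: mZ. Qed.

Lemma measurable_seq (s : seq R) : measurable [set` s].
Proof.
apply: countable_measurable => [x|]; first exact: measurable_set1.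
exact: finite_set_countable (finite_seq s).
Qed.

Lemma atomless_seq i (s : seq R) : P (Z i @^-1` [set` s]) = 0%E.
Proof.
elim: s => [|x s IH].
  by rewrite (_ : _ @^-1` _ = set0) ?measure0 //; apply/seteqP; split=> w.
rewrite (_ : [set` x :: s] = [set x] `|` [set` s]); last first.
  by apply/seteqP; split=> y /=; rewrite inE => /predU1P.
rewrite preimage_setU.
apply: null_set_setU; [exact: mpre|apply: mpre; exact: measurable_seq|exact: atomless|exact: IH].
Qed.

(** Induction on the number of variables. By [x0], some coefficient with respect to a variable [i]
    is a nonzero polynomial and so vanishes with probability 0; elsewhere [f] is a nonzero
    polynomial in [Z i]. *)
Lemma polyf_null J f x0 : polyf J f -> f x0 != 0 ->
  P [set w | f (Z^~ w) = 0] = 0%E.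
Proof.
move En : #|J| => n; elim: n J f En => [|n IH] J f cJ pf f0.
  rewrite (_ : [set w | _] = set0) ?measure0 //; apply/seteqP; split=> // w /=.
  rewrite (polyf_local (y := x0) pf) => [/eqP|i]; first by rewrite (negbTE f0).
  by move/eqP: cJ; rewrite cards_eq0 => /eqP ->; rewrite inE.
have [i iJ] : exists i, i \in J by apply/set0Pn; rewrite -cards_eq0 cJ.
have [k [Q [sQ cQ fQ]]] := polyf_coef i pf.
have [m mk Qm] : exists2 m : 'I_k, true & (Q x0)`_m != 0.
  apply: contrapT => H; move/eqP: f0; apply; rewrite fQ (_ : Q x0 = 0) ?horner0 //.
  apply/polyP => m; rewrite coef0; have [mk|km] := ltnP m k.
    by apply: contrapT => /eqP h; apply: H; exists (Ordinal mk).
  by rewrite nth_default // (leq_trans (sQ _)).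
have null_m : P [set w | (Q (Z^~ w))`_m = 0] = 0%E.
  by apply: IH (cQ m) Qm; have := cardsD1 i J; rewrite iJ cJ => -[].
(* The coefficients involve only the variables other than [i], so their vector is independent of
   [Z i]. *)
pose V0 w := [tuple (Q (Z^~ w))`_j | j < k].
have sV A : measurable A -> sig Z (J :\ i)%SET (V0 @^-1` A).
  move=> mA.
  have mV : measurable_fun (setT : set (g_sigma_algebraType (rects Z (J :\ i)%SET))) V0.
    apply/measurable_fun_tnthP => j.
    rewrite (_ : _ \o _ = fun w => (Q (Z^~ w))`_j); last first.
      by apply/funext => w; rewrite /= tnth_mktuple.
    exact: (polyf_sig (cQ j)).
  by rewrite -[X in sig _ _ X]setTI; apply: mV.
have mV0 : measurable_fun setT V0.
  by move=> _ A mA; rewrite setTI; apply: sig_measurable mZ _ _ (sV _ mA).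
pose V : {RV P >-> k.-tuple R} := HB.pack V0 (isMeasurableFun.Build _ _ _ _ _ mV0).
pose U : {RV P >-> R} := HB.pack (Z i) (isMeasurableFun.Build _ _ _ _ _ (mZ i)).
pose g (z : k.-tuple R * R) := \sum_(j < k) tnth z.1 j * z.2 ^+ j.
pose E : set (k.-tuple R * R) := [set z | tnth z.1 m != 0 /\ g z = 0].
have mE : measurable E.
  have mt j : measurable_fun setT (fun z : k.-tuple R * R => tnth z.1 j).
    exact: measurableT_comp (measurable_tnth j) measurable_fst.
  rewrite (_ : E = (fun z => tnth z.1 m) @^-1` (~` [set 0]) `&` g @^-1` [set 0]); last first.
    by apply/seteqP; split=> z; [case=> /eqP|case=> /= /eqP].
  apply: measurableI; rewrite -[X in measurable X]setTI.
    by apply: mt => //; apply: measurableC.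
  apply: (_ : measurable_fun setT g) => //.
  apply: measurable_sum => j; apply: measurable_funM => //.
  exact: measurable_funX measurable_snd.
have PE : P ((fun w => (V w, U w)) @^-1` E) = 0%E.
  rewrite joint_law //; last first.
    move=> A B mA mB; apply: (sig_indep mZ indZ (J := (J :\ i)%SET) (K := [set i]%SET)).
    - by rewrite disjoint_sym disjoints1 !inE eqxx.
    - exact: sV.
    - by apply: sig_coord => //; rewrite inE.
  (* For fixed coefficients [v] with nonzero entry [m], the section consists of roots of [Poly v],
     finitely many, which an atomless law does not see. *)
  rewrite /product_measure1 /=; apply: integral0_eq => v _ /=.
  rewrite /distribution /pushforward /=.
  pose q := Poly (tval v).
  have [vm|vm] := eqVneq (tnth v m) 0.
    rewrite (_ : _ @^-1` _ = set0) ?measure0 //.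
    apply/seteqP; split=> // w; rewrite /xsection /= inE => -[/=].
    by rewrite vm eqxx.
  have q0 : q != 0.
    apply: contraNneq vm => q0; have := congr1 (fun p : {poly R} => p`_m) q0.
    by rewrite coef_Poly coef0 (tnth_nth 0) => ->.
  have [s qs] : exists s : seq R, forall u, root q u -> u \in s.
    exact: poly_roots_seq.
  apply: (subset_measure0 _ _ _ (atomless_seq i s)).
  - by apply: mpre; apply: measurable_xsection.
  - by apply: mpre; apply: measurable_seq.
  - move=> w; rewrite /xsection /= inE => -[_ /= gw]; apply: qs.
    apply/eqP; transitivity (g (v, Z i w)) => //; apply/eqP.
    rewrite /g /= horner_coef.
    have qk : (size q <= k)%N by rewrite (leq_trans (size_Poly _)) // size_tuple.
    rewrite (big_ord_widen k (fun j => q`_j * Z i w ^+ j) qk) [eqbRHS](bigID (fun j : 'I_k => (j < size q)%N)) /=.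
    rewrite [X in _ == _ + X]big1 ?addr0; last first.
      by move=> j; rewrite -leqNgt (tnth_nth 0) => h; rewrite -(coef_Poly (tval v)) -/q nth_default // mul0r.
    by apply/eqP; apply: eq_bigr => j _; rewrite (tnth_nth 0) coef_Poly.
have mc m' : measurable [set w | (Q (Z^~ w))`_m' = 0].
  have := polyf_measurable (cQ m') measurableT (measurable_set1 0).
  by rewrite setTI.
have mPE : measurable ((fun w => (V w, U w)) @^-1` E).
  rewrite -[X in measurable X]setTI.
  by apply: (measurable_fun_pair (f := V) (g := U)).
apply: (subset_measure0 _ _ _ (null_set_setU _ _ null_m PE)) => //.
- have := polyf_measurable pf measurableT (measurable_set1 0).
  by rewrite setTI.
- exact: measurableU.
move=> w /= fw; have [h|h] := eqVneq ((Q (Z^~ w))`_m) 0; [by left|right].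
split; rewrite /= ?tnth_mktuple //; transitivity (f (Z^~ w)) => //.
rewrite fQ (horner_coef_wide _ (sQ _)).
by apply: eq_bigr => j _; rewrite tnth_mktuple.
Qed.

End PolynomialsOfIndependentVariables.

(** * Ties and degeneracy as polynomial equations *)

Section GenericSimplices.
Variables (R : realType) (d : nat).
Implicit Types (p q : 'M[R]_(d.+1, d)) (ms : seq ('I_d.+1 * 'I_d.+1)).

(** The bisected edges need not be longest: this gives a countable family of linear maps, fixed in
    advance, that covers the refinement tree of every simplex. *)
Definition bisects ms p := foldl (fun q e => bisect q e.1 e.2) p ms.

Definition proper_moves ms := all (fun e : 'I_d.+1 * 'I_d.+1 => e.1 != e.2) ms.

Lemma bisects_rcons ms e p : bisects (rcons ms e) p = bisect (bisects ms p) e.1 e.2.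
Proof. by rewrite /bisects foldl_rcons. Qed.

Lemma bisect_surj i j q : i != j -> exists p, bisect p i j = q.
Proof.
move=> ij.
exists (\matrix_k (if k == i then 2 *: row i q - row j q else row k q)).
apply/matrixP => k l; rewrite !mxE; case: (eqVneq k i) => [->|ki].
  by rewrite !mxE eqxx eq_sym (negbTE ij) !mxE; field.
by rewrite !mxE (negbTE ki) !mxE.
Qed.

Lemma bisects_surj ms q : proper_moves ms -> exists p, bisects ms p = q.
Proof.
elim/last_ind: ms q => [|ms e IH] q; first by exists q.
rewrite /proper_moves all_rcons => /andP[ne /IH H].
have [p' <-] := bisect_surj q ne; have [p <-] := H p'.
by exists p; rewrite bisects_rcons.
Qed.

Lemma refinement_tree_bisects p q : refinement_tree p q ->
  exists2 ms, proper_moves ms & q = bisects ms p.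
Proof.
move=> [s [n [[s0 sS] <-]]] {q}; elim: n => [|n [ms pm sn]]; first by exists [::].
have [i [j [[ij _]]]] := sS n.
case=> ->; rewrite sn.
  by exists (rcons ms (i, j)); rewrite ?bisects_rcons // /proper_moves all_rcons /= ij.
exists (rcons ms (j, i)); rewrite ?bisects_rcons // /proper_moves all_rcons /=.
by rewrite eq_sym ij.
Qed.

Definition edges_differ (e e' : 'I_d.+1 * 'I_d.+1) :=
  [&& (e.1 < e.2)%N, (e'.1 < e'.2)%N & e != e'].

Lemma tie_freeP p : (0 < d)%N ->
  (forall ms e e', proper_moves ms -> edges_differ e e' ->
     sqd (bisects ms p) e.1 e.2 != sqd (bisects ms p) e'.1 e'.2) ->
  tie_free p.
Proof.
move=> d0 H q /refinement_tree_bisects[ms pm ->].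
have := exists_sqlongest d0 (semimetric_sqd (bisects ms p)) (sqd_ge0 _).
set q' := bisects ms p => -[e le].
wlog e12 : e le / (e.1 < e.2)%N.
  move=> W; have := le.1; rewrite -val_eqE /= neq_ltn => /orP[|h]; first exact: W.
  apply: (W (e.2, e.1)) => //; split; first by rewrite eq_sym le.1.
  by move=> k l; rewrite [leRHS](semimetric_sqd q').1; apply: le.2.
exists e; split.
  by split=> //; apply/longest_edgeP; case: (e) le.
move=> e' [e'12 /longest_edgeP le']; apply: contrapT => /eqP ne.
have := H ms e e' pm; rewrite /edges_differ e12 e'12 ne => /(_ isT)/negP; apply.
by rewrite -/q' eq_le le'.2 le.2.
Qed.

Definition coords p (ij : 'I_d.+1 * 'I_d) : R := p ij.1 ij.2.
Definition simplex_of (x : 'I_d.+1 * 'I_d -> R) : 'M[R]_(d.+1, d) :=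
  \matrix_(i, j) x (i, j).

Lemma coordsK p : simplex_of (coords p) = p.
Proof. by apply/matrixP => i j; rewrite mxE. Qed.

Lemma polyf_sqd J (A : ('I_d.+1 * 'I_d -> R) -> 'M[R]_(d.+1, d)) k l :
  (forall j, polyf J (fun x => A x k j)) -> (forall j, polyf J (fun x => A x l j)) ->
  polyf J (fun x => sqd (A x) k l).
Proof.
move=> Ak Al; apply: polyf_sum => j.
by apply: (@polyf_exp _ _ _ _ 2); apply: polyf_sub.
Qed.

Lemma polyf_bisects J ms k l :
  (forall k l, polyf J (fun x => simplex_of x k l)) ->
  polyf J (fun x => bisects ms (simplex_of x) k l).
Proof.
move=> H; elim/last_ind: ms k l => [|ms e IH] k l; first exact: H.
under eq_fun do rewrite bisects_rcons mxE.
have [_|_] := eqVneq k e.1; last by under eq_fun do rewrite mxE.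
under eq_fun do rewrite !mxE.
by apply: polyf_mul; [exact: polyf_cst|exact: polyf_add].
Qed.

Lemma polyf_simplex_of k l : polyf finset.setT (fun x => simplex_of x k l).
Proof. by under eq_fun do rewrite mxE; apply: polyf_var; rewrite inE. Qed.

Lemma polyf_det_edge : polyf finset.setT (fun x => \det (edge_mx (simplex_of x))).
Proof.
apply: polyf_det => i j; under eq_fun do rewrite !mxE.
by apply: polyf_sub; apply: polyf_var; rewrite inE.
Qed.

Lemma exists_nondegenerate : exists x, \det (edge_mx (simplex_of x)) != 0.
Proof.
exists (fun ij => (ij.1 == lift ord0 ij.2)%:R).
rewrite (_ : edge_mx _ = 1%:M) ?det1 ?oner_neq0 //.
apply/matrixP => i j; rewrite !mxE /= (inj_eq lift_inj).
by rewrite subr0.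
Qed.

(** Bisections are surjective, so the outcome of [ms] can be prescribed: all vertices at the origin
    except one, which belongs to [e] but not to [e']. *)
Lemma exists_no_tie ms e e' : (0 < d)%N -> proper_moves ms -> edges_differ e e' ->
  exists x, sqd (bisects ms (simplex_of x)) e.1 e.2
    - sqd (bisects ms (simplex_of x)) e'.1 e'.2 != 0.
Proof.
move=> d0 pm /and3P[e12 e12' ne].
pose j0 : 'I_d := Ordinal d0.
pose single (i : 'I_d.+1) : 'M[R]_(d.+1, d) := \matrix_(k, j) ((k == i) && (j == j0))%:R.
have sE i k l : k != l -> sqd (single i) k l = ((k == i) || (l == i))%:R.
  move=> kl; rewrite /sqd (bigD1 j0) //= big1 ?addr0 => [|j /negbTE jj]; last first.
    by rewrite !mxE jj !andbF subrr expr0n.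
  rewrite !mxE !eqxx !andbT; have [ki|ki] := eqVneq k i.
    have -> : (l == i) = false by apply/negbTE; rewrite -ki eq_sym.
    by rewrite subr0 expr1n.
  by case: (l == i); rewrite ?sub0r ?sqrrN ?expr1n ?subrr ?expr0n.
have ne1 : e.1 != e.2 by rewrite -val_eqE /= neq_ltn e12.
have ne1' : e'.1 != e'.2 by rewrite -val_eqE /= neq_ltn e12'.
have [i [i1 i2]] : exists i, (e.1 == i) || (e.2 == i) /\ ~~ ((e'.1 == i) || (e'.2 == i)).
  apply: contrapT => H.
  have K i : (e.1 == i) || (e.2 == i) -> (e'.1 == i) || (e'.2 == i).
    by move=> h; apply/negPn/negP => h'; apply: H; exists i.
  have := K e.1; have := K e.2; rewrite !eqxx orbT => /(_ isT) h2 /(_ isT) h1.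
  case/negP: ne; case: (e) (e') e12 e12' h1 h2 => [a b] [a' b'] /= ab ab'.
  rewrite xpair_eqE => /orP[/eqP ha|/eqP ha] /orP[/eqP hb|/eqP hb]; subst.
  - by rewrite ltnn in ab.
  - by rewrite !eqxx.
  - by rewrite ltnNge (ltnW ab) in ab'.
  - by rewrite ltnn in ab.
have [p pE] := bisects_surj (single i) pm.
exists (coords p); rewrite coordsK pE !sE // i1 (negbTE i2) subr0.
exact: oner_neq0.
Qed.

End GenericSimplices.

(** * The standard normal law *)

Section StandardNormal.
Variable R : realType.
Local Notation N := (normal_prob (0 : R) 1).
Local Notation mu := lebesgue_measure.

Lemma normal_prob1 (x : R) : N [set x] = 0%E.
Proof.
have /null_content_dominatesP := normal_prob_dominates (0 : R) 1.
by move=> H; apply: H => //; exact: lebesgue_measure_set1.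
Qed.

Lemma normal_prob_itv_gt0 (a e : R) : 0 < e -> (0 < N `](a - e)%R, (a + e)%R[)%E.
Proof.
move=> e0; pose c : R := normal_peak 1 * expR (- (`|a| + e) ^+ 2 / (1 ^+ 2 *+ 2)).
have c0 : 0 < c by rewrite mulr_gt0 ?expR_gt0 ?normal_peak_gt0 ?oner_neq0.
apply: (@lt_le_trans _ _ (\int[mu]_(x in `](a - e)%R, (a + e)%R[) c%:E)%E).
  rewrite integral_cst //= lebesgue_measure_itv /= lte_fin ltrBlDr -addrA ltrDl addr_gt0 //.
  by rewrite -EFinB -EFinM lte_fin mulr_gt0 // opprD opprK addrACA subrr add0r addr_gt0.
apply: ge0_le_integral => //=.
- by move=> x _; rewrite lee_fin ltW.
- by apply/measurable_EFinP/measurable_funTS; exact: measurable_normal_pdf.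
move=> x; rewrite in_itv /= => /andP[x1 x2].
rewrite lee_fin normal_pdfE ?oner_neq0 // ler_pM2l ?normal_peak_gt0 ?oner_neq0 //.
rewrite /normal_fun ler_expR subr0 !mulNr lerN2 ler_pM2r; last first.
  by rewrite invr_gt0 expr1n.
rewrite -[leLHS]real_normK ?num_real // ler_pXn2r ?nnegrE ?addr_ge0 ?(ltW e0) //.
have : `|x - a| <= e by rewrite ler_norml; apply/andP; split; lra.
by have := ler_normD (x - a) a; rewrite subrK; lra.
Qed.

(** The Radon-Nikodym derivative is determined almost everywhere and hence agrees with the
    density. *)
Lemma integral_normal (f : R -> \bar R) : measurable_fun setT f ->
  (forall x, 0 <= f x)%E ->
  (\int[N]_x f x = \int[mu]_x (f x * (normal_pdf 0 1 x)%:E))%E.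
Proof.
move=> mf f0; have dom := normal_prob_dominates (0 : R) 1.
rewrite -(Radon_Nikodym_SigmaFinite.change_of_variables dom f0) //.
apply: ae_eq_integral => //.
- apply: emeasurable_funM => //.
  have /integrableP[mRN _] := Radon_Nikodym_SigmaFinite.f_integrable dom.
  exact mRN.
- by apply: emeasurable_funM => //; apply/measurable_EFinP; exact: measurable_normal_pdf.
apply: ae_eqe_mul2l => /=; apply: integral_ae_eq => //=.
- exact: Radon_Nikodym_SigmaFinite.f_integrable.
- by apply/measurable_EFinP; exact: measurable_normal_pdf.
by move=> E _ mE; rewrite -Radon_Nikodym_SigmaFinite.f_integral.
Qed.

Lemma normal_fourth_moment : (\int[N]_x (x ^+ 4)%:E < +oo)%E.
Proof.
rewrite integral_normal; last 2 first.
- by apply/measurable_EFinP; exact: measurable_funX.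
- by move=> x; rewrite lee_fin (exprM x 2 2) sqr_ge0.
(* 256/9 is the constant of the pointwise bound below, by which a Gaussian density of standard
   deviation 2 dominates; the peaks adjust the normalizations. *)
pose C : R := 256 / 9 * normal_peak 1 / normal_peak 2.
have pk1 : 0 < normal_peak 1 :> R by rewrite normal_peak_gt0 ?oner_neq0.
have pk2 : 0 < normal_peak 2 :> R by rewrite normal_peak_gt0.
apply: (@le_lt_trans _ _ (\int[mu]_x (C%:E * (normal_pdf 0 2 x)%:E))%E); last first.
  rewrite ge0_integralZl //=.
  - by rewrite integral_normal_pdf mule1 ltry.
  - by apply/measurable_EFinP; exact: measurable_normal_pdf.
  - by move=> x _; rewrite lee_fin normal_pdf_ge0.
  - by rewrite lee_fin divr_ge0 ?(ltW pk2) // mulr_ge0 ?(ltW pk1) ?divr_ge0.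
apply: ge0_le_integral => //=.
- by move=> x _; rewrite -EFinM lee_fin mulr_ge0 ?normal_pdf_ge0 // (exprM x 2 2) sqr_ge0.
- apply: emeasurable_funM; apply/measurable_EFinP; last exact: measurable_normal_pdf.
  exact: measurable_funX.
- by apply: emeasurable_funM => //; apply/measurable_EFinP; exact: measurable_normal_pdf.
move=> x _; rewrite -!EFinM lee_fin !normal_pdfE ?oner_neq0 //.
(* x^4 exp(-x^2/2) <= (256/9) exp(-x^2/8), as (1 + t/2)^2 <= exp t for t = 3x^2/8 *)
rewrite /normal_fun subr0.
have -> : C * (normal_peak 2 * expR (- x ^+ 2 / (2 ^+ 2 *+ 2))) =
    normal_peak 1 * (256 / 9 * expR (- x ^+ 2 / 8)).
  rewrite /C (_ : 2 ^+ 2 *+ 2 = 8); last by rewrite -mulr_natr; lra.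
  by field; rewrite gt_eqF.
rewrite mulrCA ler_pM2l // expr1n.
pose t : R := 3 / 8 * x ^+ 2.
have t0 : 0 <= t by rewrite mulr_ge0 ?sqr_ge0 // divr_ge0.
have -> : expR (- x ^+ 2 / 8) = expR t * expR (- x ^+ 2 / 2).
  by rewrite -expRD /t; congr expR; field.
rewrite mulrA ler_pM2r ?expR_gt0 //.
have -> : x ^+ 4 = 64 / 9 * t ^+ 2 by rewrite /t; field.
have h1 := expR_ge1Dx (t / 2).
have -> : expR t = expR (t / 2) ^+ 2 by rewrite expr2 -expRD; congr expR; field.
have : (t / 2) ^+ 2 <= expR (t / 2) ^+ 2.
  by rewrite ler_pXn2r ?nnegrE ?expR_ge0 ?divr_ge0 //; lra.
by rewrite expr_div_n; lra.
Qed.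

End StandardNormal.

Section JointIntegrals.
Context d d1 d2 (T : measurableType d) (T1 : measurableType d1)
  (T2 : measurableType d2) (R : realType) (P : probability T R).
Variables (U : {RV P >-> T1}) (V : {RV P >-> T2}).
Hypothesis indUV : forall A B, measurable A -> measurable B ->
  P (U @^-1` A `&` V @^-1` B) = (P (U @^-1` A) * P (V @^-1` B))%E.

Lemma ge0_integral_joint (f : T1 * T2 -> \bar R) : measurable_fun setT f ->
  (forall z, 0 <= f z)%E ->
  (\int[P]_w f (U w, V w) = \int[distribution P U \x distribution P V]_z f z)%E.
Proof.
move=> mf f0.
have mUV : measurable_fun setT (fun w => (U w, V w)) by apply: measurable_fun_pair.
pose UV : {RV P >-> (T1 * T2)%type} :=
  HB.pack (fun w => (U w, V w)) (isMeasurableFun.Build _ _ _ _ _ mUV).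
rewrite -(ge0_integral_distribution UV mf f0).
by apply: eq_measure_integral => A mA _; exact: (joint_law indUV mA).
Qed.

Lemma ge0_integral_indep (f : T1 -> \bar R) (g : T2 -> \bar R) :
  measurable_fun setT f -> measurable_fun setT g ->
  (forall x, 0 <= f x)%E -> (forall x, 0 <= g x)%E ->
  (\int[P]_w (f (U w) * g (V w)) = \int[P]_w f (U w) * \int[P]_w g (V w))%E.
Proof.
move=> mf mg f0 g0.
have mfg : measurable_fun setT (fun z : T1 * T2 => f z.1 * g z.2)%E.
  by apply: emeasurable_funM; [exact: measurableT_comp mf measurable_fst
    |exact: measurableT_comp mg measurable_snd].
have fg0 (z : T1 * T2) : (0 <= f z.1 * g z.2)%E by rewrite mule_ge0.
rewrite (ge0_integral_joint mfg fg0) fubini_tonelli1 //.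
rewrite /fubini_F /=.
under eq_integral do rewrite ge0_integralZl //.
rewrite (ge0_integral_distribution V mg g0).
rewrite ge0_integralZr //; last by apply: integral_ge0 => x _; exact: g0.
congr (_ * _)%E.
exact: (ge0_integral_distribution U mf f0).
Qed.

End JointIntegrals.

(** * Moments of the difference of two independent normal variables *)

Section GaussianPairs.
Variable R : realType.
Local Notation N := (normal_prob (0 : R) 1).
Local Notation NN := (N \x N)%E.

Definition pair_moment (k : nat) : \bar R := (\int[NN]_z ((z.1 - z.2) ^+ k)%:E)%E.

Lemma measurable_sub_exp k : measurable_fun setT (fun z : R * R => ((z.1 - z.2) ^+ k)%:E).
Proof.
apply/measurable_EFinP; apply: measurable_funX.
exact: measurable_funB measurable_fst measurable_snd.
Qed.

Lemma pair_moment4_lty : (pair_moment 4 < +oo)%E.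
Proof.
have mX (p : R * R -> R) : measurable_fun setT p ->
    measurable_fun setT (fun z : R * R => (p z ^+ 4)%:E).
  by move=> mp; apply/measurable_EFinP; apply: measurable_funX.
have X0 (x : R) : (0 <= (x ^+ 4)%:E)%E by rewrite lee_fin (exprM x 2 2) sqr_ge0.
apply: (@le_lt_trans _ _ (\int[NN]_z (8%:E * ((z.1 ^+ 4)%:E + (z.2 ^+ 4)%:E)))%E).
  apply: ge0_le_integral => //=.
  - exact: measurable_sub_exp.
  - by apply: measurable_funeM; apply: emeasurable_funD; apply: mX.
  move=> [x y] _; rewrite -EFinD -EFinM lee_fin /=.
  have h1 : (x - y) ^+ 2 <= 2 * (x ^+ 2 + y ^+ 2).
    by have := sqr_ge0 (x + y); nra.
  have h2 : (x ^+ 2 + y ^+ 2) ^+ 2 <= 2 * (x ^+ 4 + y ^+ 4).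
    by rewrite !(exprM _ 2 2); have := sqr_ge0 (x ^+ 2 - y ^+ 2); move: (x ^+ 2) (y ^+ 2) => a b; nra.
  have h3 : ((x - y) ^+ 2) ^+ 2 <= (2 * (x ^+ 2 + y ^+ 2)) ^+ 2.
    by rewrite ler_pXn2r ?nnegrE ?sqr_ge0 // mulr_ge0 ?addr_ge0 ?sqr_ge0.
  by move: h3; rewrite -exprM exprMn; move: h2; move: (_ ^+ 2) => a; lra.
rewrite ge0_integralZl //; last 2 first.
- by apply: emeasurable_funD; apply: mX.
- by move=> z _; rewrite adde_ge0.
rewrite ge0_integralD //; [|exact: mX|exact: mX].
rewrite fubini_tonelli1 //; last exact: mX.
rewrite [X in (_ + X)%E]fubini_tonelli2 //; last exact: mX.
rewrite /fubini_F /fubini_G /=.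
have C (x : R) : (\int[N]_y (x ^+ 4)%:E = (x ^+ 4)%:E)%E.
  by rewrite integral_cst //= probability_setT mule1.
have lt4 : (\int[N]_x \int[N]_y (x ^+ 4)%:E < +oo)%E.
  rewrite (_ : (\int[N]_x _)%E = (\int[N]_x (x ^+ 4)%:E)%E); first exact: normal_fourth_moment.
  by apply: eq_integral => x _; exact: C.
have ge4 : (0 <= \int[N]_x \int[N]_y (x ^+ 4)%:E)%E.
  by apply: integral_ge0 => x _; apply: integral_ge0.
by apply: lte_mul_pinfty => //; apply: lte_add_pinfty; exact: lt4.
Qed.

Lemma pair_moment2_lty : (pair_moment 2 < +oo)%E.
Proof.
apply: (@le_lt_trans _ _ (\int[NN]_z (1 + ((z.1 - z.2) ^+ 4)%:E))%E).
  apply: ge0_le_integral => //=.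
  - by move=> z _; rewrite lee_fin sqr_ge0.
  - exact: measurable_sub_exp.
  - by apply: emeasurable_funD => //; exact: measurable_sub_exp.
  move=> z _; rewrite -EFinD lee_fin (exprM _ 2 2).
  by have := sqr_ge0 ((z.1 - z.2) ^+ 2 - 1); move: ((z.1 - z.2) ^+ 2) => t; nra.
rewrite ge0_integralD //; last 2 first.
- by move=> z _; rewrite lee_fin (exprM _ 2 2) sqr_ge0.
- exact: measurable_sub_exp.
rewrite integral_cst //= mul1e lte_add_pinfty ?pair_moment4_lty //.
by rewrite -setXTT product_measure1E //= !probability_setT mule1 ltry.
Qed.

(** On the rectangle [A] times [B], of positive measure, the difference exceeds 1 in absolute
    value. *)
Lemma pair_moment2_gt0 : (0 < pair_moment 2)%E.
Proof.
pose A : set R := `](0 - 2^-1)%R, (0 + 2^-1)%R[%classic.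
pose B : set R := `](2 - 2^-1)%R, (2 + 2^-1)%R[%classic.
have h0 : 0 < 2^-1 :> R by rewrite invr_gt0.
apply: (@lt_le_trans _ _ (NN (A `*` B))).
  have NA := @normal_prob_itv_gt0 R 0 _ h0; have NB := @normal_prob_itv_gt0 R 2 _ h0.
  have := mule_gt0 NA NB; rewrite -[X in (0 < X)%E -> _]product_measure1E //.
have mAB : measurable (A `*` B) by apply: measurableX; exact: measurable_itv.
rewrite -[X in NN X]setIT -integral_indic //.
apply: ge0_le_integral => //=.
- by apply/measurable_EFinP; exact: measurable_indic.
- exact: measurable_sub_exp.
move=> [x y] _; rewrite lee_fin indicE.
case: (boolP (_ \in _)) => [|_]; last by rewrite sqr_ge0.
rewrite inE /A /B /= !in_itv /= => -[/andP[? ?] /andP[? ?]].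
by nra.
Qed.

End GaussianPairs.

(** * Chebyshev's inequality for Gaussian squared distances *)

Section Concentration.
Context d (T : measurableType d) (R : realType) (P : probability T R).
Variables (I : finType) (Z : I -> T -> R).
Hypothesis mZ : forall i, measurable_fun setT (Z i).
Hypothesis indZ : mutually_independent P Z.
Hypothesis lawZ : forall i (B : set R), measurable B ->
  P (Z i @^-1` B) = normal_prob 0 1 B.
Local Notation N := (normal_prob (0 : R) 1).

Let mZ' i : @measurable_fun _ _ T (measurableTypeR R) setT (Z i) := mZ i.
Let Zrv i : {RV P >-> measurableTypeR R} :=
  HB.pack (Z i : T -> measurableTypeR R) (isMeasurableFun.Build _ _ _ _ _ (mZ' i)).

Lemma integral_gaussian_pair i j k : i != j -> ~~ odd k ->
  (\int[P]_w ((Z i w - Z j w) ^+ k)%:E = pair_moment R k)%E.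
Proof.
move=> ij k2.
have ind A B : measurable A -> measurable B ->
    P (Zrv i @^-1` A `&` Zrv j @^-1` B) = (P (Zrv i @^-1` A) * P (Zrv j @^-1` B))%E.
  move=> mA mB; apply: (sig_indep mZ indZ (J := [set i]%SET) (K := [set j]%SET)).
  - by rewrite disjoints1 inE.
  - by apply: sig_coord => //; rewrite inE.
  - by apply: sig_coord => //; rewrite inE.
rewrite (ge0_integral_joint ind (f := fun z => ((z.1 - z.2) ^+ k)%:E)).
- rewrite /pair_moment. apply: eq_measure_integral => A mA _; symmetry.
  apply: product_measure_unique => // B C mB mC.
  transitivity (distribution P (Zrv i) B * distribution P (Zrv j) C)%E.
    exact: product_measure1E.
  by congr (_ * _)%E; apply: lawZ.
- exact: measurable_sub_exp.
- by move=> z; rewrite lee_fin exprn_even_ge0.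
Qed.

Variables (n : nat) (u v : 'I_n -> I).
Hypothesis uv : forall j, u j != v j.
Hypothesis disj : forall j k, j != k ->
  fintype.disjoint (mem [set u j; v j]%SET) (mem [set u k; v k]%SET).

Let Y j w := (Z (u j) w - Z (v j) w) ^+ 2.
Let S w := \sum_j Y j w.

Let mY j : measurable_fun setT (Y j).
Proof. by apply: measurable_funX; apply: measurable_funB. Qed.

Let Y0 j w : 0 <= Y j w. Proof. exact: sqr_ge0. Qed.
Let S0 w : 0 <= S w. Proof. exact: sumr_ge0. Qed.
Let mS : measurable_fun setT S.
Proof. exact: measurable_sum. Qed.

Let EYY j k : j != k ->
  (\int[P]_w (Y j w * Y k w)%:E = pair_moment R 2 * pair_moment R 2)%E.
Proof.
move=> jk.
have mU i : measurable_fun setT (fun w => (Z (u i) w, Z (v i) w)).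
  by apply: measurable_fun_pair.
pose U i : {RV P >-> (R * R)%type} :=
  HB.pack (fun w => (Z (u i) w, Z (v i) w)) (isMeasurableFun.Build _ _ _ _ _ (mU i)).
have sU i A : measurable A -> sig Z [set u i; v i]%SET (U i @^-1` A).
  move=> mA.
  pose TJ := g_sigma_algebraType (rects Z [set u i; v i]%SET).
  have sZ l : l \in [set u i; v i]%SET -> measurable_fun (setT : set TJ) (Z l).
    by move=> lJ _ B mB; rewrite setTI; apply: sig_coord.
  have := measurable_fun_pair (sZ (u i) _) (sZ (v i) _) measurableT mA.
  by rewrite setTI; apply; rewrite !inE eqxx ?orbT.
have ind A B : measurable A -> measurable B ->
    P (U j @^-1` A `&` U k @^-1` B) = (P (U j @^-1` A) * P (U k @^-1` B))%E.
  by move=> mA mB; apply: (sig_indep mZ indZ (disj jk)); apply: sU.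
have := ge0_integral_indep ind (@measurable_sub_exp R 2) (@measurable_sub_exp R 2).
rewrite /= => H; rewrite -{1}(integral_gaussian_pair (uv j)) // -(integral_gaussian_pair (uv k)) //.
by rewrite -H // => x; rewrite lee_fin sqr_ge0.
Qed.

Let s2 : R := fine (pair_moment R 2).
Let s4 : R := fine (pair_moment R 4).
Let E2 : pair_moment R 2 = s2%:E.
Proof.
by rewrite fineK // ge0_fin_numE ?pair_moment2_lty // ltW // pair_moment2_gt0.
Qed.
Let E4 : pair_moment R 4 = s4%:E.
Proof.
rewrite fineK // ge0_fin_numE ?pair_moment4_lty // integral_ge0 // => z _.
by rewrite lee_fin exprn_even_ge0.
Qed.
Let s2_gt0 : 0 < s2. Proof. by rewrite -lte_fin -E2 pair_moment2_gt0. Qed.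

Lemma gaussian_variance :
  (\int[P]_w ((S w - n%:R * s2) ^+ 2)%:E <= (n%:R * s4)%:E)%E.
Proof.
have ES : (\int[P]_w (S w)%:E = (n%:R * s2)%:E)%E.
  under eq_integral do rewrite -sumEFin.
  rewrite ge0_integral_sum //; last 2 first.
  - by move=> j; apply/measurable_EFinP.
  - by move=> j w _; rewrite lee_fin.
  under eq_bigr do rewrite integral_gaussian_pair // E2.
  by rewrite sumEFin sumr_const card_ord mulr_natl.
have ESS : (\int[P]_w (S w ^+ 2)%:E <= (n%:R * s4 + (n%:R * s2) ^+ 2)%:E)%E.
  have mYY j k : measurable_fun setT (fun w => (Y j w * Y k w)%:E).
    by apply/measurable_EFinP; apply: measurable_funM.
  have YY0 j k w : (0 <= (Y j w * Y k w)%:E)%E by rewrite lee_fin mulr_ge0.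
  have -> : (\int[P]_w (S w ^+ 2)%:E =
      \sum_(j < n) \sum_(k < n) \int[P]_w (Y j w * Y k w)%:E)%E.
    under eq_integral do rewrite expr2 mulr_suml -sumEFin.
    rewrite ge0_integral_sum //; last 2 first.
    - by move=> j; apply/measurable_EFinP; apply: measurable_funM.
    - by move=> j w _; rewrite lee_fin mulr_ge0.
    apply: eq_bigr => j _.
    under eq_integral do rewrite mulr_sumr -sumEFin.
    by rewrite ge0_integral_sum.
  (* The diagonal term is [s4]; the others, at most n, equal [s2 ^+ 2] by independence. *)
  have le_j j : (\sum_(k < n) \int[P]_w (Y j w * Y k w)%:E <= (s4 + n%:R * s2 ^+ 2)%:E)%E.
    rewrite (bigD1 j) //= EFinD; apply: leeD.
      rewrite -E4 -(integral_gaussian_pair (uv j)) // le_eqVlt; apply/orP; left; apply/eqP.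
      by apply: eq_integral => w _; rewrite -expr2 -exprM.
    under eq_bigr => k kj do rewrite EYY 1?eq_sym // E2 -EFinM.
    rewrite sumEFin lee_fin sumr_const -expr2 -[leLHS]mulr_natl ler_wpM2r ?sqr_ge0 // ler_nat.
    by rewrite -[leqRHS](card_ord n) max_card.
  apply: le_trans (lee_sum _ (fun j _ => le_j j)) _.
  rewrite sumEFin lee_fin sumr_const card_ord -mulr_natl.
  by rewrite exprMn expr2; lra.
have mX (f : T -> R) : measurable_fun setT f -> measurable_fun setT (fun w => (f w ^+ 2)%:E).
  by move=> mf; apply/measurable_EFinP; apply: measurable_funX.
have c0 : 0 <= 2 * (n%:R * s2) by rewrite !mulr_ge0 // ltW.
(* Integrals of nonnegative functions do not allow subtraction, so the cross term is moved: (S -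
   a)^2 + 2 a S = S^2 + a^2 with a the mean of S. *)
have key : (\int[P]_w ((S w - n%:R * s2) ^+ 2)%:E + (2 * (n%:R * s2))%:E * (n%:R * s2)%:E =
    \int[P]_w (S w ^+ 2)%:E + ((n%:R * s2) ^+ 2)%:E)%E.
  have -> : (((n%:R * s2) ^+ 2)%:E = \int[P]_w (cst ((n%:R * s2) ^+ 2)%:E w))%E.
    by rewrite integral_cst //= probability_setT mule1.
  have add (f g : T -> R) : measurable_fun setT f -> measurable_fun setT g ->
      (forall w, 0 <= f w) -> (forall w, 0 <= g w) ->
      (\int[P]_w (f w)%:E + \int[P]_w (g w)%:E = \int[P]_w (f w + g w)%:E)%E.
    move=> mf mg f0 g0; under [RHS]eq_integral do rewrite EFinD.
    by rewrite ge0_integralD //; (try by move=> w _; rewrite lee_fin); apply/measurable_EFinP.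
  have mSn : measurable_fun setT (fun w => (S w - n%:R * s2) ^+ 2).
    by apply: measurable_funX; apply: measurable_funB.
  rewrite -ES -ge0_integralZl_EFin //; last 2 first.
  - by move=> w _; rewrite lee_fin.
  - exact/measurable_EFinP.
  under [X in (_ + X)%E]eq_integral do rewrite -EFinM.
  have mS2 : measurable_fun setT (fun w => S w ^+ 2) by apply: measurable_funX.
  have mcS : measurable_fun setT (fun w => 2 * (n%:R * s2) * S w) by apply: measurable_funM.
  have cS0 w : 0 <= 2 * (n%:R * s2) * S w by apply: mulr_ge0.
  have sq0 (f : T -> R) w : 0 <= f w ^+ 2 by apply: sqr_ge0.
  rewrite (add _ _ mSn mcS (sq0 _) cS0) (add _ (cst ((n%:R * s2) ^+ 2)) mS2 (measurable_cst _) (sq0 S)); last first.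
    by move=> w; apply: sqr_ge0.
  by apply: eq_integral => w _; rewrite /=; congr (_%:E); ring.
have : (\int[P]_w ((S w - n%:R * s2) ^+ 2)%:E + (2 * (n%:R * s2) ^+ 2)%:E <=
    (n%:R * s4 + 2 * (n%:R * s2) ^+ 2)%:E)%E.
  rewrite (_ : 2 * _ ^+ 2 = 2 * (n%:R * s2) * (n%:R * s2)); last by ring.
  rewrite EFinM key (_ : (n%:R * s4 + _) = (n%:R * s4 + (n%:R * s2) ^+ 2) + (n%:R * s2) ^+ 2); last by ring.
  by rewrite EFinD leeD2r.
by rewrite EFinD leeD2rE.
Qed.

Lemma gaussian_chebyshev (e : R) : 0 < e -> (0 < n)%N ->
  (P [set w | (e * (n%:R * s2) <= `|S w - n%:R * s2|)%R]
    <= (s4 / ((e * s2) ^+ 2 * n%:R))%:E)%E.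
Proof.
move=> e0 n0; set A := [set w | _].
have n0' : 0 < n%:R :> R by rewrite ltr0n.
have mA : measurable A.
  rewrite (_ : A = (fun w => `|S w - n%:R * s2|) @^-1` `[e * (n%:R * s2), +oo[); last first.
    by apply/seteqP; split=> w /=; rewrite in_itv /= andbT.
  rewrite -[X in measurable X]setTI.
  apply: (_ : measurable_fun setT (fun w => `|S w - n%:R * s2|)) => //.
  by apply: measurableT_comp => //; apply: measurable_funB.
have c0 : 0 < (e * (n%:R * s2)) ^+ 2 by rewrite exprn_gt0 // !mulr_gt0.
have : (((e * (n%:R * s2)) ^+ 2)%:E * P A <= (n%:R * s4)%:E)%E.
  apply: le_trans gaussian_variance.
  rewrite -[A in P A]setIT -integral_indic // -ge0_integralZl_EFin ?(ltW c0) //; last first.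
    by apply/measurable_EFinP; exact: measurable_indic.
  apply: ge0_le_integral => //.
  - by move=> w _; rewrite -EFinM lee_fin mulr_ge0 ?(ltW c0).
  - by apply: measurable_funeM; apply/measurable_EFinP; exact: measurable_indic.
  - by apply/measurable_EFinP; apply: measurable_funX; apply: measurable_funB.
  move=> w _; rewrite -EFinM lee_fin indicE.
  case: (boolP (w \in A)) => [|_]; last by rewrite mulr0 sqr_ge0.
  rewrite inE /A /= mulr1 -(real_normK (num_real (S w - _))) => h.
  by rewrite ler_pXn2r ?nnegrE // ltW // !mulr_gt0.
rewrite -lee_pdivlMl // -EFinM; congr (_ <= _%:E)%E.
by field; rewrite !gt_eqF.
Qed.

End Concentration.

(** * Nearly regular faces and their probability *)

Section NearRegularFaces.
Variables (R : realType) (d : nat).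
Implicit Types (p : 'M[R]_(d.+1, d)) (f : 'I_5 -> 'I_d.+1).

Definition near_regular (e c : R) p f :=
  forall k l, k != l -> `|sqd p (f k) (f l) - c| < e * c.

End NearRegularFaces.

(** The tolerance [e] comes from a statement about five points and so does not depend on [d]; the
    size [c] is removed by scaling. *)
Lemma near_regular_degenerates (R : realType) : exists2 e : R, 0 < e &
  forall d (p : 'M[R]_(d.+1, d)) (f : 'I_5 -> 'I_d.+1) c, injective f -> 0 < c ->
    Defs.nondegenerate p -> near_regular e c p f -> has_degenerating_branch p.
Proof.
have [e e0 He] := robust_regular R; exists e => // d p f c fI c0 np nr.
have : sqdegen (fun k l => sqd p (f k) (f l)).
  have -> : (fun k l => sqd p (f k) (f l)) = fun k l => c * (c^-1 * sqd p (f k) (f l)).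
    by apply/funext => k; apply/funext => l; rewrite mulVKf ?gt_eqF.
  apply: sqdegenZ => //; apply: He; first by split=> *; [rewrite (semimetric_sqd p).1|rewrite (semimetric_sqd p).2 mulr0].
  move=> k l; have [->|kl] := eqVneq k l.
    rewrite (semimetric_sqd p).2 mulr0 (_ : zsym _ _ _ = 0) ?zr0 ?subrr ?normr0 ?(ltW e0) //.
    by case: l => -[|[|[|[|[|]]]]].
  have -> : zsym (zlist (nseq 10 1%N)) k l = 1.
    by move: k l kl; elim/ord5P; elim/ord5P.
  rewrite zr1 -(ler_pM2l c0) -{1}(ger0_norm (ltW c0)) -normrM mulrBr mulVKf ?gt_eqF //.
  by rewrite mulr1 mulrC ltW // nr.
move=> [m [lm dm]]; exact: (face_degenerates fI lm dm).
Qed.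

Section RegularSimplex.
Variable R : realType.

(* Four multiples of basis vectors and a multiple of (1, 1, 1, 1). *)
Definition regular_coord (c : R) (k j : nat) : R :=
  let a := Num.sqrt (c / 2) in
  if (j < 4)%N then
    if k == 4 then a * ((1 + Num.sqrt 5) / 4) else if j == k then a else 0
  else 0.

(** For a (t, t, t, t) to lie at the same distance from the four points a e_j as they do from each
    other, 4 t^2 - 2 t + 1 = 2 is required; (1 + sqrt 5) / 4 is its positive root. *)
Lemma regular_coord_dist c n (k l : 'I_5) : 0 <= c -> (4 <= n)%N -> k != l ->
  \sum_(j < n) (regular_coord c k j - regular_coord c l j) ^+ 2 = c.
Proof.
move=> c0 n4 kl.
transitivity (\sum_(j < 4) (regular_coord c k j - regular_coord c l j) ^+ 2).
  rewrite (big_ord_widen n (fun j => (regular_coord c k j - regular_coord c l j) ^+ 2) n4).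
  rewrite [LHS](bigID (fun j : 'I_n => (j < 4)%N)) /= [X in _ + X]big1 ?addr0 // => j /negbTE j4.
  by rewrite /regular_coord j4 subrr expr0n.
rewrite !big_ord_recr big_ord0 /= add0r.
have a2 : Num.sqrt (c / 2) ^+ 2 = c / 2 by rewrite sqr_sqrtr // divr_ge0.
have s5 : Num.sqrt 5 ^+ 2 = 5 :> R by rewrite sqr_sqrtr.
rewrite /regular_coord; move: a2 s5; set a := Num.sqrt (c / 2); set s := Num.sqrt 5.
move: kl; clearbody a s; move: k l; elim/ord5P; elim/ord5P => //= _ a2 s5.
all: rewrite ?subr0 ?sub0r ?subrr ?sqrrN ?expr0n /= ?add0r ?addr0.
all: try by rewrite a2; field.
all: nra.
Qed.

End RegularSimplex.

Lemma union_bound disp (T : measurableType disp) (R : realType)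
    (P : probability T R) (K : eqType) (s : seq K) (B : K -> set T) (q : R) :
  (forall k, measurable (B k)) -> (forall k, k \in s -> (P (B k) <= q%:E)%E) ->
  (P (\bigcup_(k in [set` s]) B k) <= ((size s)%:R * q)%:E)%E.
Proof.
move=> mB; elim: s => [|k s IH] Bq.
  rewrite (_ : \bigcup_(_ in _) _ = set0) ?measure0 ?mul0r //.
  by apply/seteqP; split=> // w [].
have -> : \bigcup_(j in [set` k :: s]) B j = B k `|` \bigcup_(j in [set` s]) B j.
  apply/seteqP; split=> w.
    by move=> [j /= ]; rewrite inE => /predU1P[->|js] Bw; [left|right; exists j].
  move=> [Bw|[j /= js Bw]]; first by exists k => //=; rewrite mem_head.
  by exists j => //=; rewrite inE js orbT.
have mU : measurable (\bigcup_(j in [set` s]) B j).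
  by apply: fin_bigcup_measurable => //; exact: finite_seq.
apply: le_trans (measureU2 P (mB k) mU) _.
rewrite /= -add1n natrD mulrDl mul1r EFinD; apply: leeD.
  by apply: Bq; rewrite mem_head.
by apply: IH => j js; apply: Bq; rewrite inE js orbT.
Qed.

Section NearRegularEvents.
Context disp (T : measurableType disp) (R : realType) (P : probability T R) (d : nat).
Variable Z : 'I_d.+1 * 'I_d -> T -> R.
Hypothesis mZ : forall i, measurable_fun setT (Z i).
Hypothesis indZ : mutually_independent P Z.
Hypothesis lawZ : forall i (B : set R), measurable B ->
  P (Z i @^-1` B) = normal_prob 0 1 B.
Implicit Types f : 'I_5 -> 'I_d.+1.

Definition face_coords f : {set 'I_d.+1 * 'I_d} := [set ij | ij.1 \in codom f]%SET.

Definition near_event (e c : R) f : set T :=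
  [set w | near_regular e c (simplex_of (Z^~ w)) f].

Lemma sig_near_event e c f : sig Z (face_coords f) (near_event e c f).
Proof.
pose TJ := g_sigma_algebraType (rects Z (face_coords f)).
pose E (kl : 'I_5 * 'I_5) : set T := [set w | kl.1 != kl.2 ->
  `|sqd (simplex_of (Z^~ w)) (f kl.1) (f kl.2) - c| < e * c].
have -> : near_event e c f = \bigcap_(kl in [set: 'I_5 * 'I_5]) E kl.
  by apply/seteqP; split=> w H; [move=> kl _; apply: H|move=> k l; apply: (H (k, l))].
apply: (@fin_bigcap_measurable _ TJ); first exact: finite_finset.
move=> [k l] _; rewrite /E /=; have [_|kl] := eqVneq k l.
  by rewrite (_ : [set w | _] = setT) //; apply/seteqP; split.
have pf : polyf (face_coords f) (fun x : _ -> R => sqd (simplex_of x) (f k) (f l)).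
  by apply: polyf_sqd => j; under eq_fun do rewrite mxE; apply: polyf_var; rewrite inE /= codom_f.
pose g : TJ -> R := fun w => sqd (simplex_of (Z^~ w)) (f k) (f l).
have mg : measurable_fun setT g := polyf_sig pf.
have mh : measurable_fun (setT : set TJ) (fun w => `|g w - c|).
  by apply: measurableT_comp => //; apply: measurable_funB.
have := mh measurableT _ (measurable_itv `]-oo, (e * c)%R[); rewrite setTI.
congr measurable; apply/seteqP; split=> w /=; rewrite in_itv /=.
  by move=> h _; exact: h.
by move/(_ isT).
Qed.

Lemma measurable_near_event e c f : measurable (near_event e c f).
Proof. exact: (sig_measurable mZ (@sig_near_event e c f)). Qed.

(** Each of the 25 ordered pairs of vertices fails with probability at most 1/50 by Chebyshev, which
    leaves 1/2; hence the 50 in the hypothesis. *)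
Lemma near_event_large e f : 0 < e -> injective f -> (4 <= d)%N ->
  let s2 := fine (pair_moment R 2) in let s4 := fine (pair_moment R 4) in
  50 * s4 <= (e * s2) ^+ 2 * d%:R ->
  ((2^-1)%:E <= P (near_event e (d%:R * s2) f))%E.
Proof.
move=> e0 fI d4 s2 s4 big; set c := d%:R * s2.
have d0 : (0 < d)%N by apply: leq_trans d4.
have s20 : 0 < s2.
  by rewrite -lte_fin fineK ?pair_moment2_gt0 // ge0_fin_numE ?pair_moment2_lty // ltW // pair_moment2_gt0.
pose B (kl : 'I_5 * 'I_5) : set T := [set w | kl.1 != kl.2 /\
  e * c <= `|sqd (simplex_of (Z^~ w)) (f kl.1) (f kl.2) - c|].
have PB kl : (P (B kl) <= (50^-1)%:E)%E.
  case: kl => k l; have [->|kl] := eqVneq k l.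
    rewrite (_ : B _ = set0) ?measure0 ?lee_fin ?invr_ge0 //.
    by apply/seteqP; split=> // w [/= /eqP].
  have := @gaussian_chebyshev _ T R P _ Z mZ indZ lawZ d (fun j => (f k, j)) (fun j => (f l, j)) _ _ e e0 d0.
  rewrite -/s2 -/s4 -/c => H.
  apply: le_trans (le_trans (H _ _) _).
  - rewrite le_eqVlt; apply/orP; left; apply/eqP; congr (P _).
    have sE w : sqd (simplex_of (Z^~ w)) (f k) (f l) =
        \sum_(j < d) (Z (f k, j) w - Z (f l, j) w) ^+ 2.
      by apply: eq_bigr => j _; rewrite !mxE.
    by apply/seteqP; split=> w; rewrite /B /= sE // => -[].
  - by move=> j; rewrite xpair_eqE (inj_eq fI) (negbTE kl).
  - move=> j j' jj; rewrite disjoint_subset; apply/fintype.subsetP => -[a b].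
    by rewrite !inE !xpair_eqE => /orP[/andP[_ /eqP ->]|/andP[_ /eqP ->]]; rewrite (negbTE jj) !andbF.
  - rewrite lee_fin ler_pdivrMr ?mulr_gt0 ?exprn_gt0 ?mulr_gt0 ?ltr0n //.
    by move: big; lra.
have mB kl : measurable (B kl).
  have pf : polyf finset.setT (fun x : _ -> R => sqd (simplex_of x) (f kl.1) (f kl.2)).
    by apply: polyf_sqd => j; apply: polyf_simplex_of.
  have mg := polyf_measurable mZ pf.
  have mh : measurable_fun setT (fun w => `|sqd (simplex_of (Z^~ w)) (f kl.1) (f kl.2) - c|).
    by apply: measurableT_comp => //; apply: measurable_funB.
  have [kE|kl'] := eqVneq kl.1 kl.2.
    rewrite (_ : B kl = set0) //; apply/seteqP; split=> // w [].
    by rewrite kE eqxx.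
  have := mh measurableT _ (measurable_itv `[(e * c)%R, +oo[); rewrite setTI.
  congr measurable; apply/seteqP; split=> w /=; rewrite in_itv /= andbT //.
  by move=> [].
have cover : ~` near_event e c f `<=` \bigcup_(kl in [set` enum [set: 'I_5 * 'I_5]%SET]) B kl.
  move=> w /= nw; apply: contrapT => H; apply: nw => k l kl.
  rewrite ltNge; apply/negP => h; apply: H.
  by exists (k, l) => //=; rewrite mem_enum inE.
have PC : (P (~` near_event e c f) <= (2^-1)%:E)%E.
  apply: (@le_trans _ _ (P (\bigcup_(kl in [set` enum [set: 'I_5 * 'I_5]%SET]) B kl))).
    apply: le_measure => //; rewrite inE; first exact/measurableC/measurable_near_event.
    by apply: fin_bigcup_measurable => //; exact: finite_seq.
  apply: le_trans (union_bound mB (fun kl _ => PB kl)) _.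
  rewrite -cardE cardsT card_prod card_ord lee_fin.
  by rewrite (_ : (5 * 5)%:R = 25) //; lra.
move: PC; rewrite (probability_setC P (measurable_near_event e c f)).
have : (P (near_event e c f)) \is a fin_num by apply: fin_num_measure; exact: measurable_near_event.
case: (P _) => // r _; rewrite -EFinB !lee_fin; lra.
Qed.

End NearRegularEvents.

Lemma near_event_small (R : realType) (e c : R) d : 0 < e -> 0 < c -> (4 <= d)%N ->
  exists2 q : R, 0 < q &
  forall disp (T : measurableType disp) (P : probability T R)
    (Z : 'I_d.+1 * 'I_d -> T -> R) (f : 'I_5 -> 'I_d.+1),
  (forall i, measurable_fun setT (Z i)) -> mutually_independent P Z ->
  (forall i (B : set R), measurable B -> P (Z i @^-1` B) = normal_prob 0 1 B) ->
  injective f -> (q%:E <= P (near_event Z e c f))%E.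
Proof.
move=> e0 c0 d4.
have d0 : 0 < d%:R :> R by rewrite ltr0n (leq_trans _ d4).
pose x := regular_coord c.
pose M : R := 1 + \sum_(k < 5) \sum_(j < d) `|x k j|.
have xM (k : 'I_5) (j : 'I_d) : `|x k j| <= M.
  apply: le_trans (_ : \sum_(k < 5) \sum_(j < d) `|x k j| <= M); last by rewrite lerDr.
  rewrite (bigD1 k) //= (bigD1 j) //= -addrA lerDl addr_ge0 //.
    by apply: sumr_ge0.
  by apply: sumr_ge0 => ? _; apply: sumr_ge0.
have M1 : 1 <= M by rewrite lerDl; apply: sumr_ge0 => ? _; apply: sumr_ge0.
(* Moving every coordinate by at most [r] changes a squared difference by at most 2 r * 6 M = 12 M
   r; the 16 leaves room for a strict inequality. *)
pose r := Num.min 1 (e * c / (d%:R * (16 * M))).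
have r0 : 0 < r by rewrite lt_min ltr01 divr_gt0 ?mulr_gt0 //; lra.
have r1 : r <= 1 by rewrite ge_min lexx.
have rE : d%:R * (16 * M) * r <= e * c.
  rewrite mulrC -ler_pdivlMr ?ge_min ?lexx ?orbT // mulr_gt0 //; lra.
pose itv (k : 'I_5) (j : 'I_d) : set R := `](x k j - r), (x k j + r)[%classic.
pose q : \bar R := (\prod_(kj : 'I_5 * 'I_d) normal_prob 0 1 (itv kj.1 kj.2))%E.
have q0 : (0 < q)%E.
  rewrite /q; elim/big_ind: _ => // [a b|kj _]; first exact: mule_gt0.
  exact: normal_prob_itv_gt0.
have qfin : q \is a fin_num.
  rewrite /q; elim/big_ind: _ => // [a b|kj _]; first exact: fin_numM.
  by apply: fin_num_measure; exact: measurable_itv.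
exists (fine q); first by rewrite fine_gt0 // q0 ltey_eq qfin.
move=> disp T P Z f mZ indZ lawZ fI.
pose B (ij : 'I_d.+1 * 'I_d) : set R :=
  if [pick k | f k == ij.1] is Some k then itv k ij.2 else setT.
have BE k j : B (f k, j) = itv k j.
  rewrite /B; case: pickP => /= [k' /eqP /fI -> //|/(_ k)].
  by rewrite eqxx.
have mB ij : measurable (B ij).
  by rewrite /B; case: pickP => // k _; exact: measurable_itv.
have PE : P (\bigcap_(ij in [set` face_coords f]) Z ij @^-1` B ij) = q.
  rewrite indZ // (_ : face_coords f = [set (f kj.1, kj.2) | kj : 'I_5 * 'I_d]%SET).
    rewrite finset.big_imset /=; last first.
      by move=> [k j] [k' j'] _ _ /= [/fI -> ->].
    by apply: eq_big => [kj|kj _]; rewrite ?inE // BE lawZ //; exact: measurable_itv.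
  apply/setP => -[i j]; rewrite inE /=; apply/idP/imsetP => [/codomP[k ->]|[[k j'] _ [-> _]]].
    by exists (k, j); rewrite ?inE.
  exact: codom_f.
rewrite fineK // -PE; apply: le_measure.
- rewrite inE; apply: fin_bigcap_measurable; first exact: finite_finset.
  by move=> ij _; rewrite -[X in measurable X]setTI; apply: mZ.
- by rewrite inE; exact: measurable_near_event.
move=> w Bw k l kl.
have near k' j : `|Z (f k', j) w - x k' j| <= r.
  have := Bw (f k', j); rewrite /= inE /= codom_f BE /itv /= in_itv /= => /(_ isT)/andP[? ?].
  by rewrite ler_norml; apply/andP; split; lra.
rewrite -{1}(@regular_coord_dist R c d k l (ltW c0) d4 kl) /sqd -sumrB.
apply: le_lt_trans (ler_norm_sum _ _ _) _.
apply: (@le_lt_trans _ _ (\sum_(j < d) (12 * M * r))).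
  apply: ler_sum => j _; rewrite !mxE -/(x k j) -/(x l j).
  have := near k j; have := near l j; have := xM k j; have := xM l j.
  move: (Z _ w) (Z _ w) (x k j) (x l j) => a b y z.
  move=> hz hy hb ha.
  have -> : (a - b) ^+ 2 - (y - z) ^+ 2 = ((a - y) - (b - z)) * ((a - y) - (b - z) + 2 * (y - z)).
    by ring.
  rewrite normrM.
  have h1 : `|(a - y) - (b - z)| <= 2 * r.
    by apply: le_trans (ler_normB _ _) _; lra.
  have h2 : `|(a - y) - (b - z) + 2 * (y - z)| <= 6 * M.
    apply: le_trans (ler_normD _ _) _; rewrite normrM ger0_norm //.
    have := ler_normB y z; lra.
  apply: le_trans (ler_pM _ _ h1 h2) _ => //; lra.
rewrite sumr_const card_ord -[ltLHS]mulr_natl.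
apply: lt_le_trans rE; rewrite -[ltRHS]mulrA ltr_pM2l // ltr_pM2r //; lra.
Qed.

(** The order of quantifiers matters: [q] is chosen before the dimension, whereas the size [c] is
    proportional to [d]. *)
Lemma near_event_uniform (R : realType) (e : R) : 0 < e ->
  exists2 q : R, 0 < q &
  forall d, (4 <= d)%N -> exists2 c : R, 0 < c &
  forall disp (T : measurableType disp) (P : probability T R)
    (Z : 'I_d.+1 * 'I_d -> T -> R) (f : 'I_5 -> 'I_d.+1),
  (forall i, measurable_fun setT (Z i)) -> mutually_independent P Z ->
  (forall i (B : set R), measurable B -> P (Z i @^-1` B) = normal_prob 0 1 B) ->
  injective f -> (q%:E <= P (near_event Z e c f))%E.
Proof.
move=> e0; pose s2 := fine (pair_moment R 2); pose s4 := fine (pair_moment R 4).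
have s20 : 0 < s2.
  by rewrite -lte_fin fineK ?pair_moment2_gt0 // ge0_fin_numE ?pair_moment2_lty // ltW // pair_moment2_gt0.
have s40 : 0 <= s4.
  by apply: fine_ge0; apply: integral_ge0 => z _; rewrite lee_fin exprn_even_ge0.
(* From [D] on [near_event_large] applies; [small] takes a minimum over the finitely many dimensions
   below. *)
pose D := Num.bound (50 * s4 / (e * s2) ^+ 2).
have es0 : 0 < (e * s2) ^+ 2 by rewrite exprn_gt0 // mulr_gt0.
have small n : exists2 q : R, 0 < q & forall d, (4 <= d < n)%N ->
    forall disp (T : measurableType disp) (P : probability T R)
      (Z : 'I_d.+1 * 'I_d -> T -> R) (f : 'I_5 -> 'I_d.+1),
    (forall i, measurable_fun setT (Z i)) -> mutually_independent P Z ->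
    (forall i (B : set R), measurable B -> P (Z i @^-1` B) = normal_prob 0 1 B) ->
    injective f -> (q%:E <= P (near_event Z e (d%:R * s2) f))%E.
  elim: n => [|n [q q0 Hq]]; first by exists 1 => // d; rewrite ltn0 andbF.
  have [n4|n4] := leqP 4 n; last first.
    exists q => // d /andP[d4]; rewrite ltnS => dn.
    by have := leq_trans d4 dn; rewrite leqNgt n4.
  have c0 : 0 < n%:R * s2 by rewrite mulr_gt0 // ltr0n (leq_trans _ n4).
  have [q' q'0 Hq'] := near_event_small e0 c0 n4.
  exists (Num.min q q'); first by rewrite lt_min q0 q'0.
  move=> d /andP[d4]; rewrite ltnS leq_eqVlt => /predU1P[->|dn] disp T P Z f mZ iZ lZ fI.
    by apply: le_trans (Hq' _ _ _ _ _ mZ iZ lZ fI); rewrite lee_fin ge_min lexx orbT.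
  have dn4 : (4 <= d < n)%N by apply/andP.
  by apply: le_trans (Hq _ dn4 _ _ _ _ _ mZ iZ lZ fI); rewrite lee_fin ge_min lexx.
have [q q0 Hq] := small D; exists (Num.min q 2^-1).
  by rewrite lt_min q0 /= invr_gt0.
move=> d d4; exists (d%:R * s2); first by rewrite mulr_gt0 // ltr0n (leq_trans _ d4).
move=> disp T P Z f mZ iZ lZ fI; have [dD|Dd] := ltnP d D.
  have dD4 : (4 <= d < D)%N by apply/andP.
  by apply: le_trans (Hq _ dD4 _ _ _ _ _ mZ iZ lZ fI); rewrite lee_fin ge_min lexx.
apply: (@le_trans _ _ (2^-1)%:E); first by rewrite lee_fin ge_min lexx orbT.
apply: near_event_large => //; rewrite [leRHS]mulrC -ler_pdivrMr //.
apply: le_trans (_ : D%:R <= _); last by rewrite ler_nat.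
by rewrite ltW // archi_boundP // divr_ge0 ?mulr_ge0 // ltW.
Qed.

(** An open set is the union of those boxes with rational centre and radius 1/(n+1) that it
    contains, and these are countably many. *)
Lemma measurable_open_preimage disp (T : measurableType disp) (R : realType) m n
    (A : T -> 'M[R]_(m, n)) (U : set 'M[R]_(m, n)) :
  (forall i j, measurable_fun setT (fun w => A w i j)) -> open U ->
  measurable (A @^-1` U).
Proof.
move=> mA oU.
pose box (k : 'M[rat]_(m, n) * nat) : set 'M[R]_(m, n) :=
  [set p | forall i j, `|p i j - ratr (k.1 i j)| < k.2.+1%:R^-1].
pose F k := if `[< box k `<=` U >] then A @^-1` box k else set0.
have -> : A @^-1` U = \bigcup_k F k.
  apply/seteqP; split=> [w Uw|w [k _]]; last first.
    by rewrite /F; case: asboolP => // kU /kU.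
  have /nbhs_ballP[e /= e0 eU] : nbhs (A w) U by exact: open_nbhs_nbhs.
  pose N := Num.bound (2 / e).
  have Ne : 2 / N.+1%:R < e.
    rewrite ltr_pdivrMr ?ltr0n // mulrC -ltr_pdivrMr //.
    apply: lt_trans (archi_boundP _) _; first by rewrite divr_ge0 // ltW.
    by rewrite ltr_nat ltnS.
  have N0 : 0 < N.+1%:R^-1 :> R by rewrite invr_gt0 ltr0n.
  have ex i j : exists q : rat, `|A w i j - ratr q| < N.+1%:R^-1.
    have [|q] := @rat_in_itvoo R (A w i j - N.+1%:R^-1) (A w i j + N.+1%:R^-1).
      by rewrite ltrBlDr -addrA ltrDl addr_gt0.
    rewrite in_itv /= => /andP[h1 h2]; exists q.
    rewrite ltr_norml; move: h1 h2; move: (_^-1) (ratr q) (A w i j) => a b x *.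
    by apply/andP; split; lra.
  pose Q : 'M[rat]_(m, n) := \matrix_(i, j) projT1 (cid (ex i j)).
  have QE i j : `|A w i j - ratr (Q i j)| < N.+1%:R^-1.
    by rewrite mxE; exact: projT2 (cid (ex i j)).
  exists (Q, N) => //; rewrite /F; case: asboolP => [_ i j|[]]; first exact: QE.
  move=> p pQ; apply: eU; split=> // i j; rewrite /ball /= /ball_.
  apply: le_lt_trans Ne; have := QE i j; have := pQ i j => /= h1 h2.
  rewrite (_ : A w i j - p i j = (A w i j - ratr (Q i j)) - (p i j - ratr (Q i j))); last by ring.
  apply: le_trans (ler_normB _ _) _; move: h1 h2; move: (_^-1) => a; lra.
apply: countable_bigcupT_measurable; first exact: countableP.
move=> k; rewrite /F; case: asboolP => // _.
have -> : A @^-1` box k = \bigcap_(ij in [set: 'I_m * 'I_n])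
    [set w | `|A w ij.1 ij.2 - ratr (k.1 ij.1 ij.2)| < k.2.+1%:R^-1].
  by apply/seteqP; split=> w H; [move=> ij _; apply: H|move=> i j; apply: (H (i, j))].
apply: fin_bigcap_measurable; first exact: finite_finset.
move=> [i j] _ /=.
have mh : measurable_fun setT (fun w => `|A w i j - ratr (k.1 i j)|).
  by apply: measurableT_comp => //; apply: measurable_funB.
have := mh measurableT _ (measurable_itv `]-oo, (k.2.+1%:R^-1)%R[); rewrite setTI.
by congr measurable; apply/seteqP; split=> w /=; rewrite in_itv.
Qed.

(** * Openness of the sufficient conditions *)

Section GoodSimplices.
Variables (R : realType) (d : nat).
Implicit Types p : 'M[R]_(d.+1, d).

Lemma nondegenerateE p : Defs.nondegenerate p = (\det (edge_mx p) != 0).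
Proof. by rewrite /Defs.nondegenerate row_free_unit unitmxE unitfE. Qed.

Lemma near_nondegenerate p : Defs.nondegenerate p ->
  \forall q \near p, Defs.nondegenerate q.
Proof.
rewrite nondegenerateE => p0.
have := polyf_continuous (@polyf_det_edge R d) (x := p).
under eq_fun do rewrite -/(coords _) coordsK.
move=> cp.
have H : \forall q \near p, \det (edge_mx q) != 0 by exact: (cvgr_neq0 _ cp p0).
by apply: filterS H => q; rewrite nondegenerateE.
Qed.

Lemma near_near_regular e c p f : near_regular e c p f ->
  \forall q \near p, near_regular e c q f.
Proof.
move=> nr.
have H (kl : 'I_5 * 'I_5) : \forall q \near p, kl.1 != kl.2 ->
    `|sqd q (f kl.1) (f kl.2) - c| < e * c.
  have [->|kl12] := eqVneq kl.1 kl.2; first by apply: filterE.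
  have pf : polyf finset.setT (fun x : _ -> R => sqd (simplex_of x) (f kl.1) (f kl.2) - c).
    apply: polyf_sub; last exact: polyf_cst.
    by apply: polyf_sqd => j; apply: polyf_simplex_of.
  have := polyf_continuous pf (x := p).
  under eq_fun do rewrite -/(coords _) coordsK.
  move=> cp.
  have H : \forall q \near p, `|sqd q (f kl.1) (f kl.2) - c| < e * c.
    exact: (cvgr_norm_lt _ cp _ (nr _ _ kl12)).
  by apply: filterS H.
apply: filterS (filter_forall _ H) => q Hq k l kl.
exact: (Hq (k, l) kl).
Qed.

End GoodSimplices.

(** * The entries of a Gaussian simplex *)

Section GaussianSimplex.
Context disp (T : measurableType disp) (R : realType) (P : probability T R) (d : nat).
Variable X : 'I_d.+1 -> {RV P >-> d.-tuple R}.

Definition entry (ij : 'I_d.+1 * 'I_d) (w : T) : R := tnth (X ij.1 w) ij.2.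

Lemma random_simplexE w : random_simplex X w = simplex_of (entry^~ w).
Proof. by apply/matrixP => i j; rewrite !mxE. Qed.

Lemma measurable_entry ij : measurable_fun setT (entry ij).
Proof. exact: measurableT_comp (measurable_tnth ij.2) (measurable_funPT (X ij.1)). Qed.

Hypothesis gX : forall i, standard_gaussian (X i).
Hypothesis indX : mutually_independent P (fun i => X i : T -> d.-tuple R).

Lemma entry_law ij (B : set R) : measurable B ->
  P (entry ij @^-1` B) = normal_prob 0 1 B.
Proof. by move=> mB; have [law _] := gX ij.1; rewrite -(law ij.2 B mB). Qed.

(** Conditions on entries are sorted by vertices into the sets [C i]; independence of the vertices
    splits over [i], and independence of the coordinates splits each factor. *)
Lemma entry_independent : mutually_independent P entry.
Proof.
move=> J B mB.
pose C (i : 'I_d.+1) : set (d.-tuple R) :=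
  \bigcap_(j in [set` [set j | (i, j) \in J]%SET]) (fun t => tnth t j) @^-1` B (i, j).
have mC i : measurable (C i).
  apply: fin_bigcap_measurable; first exact: finite_finset.
  by move=> j _; rewrite -[X in measurable X]setTI; apply: measurable_tnth.
have -> : \bigcap_(ij in [set` J]) entry ij @^-1` B ij =
    \bigcap_(i in [set` [set: 'I_d.+1]%SET]) (X i : T -> d.-tuple R) @^-1` C i.
  apply/seteqP; split=> w H.
    by move=> i _ j /=; rewrite inE => ijJ; apply: (H (i, j)).
  by move=> [i j] /= ijJ; apply: (H i); rewrite /= inE.
rewrite indX //.
rewrite (eq_bigr (fun i => \prod_(j | (i, j) \in J) P (entry (i, j) @^-1` B (i, j)))%E); last first.
  move=> i _; have [_ indi] := gX i.
  have := indi [set j | (i, j) \in J]%SET (fun j => B (i, j)) (fun j => mB (i, j)).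
  rewrite preimage_bigcap => ->.
  by apply: eq_bigl => j; rewrite inE.
rewrite (eq_bigl xpredT) => [|i]; last by rewrite inE.
by rewrite pair_big_dep /=; apply: eq_big => [[i j]|[i j] _].
Qed.

End GaussianSimplex.

(** * Disjoint blocks of five vertices *)

Section Blocks.
Context disp (T : measurableType disp) (R : realType) (P : probability T R) (d : nat).
Variable Z : 'I_d.+1 * 'I_d -> T -> R.
Hypothesis mZ : forall i, measurable_fun setT (Z i).
Hypothesis indZ : mutually_independent P Z.

Definition block (b : nat) (k : 'I_5) : 'I_d.+1 := inord (5 * b + k).

Let blockE b k : (b < d.+1 %/ 5)%N -> block b k = (5 * b + k)%N :> nat.
Proof. by move=> bm; rewrite inordK //; have := ltn_ord k; lia. Qed.

Lemma block_inj b : (b < d.+1 %/ 5)%N -> injective (block b).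
Proof.
by move=> bm k l /(congr1 val); rewrite /= !blockE // => h; apply/val_inj => /=; lia.
Qed.

Variables (e c q : R).
Hypothesis q_le : forall f, injective f -> (q%:E <= P (near_event Z e c f))%E.

Lemma near_block_prob : 0 <= q <= 1 ->
  ((1 - (1 - q) ^+ (d.+1 %/ 5))%:E <=
     P (\bigcup_(b < d.+1 %/ 5) near_event Z e c (block b)))%E.
Proof.
move=> /andP[q0 q1]; set m := (d.+1 %/ 5)%N.
have mE b : measurable (near_event Z e c (block b)) by exact: measurable_near_event.
have mU : measurable (\bigcup_(b < m) near_event Z e c (block b)).
  by apply: bigcup_measurable.
have disjB a b : (a < b < m)%N ->
    fintype.disjoint (mem (face_coords (block a))) (mem (face_coords (block b))).
  move=> /andP[ab bm]; have am := ltn_trans ab bm.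
  rewrite disjoint_subset; apply/fintype.subsetP => -[i j]; rewrite !inE /=.
  move=> /codomP[k ->]; apply/negP => /codomP[l /(congr1 val)].
  by rewrite /= !blockE // => h; have := ltn_ord k; have := ltn_ord l; lia.
have sE b : (b < m)%N -> sig Z (face_coords (block b)) (~` near_event Z e c (block b)).
  move=> _; pose TJ := g_sigma_algebraType (rects Z (face_coords (block b))).
  by apply: (@measurableC _ TJ); exact: sig_near_event.
have PI := sig_indep_seq mZ indZ disjB sE.
have PC : (P (~` \bigcup_(b < m) near_event Z e c (block b)) <= ((1 - q) ^+ m)%:E)%E.
  rewrite setC_bigcup PI.
  have fE (b : 'I_m) : P (~` near_event Z e c (block b)) = (fine (P (~` near_event Z e c (block b))))%:E.
    by rewrite fineK //; apply: fin_num_measure; exact: measurableC.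
  under eq_bigr do rewrite fE.
  rewrite prodEFin lee_fin -[in leRHS](card_ord m) -prodr_const.
  apply: ler_prod => b _; rewrite fine_ge0 //= -lee_fin -fE probability_setC //.
  have := q_le (@block_inj b (ltn_ord b)).
  have : P (near_event Z e c (block b)) \is a fin_num by apply: fin_num_measure.
  by case: (P _) => // r _; rewrite -EFinB !lee_fin; lra.
move: PC; rewrite probability_setC //.
have : P (\bigcup_(b < m) near_event Z e c (block b)) \is a fin_num by apply: fin_num_measure.
by case: (P _) => // r _; rewrite -EFinB !lee_fin; lra.
Qed.

End Blocks.

(** Uses 1 - q <= exp(-q) and d <= 9 * floor((d + 1) / 5), valid for d >= 4; this is the source of
    the 9 in the exponent. *)
Lemma pow_le_expR (R : realType) (q : R) d : 0 <= q <= 1 -> (4 <= d)%N ->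
  (1 - q) ^+ (d.+1 %/ 5) <= expR (- (q / 9 * d%:R)).
Proof.
move=> /andP[q0 q1] d4.
have h : 1 - q <= expR (- q) by have := expR_ge1Dx (- q).
apply: (@le_trans _ _ (expR (- q) ^+ (d.+1 %/ 5))).
  by rewrite lerXn2r ?nnegrE ?expR_ge0 // subr_ge0.
rewrite -expRM_natr ler_expR mulNr lerN2.
rewrite -mulrA ler_wpM2l // mulrC ler_pdivrMr // -natrM ler_nat.
by lia.
Qed.

(** * Almost sure nondegeneracy and absence of ties *)

Section AlmostSure.
Context disp (T : measurableType disp) (R : realType) (P : probability T R) (d : nat).
Variable Z : 'I_d.+1 * 'I_d -> T -> R.
Hypothesis mZ : forall i, measurable_fun setT (Z i).
Hypothesis indZ : mutually_independent P Z.
Hypothesis lawZ : forall i (B : set R), measurable B ->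
  P (Z i @^-1` B) = normal_prob 0 1 B.

Let atomless i x : P (Z i @^-1` [set x]) = 0%E.
Proof. by rewrite lawZ // normal_prob1. Qed.

Lemma degenerate_null : P [set w | \det (edge_mx (simplex_of (Z^~ w))) = 0] = 0%E.
Proof.
have [x x0] := exists_nondegenerate R d.
exact: (polyf_null mZ indZ atomless (polyf_det_edge R d) x0).
Qed.

Lemma tie_free_ae : (0 < d)%N -> {ae P, forall w, tie_free (simplex_of (Z^~ w))}.
Proof.
move=> d0.
pose tie (t : seq ('I_d.+1 * 'I_d.+1) * ('I_d.+1 * 'I_d.+1) * ('I_d.+1 * 'I_d.+1)) : set T :=
  let: (ms, e, e') := t in
  [set w | [/\ proper_moves ms, edges_differ e e' &
    sqd (bisects ms (simplex_of (Z^~ w))) e.1 e.2 -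
    sqd (bisects ms (simplex_of (Z^~ w))) e'.1 e'.2 = 0]].
have tie0 t : P.-negligible (tie t).
  case: t => [[ms e] e'] /=; have [pm|npm] := boolP (proper_moves ms); last first.
    by apply: negligibleS (negligible_set0 P) => w [].
  have [ed|ned] := boolP (edges_differ e e'); last first.
    by apply: negligibleS (negligible_set0 P) => w [].
  have [x x0] := exists_no_tie R d0 pm ed.
  have pf : polyf finset.setT (fun x : _ -> R => sqd (bisects ms (simplex_of x)) e.1 e.2 -
      sqd (bisects ms (simplex_of x)) e'.1 e'.2).
    have pb k l : polyf finset.setT (fun x : _ -> R => bisects ms (simplex_of x) k l).
      by apply: polyf_bisects; exact: polyf_simplex_of.
    by apply: polyf_sub; apply: (polyf_sqd (A := fun x => bisects ms (simplex_of x))) => j; apply: pb.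
  have nl := polyf_null mZ indZ atomless pf x0.
  apply: negligibleS (_ : P.-negligible _) => [w [_ _ h]|]; first exact: h.
  apply/negligibleP => //.
  have := polyf_measurable mZ pf measurableT (measurable_set1 0).
  by rewrite setTI.
pose F n := if unpickle n is Some t then tie t else set0.
have FN : P.-negligible (\bigcup_n F n).
  apply: negligible_bigcup => n; rewrite /F; case: (unpickle n) => [t|]; first exact: tie0.
  exact: negligible_set0.
apply: negligibleS FN => w /= nt; apply: contrapT => H; apply: nt.
apply: tie_freeP => // ms e e' pm ed; apply/negP => /eqP h; apply: H.
exists (pickle (ms, e, e')) => //; rewrite /F pickleK /=; split=> //.
by rewrite h subrr.
Qed.

End AlmostSure.

Theorem corollary1p4 (R : realType) :
  exists c : R, 0 < c /\
  forall (d : nat) (disp : measure_display) (T : measurableType disp)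
    (P : probability T R) (X : 'I_d.+1 -> {RV P >-> d.-tuple R}),
  (4 <= d)%N ->
  (forall i, standard_gaussian (X i)) ->
  mutually_independent P (fun i => X i : T -> d.-tuple R) ->
  [/\ ((1 - expR (- (c * d%:R)))%:E
         <= inner_probability P
              (random_simplex X @^-1` @has_degenerating_branch R d))%E,
      measurable
        (random_simplex X @^-1` interior (@has_degenerating_branch R d)),
      ((1 - expR (- (c * d%:R)))%:E
         <= P (random_simplex X @^-1`
                 interior (@has_degenerating_branch R d)))%E
    & {ae P, forall w, tie_free (random_simplex X w)}].
Proof.
have [e e0 He] := near_regular_degenerates R.
have [q0 q0_gt0 Hq] := near_event_uniform e0.
(* The cap 1 keeps [1 - q] nonnegative. *)
pose q := Num.min q0 1.
have q_gt0 : 0 < q by rewrite lt_min q0_gt0 ltr01.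
have q01 : 0 <= q <= 1 by rewrite ltW // ge_min lexx orbT.
exists (q / 9); split; first by rewrite divr_gt0.
move=> d disp T P X d4 gX indX.
have mZ := measurable_entry X.
have indZ := entry_independent gX indX.
have lawZ := entry_law gX.
have [c c0 Hc] := Hq d d4.
have HZ f : injective f -> (q%:E <= P (near_event (entry X) e c f))%E.
  move=> fI; apply: le_trans (Hc _ _ _ _ _ mZ indZ lawZ fI).
  by rewrite lee_fin ge_min lexx.
pose m := (d.+1 %/ 5)%N.
pose G := \bigcup_(b < m) near_event (entry X) e c (block d b).
pose D := [set w | \det (edge_mx (simplex_of ((entry X)^~ w))) = 0].
have mG : measurable G by apply: bigcup_measurable => b _; exact: measurable_near_event.
have mD : measurable D.
  have := polyf_measurable mZ (polyf_det_edge R d) measurableT (measurable_set1 0).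
  by rewrite setTI.
have mGD : measurable (G `\` D) by exact: measurableD.
(* Near regularity concerns five vertices only, so degenerate simplices have to be removed; they
   form a null set. *)
have PG : ((1 - expR (- (q / 9 * d%:R)))%:E <= P (G `\` D))%E.
  apply: (@le_trans _ _ (P G)).
    apply: le_trans (near_block_prob mZ indZ HZ q01).
    by rewrite lee_fin lerB // pow_le_expR.
  have -> : P (G `\` D) = (P (G `\` D) + P D)%E.
    by rewrite (degenerate_null mZ indZ lawZ) adde0.
  apply: le_trans (measureU2 P mGD mD); apply: le_measure; rewrite ?inE //.
    exact: measurableU.
  by move=> w Gw; have [Dw|nD] := pselect (D w); [right|left].
have mI : measurable (random_simplex X @^-1` interior (@has_degenerating_branch R d)).
  apply: measurable_open_preimage; last exact: open_interior.
  by move=> i j; under eq_fun do rewrite mxE; exact: (mZ (i, j)).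
have GI : G `\` D `<=` random_simplex X @^-1` interior (@has_degenerating_branch R d).
  move=> w [[b /= bm nr] nD]; rewrite /preimage /= random_simplexE.
  set p := simplex_of _ in nr *.
  have np : Defs.nondegenerate p by rewrite nondegenerateE; apply/eqP.
  (* Both conditions are open for fixed [e] and [c], so a whole neighbourhood has degenerating
     branches. *)
  apply: filterS2 (near_nondegenerate np) (near_near_regular nr) => p' np' nr'.
  exact: He (block_inj bm) c0 np' nr'.
have PI : ((1 - expR (- (q / 9 * d%:R)))%:E
    <= P (random_simplex X @^-1` interior (@has_degenerating_branch R d)))%E.
  by apply: le_trans PG _; apply: le_measure; rewrite ?inE.
split=> //.
  (* The preimage of the interior serves as measurable event inside the one whose measurability is
     not asserted. *)
  apply: le_trans PI _; apply: ereal_sup_ubound.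
  exists (random_simplex X @^-1` interior (@has_degenerating_branch R d)) => //.
  by split=> // w; exact: interior_subset.
have := tie_free_ae mZ indZ lawZ (leq_trans _ d4); move/(_ isT).
by apply: filterS => w; rewrite random_simplexE.
Qed.
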